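(* Let $n\ge 3$ be an integer, let $\boldsymbol r=(r_1,\dots,r_n)$ be a sequence of integers greater than $1$, and put $\lambda_1=\infty$, $\lambda_2=0$, $\lambda_3=1$. For any $(\lambda_4,\dots,\lambda_n)\in\mathbb A^{n-3}$ (coincidences among the $\lambda_i$ are allowed), with $\boldsymbol\lambda=(\lambda_1,\dots,\lambda_n)$, one has an isomorphism of stacks $$\mathbf X_{\boldsymbol r,\boldsymbol\lambda}\;\simeq\;\mathbf X_{r_1,\lambda_1}\times_{\mathbb P^1}\mathbf X_{r_2,\lambda_2}\times_{\mathbb P^1}\cdots\times_{\mathbb P^1}\mathbf X_{r_n,\lambda_n}.$$
   Context: We work over an algebraically closed field $\mathbf k$ of characteristic zero. An element $\lambda\in\mathbf k=\mathbb A^1$ is identified with $[\lambda:1]\in\mathbb P^1$, and $\infty=[1:0]$. Definition of $\mathbf X_{\boldsymbol r,\boldsymbol\lambda}$: let $L$ be the abelian group generated by $\vec c,\vec x_1,\dots,\vec x_n$ with relations $\vec c=r_i\vec x_i$ for $i=1,\dots,n$, and let $L^\vee=\operatorname{Spec}\mathbf k[L]$ be its Cartier dual. Let $$S=S_{\boldsymbol r,\boldsymbol\lambda}=\mathbf k[x_1,\dots,x_n]\big/\big(x_i^{r_i}-x_2^{r_2}+\lambda_i x_1^{r_1}\big)_{i=3}^n ,$$ which is $L$-graded by $\deg x_i=\vec x_i$, so that $L^\vee$ acts on $\operatorname{Spec}S$ with coaction $x_i\mapsto \vec x_i\otimes x_i$. Then $\mathbf X_{\boldsymbol r,\boldsymbol\lambda}=[(\operatorname{Spec}S\setminus\boldsymbol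 0)/L^\vee]$ (stack quotient), where $\boldsymbol 0$ is the origin $x_1=\dots=x_n=0$. For an integer $r>1$ and a point $\lambda\in\mathbb P^1$, $\mathbf X_{r,\lambda}\to\mathbb P^1$ denotes the stack obtained from $\mathbb P^1$ by the $r$-th root construction at the point (reduced divisor) $\lambda$. The fiber product is taken in the ($2$-)category of stacks along the structure morphisms to $\mathbb P^1$. *)

(* Defs.v *)
(* Stacks over k are presented as categories over the category of affine
   k-schemes (a stack on Sch/k is determined by its restriction to affine
   schemes).  Everything is written on the side of algebras: an affine k-scheme
   Spec R is a commutative k-algebra R, possibly zero, and an arrow x -> y lying
   over a homomorphism R -> R' below is what is usually drawn as an arrow
   y -> x lying over Spec R' -> Spec R.  In particular the fibred categories
   below have only (co)cartesian arrows: they are fibred in groupoids.  Descent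
   is not part of the data, as an isomorphism of stacks is an equivalence of the
   underlying fibred categories. *)
From HB Require Import structures.
From mathcomp Require Import all_boot all_order all_algebra.
From mathcomp Require Import generic_quotient ring_quotient.
From mathcomp Require Import boolp.
From mathcomp Require Import mpoly.

Set Implicit Arguments.
Unset Strict Implicit.
Unset Printing Implicit Defensive.

Import GRing.Theory.
Local Open Scope ring_scope.
Local Open Scope quotient_scope.

Record kalg (k : closedFieldType) := Kalg {
  kring :> comPzRingType;
  kstr : {rmorphism k -> kring} }.

Record kmor (k : closedFieldType) (R R' : kalg k) := Kmor {
  kfun :> {rmorphism R -> R'};
  kfunE : forall c, kfun (kstr R c) = kstr R' c }.

Lemma rmorph_eq (R R' : pzRingType) (f g : {rmorphism R -> R'}) : f =1 g -> f = g.
Proof.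
case: f g => f [[fa] [fm]] [g [[ga] [gm]]] /= /funext fg; subst g.
by rewrite (Prop_irrelevance fa ga) (Prop_irrelevance fm gm).
Qed.

Lemma kmor_eq (k : closedFieldType) (R R' : kalg k) (f g : kmor R R') :
  f =1 g -> f = g.
Proof.
case: f g => f fE [g gE] /= /rmorph_eq fg; subst g.
by rewrite (Prop_irrelevance fE gE).
Qed.

Definition kid (k : closedFieldType) (R : kalg k) : kmor R R :=
  @Kmor k R R idfun (fun _ => erefl).

Definition kcomp (k : closedFieldType) (R R' R'' : kalg k)
  (f : kmor R R') (g : kmor R' R'') : kmor R R''.
Proof. by exists (g \o f : {rmorphism R -> R''}) => c /=; rewrite !kfunE. Defined.

Record fibcat (k : closedFieldType) := Fibcat {
  fob :> kalg k -> Type;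
  fhom : forall R R', fob R -> fob R' -> Type;
  fover : forall R R' (x : fob R) (y : fob R'), fhom x y -> kmor R R';
  fid : forall R (x : fob R), fhom x x;
  fcomp : forall R R' R'' (x : fob R) (y : fob R') (z : fob R''),
    fhom x y -> fhom y z -> fhom x z;
  fover_id : forall R (x : fob R), fover (fid x) = kid R;
  fover_comp : forall R R' R'' (x : fob R) (y : fob R') (z : fob R'')
    (f : fhom x y) (g : fhom y z), fover (fcomp f g) = kcomp (fover f) (fover g);
  fcomp1l : forall R R' (x : fob R) (y : fob R') (f : fhom x y),
    fcomp (fid x) f = f;
  fcomp1r : forall R R' (x : fob R) (y : fob R') (f : fhom x y),
    fcomp f (fid y) = f;
  fcompA : forall R R' R'' R''' (x : fob R) (y : fob R') (z : fob R'')
    (t : fob R''') (f : fhom x y) (g : fhom y z) (h : fhom z t),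
    fcomp f (fcomp g h) = fcomp (fcomp f g) h }.

Arguments fid {k X R} x : rename.

Record ffunctor (k : closedFieldType) (X Y : fibcat k) := Ffunctor {
  fnob :> forall R, X R -> Y R;
  fnhom : forall R R' (x : X R) (y : X R'), fhom x y -> fhom (fnob x) (fnob y);
  fn_over : forall R R' (x : X R) (y : X R') (f : fhom x y),
    fover (fnhom f) = fover f;
  fn_id : forall R (x : X R), fnhom (fid x) = fid (fnob x);
  fn_comp : forall R R' R'' (x : X R) (y : X R') (z : X R'')
    (f : fhom x y) (g : fhom y z), fnhom (fcomp f g) = fcomp (fnhom f) (fnhom g) }.

Definition fidfun (k : closedFieldType) (X : fibcat k) : ffunctor X X :=
  @Ffunctor k X X (fun _ x => x) (fun _ _ _ _ f => f)
    (fun _ _ _ _ _ => erefl) (fun _ _ => erefl) (fun _ _ _ _ _ _ _ _ => erefl).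

Definition fcompfun (k : closedFieldType) (X Y Z : fibcat k)
  (F : ffunctor X Y) (G : ffunctor Y Z) : ffunctor X Z.
Proof.
exists (fun R x => G R (F R x)) (fun R R' x y f => fnhom G (fnhom F f)).
- by move=> R R' x y f; rewrite !fn_over.
- by move=> R x; rewrite !fn_id.
- by move=> R R' R'' x y z f g; rewrite !fn_comp.
Defined.

(* isomorphisms in the fibre over R *)
Record fiso (k : closedFieldType) (X : fibcat k) (R : kalg k) (x y : X R) := Fiso {
  iso_fun :> fhom x y;
  iso_inv : fhom y x;
  iso_fun_over : fover iso_fun = kid R;
  iso_inv_over : fover iso_inv = kid R;
  iso_funK : fcomp iso_fun iso_inv = fid x;
  iso_invK : fcomp iso_inv iso_fun = fid y }.

Record natiso (k : closedFieldType) (X Y : fibcat k) (F G : ffunctor X Y) := Natiso {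
  nt :> forall R (x : X R), fiso (F R x) (G R x);
  nt_natural : forall R R' (x : X R) (y : X R') (f : fhom x y),
    fcomp (fnhom F f) (nt y) = fcomp (nt x) (fnhom G f) }.

(* equivalence over affine k-schemes; for stacks, this is an isomorphism of stacks *)
Definition equivalent (k : closedFieldType) (X Y : fibcat k) : Prop :=
  exists (F : ffunctor X Y) (G : ffunctor Y X),
    inhabited (natiso (fcompfun F G) (fidfun X)) /\
    inhabited (natiso (fcompfun G F) (fidfun Y)).

(* The 2-fibre product of a family p i : X i -> B of categories over B: an object
   is an object b of B, objects x i of X i, and isomorphisms b ~ p i (x i). *)
Record fibprod_ob (k : closedFieldType) (B : fibcat k) (I : Type) (X : I -> fibcat k)
  (p : forall i, ffunctor (X i) B) (R : kalg k) := FprodOb {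
  fp_base : B R;
  fp_comp : forall i, X i R;
  fp_iso : forall i, fiso fp_base (p i R (fp_comp i)) }.

Record fibprod_hom (k : closedFieldType) (B : fibcat k) (I : Type) (X : I -> fibcat k)
  (p : forall i, ffunctor (X i) B) (R R' : kalg k)
  (x : fibprod_ob p R) (y : fibprod_ob p R') := FprodHom {
  fph_base : fhom (fp_base x) (fp_base y);
  fph_comp : forall i, fhom (fp_comp x i) (fp_comp y i);
  fph_over : forall i, fover (fph_comp i) = fover fph_base;
  fph_iso : forall i, fcomp fph_base (fp_iso y i)
    = fcomp (fp_iso x i) (fnhom (p i) (fph_comp i)) }.

Lemma fibprod_hom_eq (k : closedFieldType) (B : fibcat k) (I : Type)
  (X : I -> fibcat k) (p : forall i, ffunctor (X i) B) (R R' : kalg k)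
  (x : fibprod_ob p R) (y : fibprod_ob p R') (f g : fibprod_hom x y) :
  fph_base f = fph_base g -> (forall i, fph_comp f i = fph_comp g i) -> f = g.
Proof.
case: f g => f0 f fo fi [g0 g go gi] /= e0 e; subst g0.
have {}e : f = g by exact: functional_extensionality_dep.
by subst g; rewrite (Prop_irrelevance fo go) (Prop_irrelevance fi gi).
Qed.

Definition fibprod_id (k : closedFieldType) (B : fibcat k) (I : Type)
  (X : I -> fibcat k) (p : forall i, ffunctor (X i) B) (R : kalg k)
  (x : fibprod_ob p R) : fibprod_hom x x.
Proof.
exists (fid _) (fun i => fid _) => i; first by rewrite !fover_id.
by rewrite fn_id fcomp1l fcomp1r.
Defined.

Definition fibprod_comp (k : closedFieldType) (B : fibcat k) (I : Type)
  (X : I -> fibcat k) (p : forall i, ffunctor (X i) B) (R R' R'' : kalg k)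
  (x : fibprod_ob p R) (y : fibprod_ob p R') (z : fibprod_ob p R'')
  (f : fibprod_hom x y) (g : fibprod_hom y z) : fibprod_hom x z.
Proof.
exists (fcomp (fph_base f) (fph_base g))
       (fun i => fcomp (fph_comp f i) (fph_comp g i)) => i.
  by rewrite !fover_comp !fph_over.
by rewrite -fcompA fph_iso fcompA fph_iso fn_comp fcompA.
Defined.

Definition fibprod (k : closedFieldType) (B : fibcat k) (I : Type)
  (X : I -> fibcat k) (p : forall i, ffunctor (X i) B) : fibcat k.
Proof.
refine (@Fibcat k (fibprod_ob p) (@fibprod_hom k B I X p)
  (fun _ _ _ _ f => fover (fph_base f)) (@fibprod_id k B I X p)
  (@fibprod_comp k B I X p) _ _ _ _ _).
- by move=> R x; rewrite fover_id.
- by move=> R R' R'' x y z f g; rewrite fover_comp.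
- by move=> R R' x y f; apply: fibprod_hom_eq => [|i] /=; rewrite fcomp1l.
- by move=> R R' x y f; apply: fibprod_hom_eq => [|i] /=; rewrite fcomp1r.
- by move=> *; apply: fibprod_hom_eq => [|i] /=; rewrite fcompA.
Defined.

Definition semilinear_along (R R' : comPzRingType) (f : R -> R')
  (M : lmodType R) (M' : lmodType R') (j : M -> M') : Prop :=
  forall a x y, j (a *: x + y) = f a *: j x + j y.

(* j exhibits M' as the tensor product of M with R' over R; this is stated as
   j being a cocartesian arrow over f in the category of modules over varying
   rings *)
Definition is_base_change (R R' : comPzRingType) (f : R -> R')
  (M : lmodType R) (M' : lmodType R') (j : M -> M') : Prop :=
  semilinear_along f j /\
  forall (R'' : comPzRingType) (g : {rmorphism R' -> R''}) (N : lmodType R'')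
    (h : M -> N), semilinear_along (g \o f) h ->
    exists! h' : M' -> N, semilinear_along g h' /\ forall x, h' (j x) = h x.

Lemma is_base_change_id (R : comPzRingType) (M : lmodType R) :
  is_base_change idfun (id : M -> M).
Proof.
split=> [a x y|R'' g N h hl] //; exists h; split; first by split.
by move=> h' [_ e]; apply: funext => x; rewrite e.
Qed.

Lemma is_base_change_comp (R R' R'' : comPzRingType) (f : {rmorphism R -> R'})
  (g : {rmorphism R' -> R''}) (M : lmodType R) (M' : lmodType R')
  (M'' : lmodType R'') (i : M -> M') (j : M' -> M'') :
  is_base_change f i -> is_base_change g j -> is_base_change (g \o f) (j \o i).
Proof.
move=> [il iu] [jl ju]; split=> [a x y|S h N t tl] /=; first by rewrite il jl.
have [t1 [[t1l t1E] t1u]] := iu S (h \o g) N t tl.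
have [t2 [[t2l t2E] t2u]] := ju S h N t1 t1l.
exists t2; split; first by split=> // x /=; rewrite t2E t1E.
move=> t3 [t3l t3E]; apply: t2u; split=> // x.
suff -> : t1 = t3 \o j by [].
by apply: t1u; split=> // a y z /=; rewrite jl t3l.
Qed.

Definition bilinear_map (R : comPzRingType) (M N P : lmodType R) (b : M -> N -> P) : Prop :=
  (forall x, linear (b x)) /\ (forall y, linear (b^~ y)).

Definition is_tensor (R : comPzRingType) (M N T : lmodType R) (b : M -> N -> T) : Prop :=
  bilinear_map b /\
  forall (P : lmodType R) (c : M -> N -> P), bilinear_map c ->
    exists! h : T -> P, linear h /\ forall x y, h (b x y) = c x y.

(* line bundles on Spec R, as modules with an inverse for the tensor product *)
Definition invertible (R : comPzRingType) (M : lmodType R) : Prop :=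
  exists (N : lmodType R) (b : M -> N -> R^o), is_tensor b.

Definition multilinear (R : comPzRingType) (r : nat) (M N : lmodType R)
  (phi : ('I_r -> M) -> N) : Prop :=
  forall (x : 'I_r -> M) (i : 'I_r) (a : R) (u v : M),
    phi [eta x with i |-> a *: u + v]
    = a *: phi [eta x with i |-> u] + phi [eta x with i |-> v].

(* phi exhibits N as the r-th tensor power of M, i.e. phi is (the multilinear map
   attached to) an isomorphism from the r-th tensor power of M to N *)
Definition is_tensor_power (R : comPzRingType) (r : nat) (M N : lmodType R)
  (phi : ('I_r -> M) -> N) : Prop :=
  multilinear phi /\
  forall (P : lmodType R) (psi : ('I_r -> M) -> P), multilinear psi ->
    exists! h : N -> P, linear h /\ forall x, h (phi x) = psi x.

Definition exact_at (R : comPzRingType) (M1 M2 M3 : lmodType R)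
  (u : M1 -> M2) (v : M2 -> M3) : Prop :=
  forall x, v x = 0 <-> exists y, u y = x.

Definition faithfully_flat (R A : comPzRingType) (f : {rmorphism R -> A}) : Prop :=
  forall (M1 M2 M3 : lmodType R) (u : {linear M1 -> M2}) (v : {linear M2 -> M3})
    (M1' M2' M3' : lmodType A) (u' : {linear M1' -> M2'}) (v' : {linear M2' -> M3'})
    (j1 : M1 -> M1') (j2 : M2 -> M2') (j3 : M3 -> M3'),
    is_base_change f j1 -> is_base_change f j2 -> is_base_change f j3 ->
    (forall x, u' (j1 x) = j2 (u x)) -> (forall x, v' (j2 x) = j3 (v x)) ->
    (exact_at u v <-> exact_at u' v').

(* The functor of points of P^1, as the groupoid of line bundles N = O(1) with two
   generating sections u = X_0 and v = X_1; such triples have no nontrivial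
   automorphism. The point [a : b] of P^1(k) is given by u = a, v = b in k. *)
Record p1ob (k : closedFieldType) (R : kalg k) := P1ob {
  p1mod :> lmodType R;
  p1inv : invertible p1mod;
  p1u : p1mod;
  p1v : p1mod;
  p1gen : forall x, exists a b : R, x = a *: p1u + b *: p1v }.

Record p1hom (k : closedFieldType) (R R' : kalg k) (x : p1ob R) (y : p1ob R') := P1hom {
  p1h_over : kmor R R';
  p1h_fun : x -> y;
  p1h_bc : is_base_change p1h_over p1h_fun;
  p1h_u : p1h_fun (p1u x) = p1u y;
  p1h_v : p1h_fun (p1v x) = p1v y }.

Lemma p1hom_eq (k : closedFieldType) (R R' : kalg k) (x : p1ob R) (y : p1ob R')
  (f g : p1hom x y) :
  p1h_over f = p1h_over g -> p1h_fun f =1 p1h_fun g -> f = g.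
Proof.
case: f g => f0 f fb fu fv [g0 g gb gu gv] /= e0 /funext e; subst g0 g.
by rewrite (Prop_irrelevance fb gb) (Prop_irrelevance fu gu)
           (Prop_irrelevance fv gv).
Qed.

Definition p1_id (k : closedFieldType) (R : kalg k) (x : p1ob R) : p1hom x x :=
  @P1hom k R R x x (kid R) id (is_base_change_id x) erefl erefl.

Definition p1_comp (k : closedFieldType) (R R' R'' : kalg k)
  (x : p1ob R) (y : p1ob R') (z : p1ob R'')
  (f : p1hom x y) (g : p1hom y z) : p1hom x z.
Proof.
exists (kcomp (p1h_over f) (p1h_over g)) (p1h_fun g \o p1h_fun f).
- exact: is_base_change_comp (p1h_bc f) (p1h_bc g).
- by rewrite /= !p1h_u.
- by rewrite /= !p1h_v.
Defined.

Definition P1 (k : closedFieldType) : fibcat k.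
Proof.
refine (@Fibcat k (@p1ob k) (@p1hom k) (@p1h_over k) (@p1_id k) (@p1_comp k)
  _ _ _ _ _) => // *; apply: p1hom_eq => //; exact: kmor_eq.
Defined.

(* k-points of P^1: pfin a is [a : 1] and pinf is [1 : 0] *)
Inductive p1pt (k : closedFieldType) := pfin of k | pinf.
Arguments pinf {k}.

(* the section of O(1) whose divisor of zeros is the point *)
Definition p1form (k : closedFieldType) (pt : p1pt k) (R : kalg k) (x : p1ob R) : x :=
  match pt with
  | pfin a => p1u x - kstr R a *: p1v x
  | pinf => p1v x
  end.

(* The r-th root stack of P^1 at pt: a map to P^1, a line bundle M with a section s,
   and an isomorphism of the r-th tensor power of M with the pullback of O(pt) = O(1)
   carrying the r-th power of s to the section cutting out pt. *)
Record root_ob (k : closedFieldType) (r : nat) (pt : p1pt k) (R : kalg k) := RootOb {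
  rt_p1 : p1ob R;
  rt_mod : lmodType R;
  rt_inv : invertible rt_mod;
  rt_sec : rt_mod;
  rt_pow : ('I_r -> rt_mod) -> rt_p1;
  rt_powP : is_tensor_power rt_pow;
  rt_pow_sec : rt_pow (fun=> rt_sec) = p1form pt rt_p1 }.

Record root_hom (k : closedFieldType) (r : nat) (pt : p1pt k) (R R' : kalg k)
  (x : root_ob r pt R) (y : root_ob r pt R') := RootHom {
  rth_p1 : p1hom (rt_p1 x) (rt_p1 y);
  rth_fun : rt_mod x -> rt_mod y;
  rth_bc : is_base_change (p1h_over rth_p1) rth_fun;
  rth_sec : rth_fun (rt_sec x) = rt_sec y;
  rth_pow : forall m, p1h_fun rth_p1 (rt_pow m) = rt_pow (rth_fun \o m) }.

Lemma root_hom_eq (k : closedFieldType) (r : nat) (pt : p1pt k) (R R' : kalg k)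
  (x : root_ob r pt R) (y : root_ob r pt R') (f g : root_hom x y) :
  rth_p1 f = rth_p1 g -> rth_fun f =1 rth_fun g -> f = g.
Proof.
case: f g => f0 f fb fs fp [g0 g gb gs gp] /= e0 /funext e; subst g0 g.
by rewrite (Prop_irrelevance fb gb) (Prop_irrelevance fs gs)
           (Prop_irrelevance fp gp).
Qed.

Definition root_id (k : closedFieldType) (r : nat) (pt : p1pt k) (R : kalg k)
  (x : root_ob r pt R) : root_hom x x :=
  @RootHom k r pt R R x x (p1_id (rt_p1 x)) id (is_base_change_id (rt_mod x))
    erefl (fun _ => erefl).

Definition root_comp (k : closedFieldType) (r : nat) (pt : p1pt k)
  (R R' R'' : kalg k) (x : root_ob r pt R) (y : root_ob r pt R')
  (z : root_ob r pt R'') (f : root_hom x y) (g : root_hom y z) : root_hom x z.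
Proof.
exists (p1_comp (rth_p1 f) (rth_p1 g)) (rth_fun g \o rth_fun f).
- exact: is_base_change_comp (rth_bc f) (rth_bc g).
- by rewrite /= !rth_sec.
- by move=> m /=; rewrite !rth_pow.
Defined.

Definition root_stack (k : closedFieldType) (r : nat) (pt : p1pt k) : fibcat k.
Proof.
refine (@Fibcat k (@root_ob k r pt) (@root_hom k r pt)
  (fun _ _ _ _ f => p1h_over (rth_p1 f)) (@root_id k r pt) (@root_comp k r pt)
  _ _ _ _ _) => // *; apply: root_hom_eq => //=;
  apply: p1hom_eq => //; exact: kmor_eq.
Defined.

Definition root_to_P1 (k : closedFieldType) (r : nat) (pt : p1pt k) :
  ffunctor (root_stack r pt) (P1 k) :=
  @Ffunctor k (root_stack r pt) (P1 k) (@rt_p1 k r pt) (@rth_p1 k r pt)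
    (fun _ _ _ _ _ => erefl) (fun _ _ => erefl) (fun _ _ _ _ _ _ _ _ => erefl).

(* A coaction of the Hopf algebra of the diagonalizable group D(L) = Spec k[L] on the
   R-algebra eta : R -> A, a |-> \sum_l (gcomp l a) (x) l, that is, an L-grading of
   this R-algebra; gcomp l is the projection onto the component of degree l. *)
Record grading (L : zmodType) (R A : comPzRingType) (eta : R -> A) := Grading {
  gcomp :> L -> A -> A;
  gcompB : forall l, {morph gcomp l : a b / a - b};
  gcomp_sum : forall a, exists s : seq L, uniq s /\ a = \sum_(l <- s) gcomp l a;
  gcompK : forall l m a, gcomp l (gcomp m a) = if l == m then gcomp m a else 0;
  gcompM : forall l m a b,
    gcomp (l + m) (gcomp l a * gcomp m b) = gcomp l a * gcomp m b;
  gcomp_scal : forall c, gcomp 0 (eta c) = eta c }.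

(* B-points of D(L) *)
Definition is_character (L : zmodType) (B : comPzRingType) (chi : L -> B) : Prop :=
  chi 0 = 1 /\ forall l m, chi (l + m) = chi l * chi m.

(* A D(L)-torsor P -> Spec R, for the fppf topology. It is affine, so P = Spec A,
   and what is required is that A is faithfully flat over R and that
   D(L) x P -> P x_{Spec R} P is an isomorphism. The latter is expressed on
   B-points: D(L)(B) acts simply transitively on the points f : A -> B of P over
   a given point of Spec R. The action sends f to a |-> f a * chi l on
   elements a of degree l.  (For a finitely generated L, A is automatically of
   finite presentation over R by descent.) *)
Record torsor (L : zmodType) (R : comPzRingType) := Torsor {
  tring :> comPzRingType;
  tstr : {rmorphism R -> tring};
  tgr : grading L tstr;
  tff : faithfully_flat tstr;
  tsimple : forall (B : comPzRingType) (f g : {rmorphism tring -> B}),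
    (forall c, f (tstr c) = g (tstr c)) ->
    exists! chi : L -> B, is_character chi /\
      forall l a, g (tgr l a) = f (tgr l a) * chi l }.

(* The quotient stack [(Spec S \ V(J)) / D(L)], where S is an L-graded k-algebra and
   V(J) is the closed subset defined by the vanishing of the elements J i: torsors P
   with an equivariant map P -> Spec S which avoids V(J). *)
Record quot_ob (k : closedFieldType) (L : zmodType) (S : kalg k)
  (gr : grading L (kstr S)) (N : nat) (J : 'I_N -> S) (R : kalg k) := QuotOb {
  qt_tor : torsor L R;
  qt_map : {rmorphism S -> qt_tor};
  qt_k : forall c, qt_map (kstr S c) = tstr qt_tor (kstr R c);
  qt_equiv : forall l a, qt_map (gr l a) = tgr qt_tor l (qt_map a);
  qt_avoid : exists c : 'I_N -> qt_tor, \sum_i c i * qt_map (J i) = 1 }.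

Record quot_hom (k : closedFieldType) (L : zmodType) (S : kalg k)
  (gr : grading L (kstr S)) (N : nat) (J : 'I_N -> S) (R R' : kalg k)
  (x : quot_ob gr J R) (y : quot_ob gr J R') := QuotHom {
  qth_over : kmor R R';
  qth_fun : {rmorphism qt_tor x -> qt_tor y};
  qth_str : forall c, qth_fun (tstr (qt_tor x) c) = tstr (qt_tor y) (qth_over c);
  qth_equiv : forall l a, qth_fun (tgr (qt_tor x) l a) = tgr (qt_tor y) l (qth_fun a);
  qth_map : forall a, qth_fun (qt_map x a) = qt_map y a }.

Lemma quot_hom_eq (k : closedFieldType) (L : zmodType) (S : kalg k)
  (gr : grading L (kstr S)) (N : nat) (J : 'I_N -> S) (R R' : kalg k)
  (x : quot_ob gr J R) (y : quot_ob gr J R') (f g : quot_hom x y) :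
  qth_over f = qth_over g -> qth_fun f =1 qth_fun g -> f = g.
Proof.
case: f g => f0 f fs fe fm [g0 g gs ge gm] /= e0 /rmorph_eq e; subst g0 g.
by rewrite (Prop_irrelevance fs gs) (Prop_irrelevance fe ge)
           (Prop_irrelevance fm gm).
Qed.

Definition quot_id (k : closedFieldType) (L : zmodType) (S : kalg k)
  (gr : grading L (kstr S)) (N : nat) (J : 'I_N -> S) (R : kalg k)
  (x : quot_ob gr J R) : quot_hom x x :=
  @QuotHom k L S gr N J R R x x (kid R) idfun
    (fun _ => erefl) (fun _ _ => erefl) (fun _ => erefl).

Definition quot_comp (k : closedFieldType) (L : zmodType) (S : kalg k)
  (gr : grading L (kstr S)) (N : nat) (J : 'I_N -> S) (R R' R'' : kalg k)
  (x : quot_ob gr J R) (y : quot_ob gr J R') (z : quot_ob gr J R'')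
  (f : quot_hom x y) (g : quot_hom y z) : quot_hom x z.
Proof.
exists (kcomp (qth_over f) (qth_over g))
       (qth_fun g \o qth_fun f : {rmorphism qt_tor x -> qt_tor z}).
- by move=> c /=; rewrite !qth_str.
- by move=> l a /=; rewrite !qth_equiv.
- by move=> a /=; rewrite !qth_map.
Defined.

Definition quot_stack (k : closedFieldType) (L : zmodType) (S : kalg k)
  (gr : grading L (kstr S)) (N : nat) (J : 'I_N -> S) : fibcat k.
Proof.
refine (@Fibcat k (@quot_ob k L S gr N J) (@quot_hom k L S gr N J)
  (@qth_over k L S gr N J) (@quot_id k L S gr N J) (@quot_comp k L S gr N J)
  _ _ _ _ _) => // *; apply: quot_hom_eq => //; exact: kmor_eq.
Defined.

Definition Lfree (n : nat) : zmodType := (int * {ffun 'I_n -> int})%type.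

Definition Lfree_c (n : nat) : Lfree n := (1, 0).
Definition Lfree_x (n : nat) (i : 'I_n) : Lfree n :=
  (0, [ffun j => ((j == i)%:R : int)]).

Definition Lrel (n : nat) (r : 'I_n -> nat) : {pred Lfree n} := fun z =>
  `[< exists t : 'I_n -> int,
        z = \sum_i (Lfree_c n - Lfree_x i *+ r i) *~ t i >].

Lemma Lrel_zmod_closed (n : nat) (r : 'I_n -> nat) : zmod_closed (Lrel r).
Proof.
split=> [|x y /asboolP[t ->] /asboolP[s ->]]; apply/asboolP.
  by exists (fun=> 0); rewrite big1 // => i _; rewrite mulr0z.
exists (fun i => t i - s i); rewrite -sumrB; apply: eq_bigr => i _.
by rewrite mulrzBr.
Qed.

HB.instance Definition _ (n : nat) (r : 'I_n -> nat) :=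
  GRing.isZmodClosed.Build (Lfree n) (Lrel r) (Lrel_zmod_closed r).

Definition Lgrp (n : nat) (r : 'I_n -> nat) : zmodType := {ideal_quot (Lrel r)}.

Definition Lc (n : nat) (r : 'I_n -> nat) : Lgrp r :=
  \pi_{ideal_quot (Lrel r)} (Lfree_c n).
Definition Lx (n : nat) (r : 'I_n -> nat) (i : 'I_n) : Lgrp r :=
  \pi_{ideal_quot (Lrel r)} (Lfree_x i).

Lemma LxE (n : nat) (r : 'I_n -> nat) (i : 'I_n) : Lx r i *+ r i = Lc r.
Proof.
rewrite /Lx /Lc -raddfMn; apply/esym/eqP; rewrite -Quotient.idealrBE.
apply/asboolP; exists (fun j => (j == i)%:R).
rewrite (bigD1 i) //= eqxx mulr1z big1 ?addr0 // => j /negbTE ->.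
by rewrite mulr0z.
Qed.

Definition mweight (L : zmodType) (n : nat) (w : 'I_n -> L) (m : 'X_{1..n}) : L :=
  \sum_i w i *+ m i.

Definition mpoly_comp (k : closedFieldType) (L : zmodType) (n : nat) (w : 'I_n -> L)
  (l : L) (p : {mpoly k[n]}) : {mpoly k[n]} :=
  \sum_(m <- msupp p | mweight w m == l) p@_m *: 'X_[m].

Lemma mweightD (L : zmodType) (n : nat) (w : 'I_n -> L) (m1 m2 : 'X_{1..n}) :
  mweight w (m1 + m2)%MM = mweight w m1 + mweight w m2.
Proof.
by rewrite /mweight -big_split; apply: eq_bigr => i _; rewrite mnmDE mulrnDr.
Qed.

Lemma mcoeff_mpoly_comp (k : closedFieldType) (L : zmodType) (n : nat)
  (w : 'I_n -> L) (l : L) (p : {mpoly k[n]}) (m : 'X_{1..n}) :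
  (mpoly_comp w l p)@_m = if mweight w m == l then p@_m else 0.
Proof.
rewrite /mpoly_comp raddf_sum /=.
under eq_bigr => m' _ do rewrite mcoeffZ mcoeffX.
have [pm|pm] := boolP (m \in msupp p); last first.
  rewrite (memN_msupp_eq0 pm) if_same big_seq_cond big1 // => m' /andP[pm' _].
  by case: eqP pm pm' => [->|_ _ _]; rewrite ?mulr0 // => /negbTE ->.
rewrite big_mkcond (bigD1_seq m) ?msupp_uniq //= eqxx mulr1 big1 ?addr0 //.
by move=> m' /negbTE ->; rewrite mulr0 if_same.
Qed.

Lemma mpoly_compB (k : closedFieldType) (L : zmodType) (n : nat) (w : 'I_n -> L)
  (l : L) : {morph @mpoly_comp k L n w l : p q / p - q}.
Proof.
move=> p q; apply/mpolyP => m; rewrite mcoeffB !mcoeff_mpoly_comp mcoeffB.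
by case: ifP => // _; rewrite subr0.
Qed.

HB.instance Definition _ (k : closedFieldType) (L : zmodType) (n : nat)
  (w : 'I_n -> L) (l : L) :=
  GRing.isZmodMorphism.Build {mpoly k[n]} {mpoly k[n]} (@mpoly_comp k L n w l)
    (mpoly_compB w l).

Lemma mpoly_comp_sum (k : closedFieldType) (L : zmodType) (n : nat) (w : 'I_n -> L)
  (p : {mpoly k[n]}) :
  exists s : seq L, uniq s /\ p = \sum_(l <- s) mpoly_comp w l p.
Proof.
exists (undup [seq mweight w m | m <- msupp p]); split; first exact: undup_uniq.
apply/mpolyP => m; rewrite raddf_sum /=.
under eq_bigr => l _ do rewrite mcoeff_mpoly_comp.
have [pm|pm] := boolP (m \in msupp p); last first.
  by rewrite (memN_msupp_eq0 pm) big1 // => l _; rewrite if_same.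
rewrite (bigD1_seq (mweight w m)) ?undup_uniq ?mem_undup ?map_f //= eqxx.
by rewrite big1 ?addr0 // => l; rewrite eq_sym => /negbTE ->.
Qed.

Lemma mpoly_compK (k : closedFieldType) (L : zmodType) (n : nat) (w : 'I_n -> L)
  (l m : L) (p : {mpoly k[n]}) :
  mpoly_comp w l (mpoly_comp w m p) = if l == m then mpoly_comp w m p else 0.
Proof.
apply/mpolyP => a; rewrite (fun_if (fun q => q@_a)) !mcoeff_mpoly_comp mcoeff0.
case: (eqVneq l m) => [->|lm]; first by case: eqP.
by case: eqP => // ->; rewrite (negbTE lm).
Qed.

Lemma mpoly_compX (k : closedFieldType) (L : zmodType) (n : nat) (w : 'I_n -> L)
  (m : 'X_{1..n}) :
  mpoly_comp w (mweight w m) ('X_[m] : {mpoly k[n]}) = 'X_[m].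
Proof.
apply/mpolyP => a; rewrite mcoeff_mpoly_comp mcoeffX.
by case: (eqVneq m a) => [->|_]; rewrite ?eqxx ?if_same.
Qed.

Lemma mpoly_compZ (k : closedFieldType) (L : zmodType) (n : nat) (w : 'I_n -> L)
  (l : L) (c : k) (p : {mpoly k[n]}) :
  mpoly_comp w l (c *: p) = c *: mpoly_comp w l p.
Proof.
by apply/mpolyP => a; rewrite mcoeffZ !mcoeff_mpoly_comp mcoeffZ (fun_if ( *%R c)) mulr0.
Qed.

Lemma mpoly_compM (k : closedFieldType) (L : zmodType) (n : nat) (w : 'I_n -> L)
  (l m : L) (p q : {mpoly k[n]}) :
  mpoly_comp w (l + m) (mpoly_comp w l p * mpoly_comp w m q)
  = mpoly_comp w l p * mpoly_comp w m q.
Proof.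
have -> : mpoly_comp w l p * mpoly_comp w m q =
    \sum_(a <- msupp p | mweight w a == l) \sum_(b <- msupp q | mweight w b == m)
      (p@_a * q@_b) *: 'X_[a + b].
  rewrite {1}/mpoly_comp mulr_suml; apply: eq_bigr => a _.
  rewrite {1}/mpoly_comp mulr_sumr; apply: eq_bigr => b _.
  by rewrite -scalerAl -scalerAr scalerA mpolyXD.
rewrite raddf_sum; apply: eq_bigr => a /eqP al.
rewrite raddf_sum; apply: eq_bigr => b /eqP bm.
by rewrite /= mpoly_compZ -al -bm -mweightD mpoly_compX.
Qed.

Lemma mpoly_comp_scal (k : closedFieldType) (L : zmodType) (n : nat) (w : 'I_n -> L)
  (c : k) : mpoly_comp w 0 (mpolyC n c) = mpolyC n c.
Proof.
apply/mpolyP => a; rewrite mcoeff_mpoly_comp mcoeffC.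
case: (eqVneq a 0%MM) => [->|a0]; last by rewrite mulr0 if_same.
by rewrite /mweight big1 ?eqxx // => i _; rewrite mnm0E mulr0n.
Qed.

Definition mpoly_grading (k : closedFieldType) (L : zmodType) (n : nat)
  (w : 'I_n -> L) : grading L (@mpolyC n k) :=
  Grading (mpoly_compB w) (mpoly_comp_sum w) (mpoly_compK w) (mpoly_compM w)
    (mpoly_comp_scal w).

(* The variables x_1, ..., x_n, with n = m + 3, are indexed by 0, ..., n - 1. *)
Definition ord1st (m : nat) : 'I_m.+3 := @Ordinal m.+3 0 isT.
Definition ord2nd (m : nat) : 'I_m.+3 := @Ordinal m.+3 1 isT.

(* lambda = (oo, 0, 1, lambda_4, ..., lambda_n) *)
Definition lamseq (k : closedFieldType) (m : nat) (lam : 'I_m -> k)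
  (i : 'I_(3 + m)) : p1pt k :=
  match split i with
  | inl j => nth pinf [:: pinf; pfin 0; pfin 1] j
  | inr j => pfin (lam j)
  end.

(* affine coordinate, with a junk value at infinity *)
Definition p1coord (k : closedFieldType) (pt : p1pt k) : k :=
  if pt is pfin a then a else 0.

Definition Srel (k : closedFieldType) (m : nat) (r : 'I_m.+3 -> nat)
  (lam : 'I_m.+3 -> p1pt k) (i : 'I_m.+3) : {mpoly k[m.+3]} :=
  'X_i ^+ r i - 'X_(ord2nd m) ^+ r (ord2nd m)
  + p1coord (lam i) *: 'X_(ord1st m) ^+ r (ord1st m).

(* the ideal generated by the relations with index at least 3 (at least 2 when
   counting from 0); that r > 1 is recorded because it makes the ideal proper *)
Definition Sideal (k : closedFieldType) (m : nat) (r : 'I_m.+3 -> nat)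
  (hr : forall i, (1 < r i)%N) (lam : 'I_m.+3 -> p1pt k) : {pred {mpoly k[m.+3]}} :=
  fun p => `[< exists q : 'I_m.+3 -> {mpoly k[m.+3]},
                 p = \sum_(i : 'I_m.+3 | (1 < i)%N) q i * Srel r lam i >].

Lemma Sideal_closed (k : closedFieldType) (m : nat) (r : 'I_m.+3 -> nat)
  (hr : forall i, (1 < r i)%N) (lam : 'I_m.+3 -> p1pt k) :
  idealr_closed (Sideal hr lam).
Proof.
split.
- by apply/asboolP; exists (fun=> 0); rewrite big1 // => i _; rewrite mul0r.
- apply/asboolP => -[q /(congr1 (fun p => p.@[fun=> 0]))].
  have r0 i : (0 : k) ^+ r i = 0 by rewrite expr0n -leqn0 leqNgt ltnW.
  rewrite rmorph1 raddf_sum big1 => [/eqP|i _]; first by rewrite oner_eq0.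
  rewrite /= mevalM /Srel mevalD mevalB mevalZ !rmorphXn /= !mevalXU !r0.
  by rewrite subrr mulr0 addr0 mulr0.
- move=> a u v /asboolP[p ->] /asboolP[q ->]; apply/asboolP.
  exists (fun i => a * p i + q i); rewrite mulr_sumr -big_split /=.
  by apply: eq_bigr => i _; rewrite mulrDl mulrA.
Qed.

HB.instance Definition _ (k : closedFieldType) (m : nat) (r : 'I_m.+3 -> nat)
  (hr : forall i, (1 < r i)%N) (lam : 'I_m.+3 -> p1pt k) :=
  isIdealr.Build {mpoly k[m.+3]} (Sideal hr lam) (Sideal_closed hr lam).

Definition Sring (k : closedFieldType) (m : nat) (r : 'I_m.+3 -> nat)
  (hr : forall i, (1 < r i)%N) (lam : 'I_m.+3 -> p1pt k) : comNzRingType :=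
  {ideal_quot (Sideal hr lam)}.

Definition Spi (k : closedFieldType) (m : nat) (r : 'I_m.+3 -> nat)
  (hr : forall i, (1 < r i)%N) (lam : 'I_m.+3 -> p1pt k) :
  {rmorphism {mpoly k[m.+3]} -> Sring hr lam} := \pi_{ideal_quot (Sideal hr lam)}.

Definition Salg (k : closedFieldType) (m : nat) (r : 'I_m.+3 -> nat)
  (hr : forall i, (1 < r i)%N) (lam : 'I_m.+3 -> p1pt k) : kalg k :=
  @Kalg k (Sring hr lam) (Spi hr lam \o @mpolyC m.+3 k : {rmorphism k -> Sring hr lam}).

Definition Sx (k : closedFieldType) (m : nat) (r : 'I_m.+3 -> nat)
  (hr : forall i, (1 < r i)%N) (lam : 'I_m.+3 -> p1pt k) (i : 'I_m.+3) :
  Salg hr lam := Spi hr lam 'X_i.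

Lemma Srel_homog (k : closedFieldType) (m : nat) (r : 'I_m.+3 -> nat)
  (lam : 'I_m.+3 -> p1pt k) (i : 'I_m.+3) :
  mpoly_comp (Lx r) (Lc r) (Srel r lam i) = Srel r lam i.
Proof.
have XE j : mpoly_comp (Lx r) (Lc r) ('X_j ^+ r j : {mpoly k[m.+3]}) = 'X_j ^+ r j.
  rewrite mpolyXn.
  suff <- : mweight (Lx r) (U_(j) *+ r j)%MM = Lc r by rewrite mpoly_compX.
  rewrite /mweight (bigD1 j) //= big1 ?addr0 => [|a aj].
    by rewrite mulmnE mnm1E eqxx mul1n LxE.
  by rewrite mulmnE mnm1E eq_sym (negbTE aj) mul0n mulr0n.
by rewrite /Srel raddfD raddfB /= mpoly_compZ !XE.
Qed.

Lemma Sideal_comp (k : closedFieldType) (m : nat) (r : 'I_m.+3 -> nat)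
  (hr : forall i, (1 < r i)%N) (lam : 'I_m.+3 -> p1pt k) (l : Lgrp r)
  (p : {mpoly k[m.+3]}) :
  p \in Sideal hr lam -> mpoly_comp (Lx r) l p \in Sideal hr lam.
Proof.
move=> /asboolP[q ->]; apply/asboolP.
exists (fun i => mpoly_comp (Lx r) (l - Lc r) (q i)).
rewrite raddf_sum; apply: eq_bigr => i _ /=.
have [s [us qE]] := mpoly_comp_sum (Lx r) (q i).
rewrite [in RHS]qE {1}qE mulr_suml !raddf_sum mulr_suml /=.
apply: eq_bigr => e _; rewrite -{1}(Srel_homog r lam i) -mpoly_compM !mpoly_compK.
rewrite subr_eq; case: eqP => [_|_]; last by rewrite mul0r.
by rewrite mpoly_compM Srel_homog.
Qed.

Definition Scomp (k : closedFieldType) (m : nat) (r : 'I_m.+3 -> nat)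
  (hr : forall i, (1 < r i)%N) (lam : 'I_m.+3 -> p1pt k) (l : Lgrp r)
  (a : Sring hr lam) : Sring hr lam :=
  Spi hr lam (mpoly_comp (Lx r) l (repr a)).

Lemma Scomp_pi (k : closedFieldType) (m : nat) (r : 'I_m.+3 -> nat)
  (hr : forall i, (1 < r i)%N) (lam : 'I_m.+3 -> p1pt k) (l : Lgrp r)
  (p : {mpoly k[m.+3]}) :
  Scomp l (Spi hr lam p) = Spi hr lam (mpoly_comp (Lx r) l p).
Proof.
apply/eqP; rewrite -Quotient.idealrBE -raddfB; apply: Sideal_comp.
by rewrite Quotient.idealrBE reprK.
Qed.

Lemma Spi_surj (k : closedFieldType) (m : nat) (r : 'I_m.+3 -> nat)
  (hr : forall i, (1 < r i)%N) (lam : 'I_m.+3 -> p1pt k) (a : Sring hr lam) :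
  exists p, a = Spi hr lam p.
Proof. by exists (repr a); rewrite /Spi /= reprK. Qed.

(* the L-grading of S with deg x_i = Lx r i *)
Definition Sgrading (k : closedFieldType) (m : nat) (r : 'I_m.+3 -> nat)
  (hr : forall i, (1 < r i)%N) (lam : 'I_m.+3 -> p1pt k) :
  grading (Lgrp r) (kstr (Salg hr lam)).
Proof.
refine (@Grading (Lgrp r) k (Sring hr lam) _ (@Scomp k m r hr lam) _ _ _ _ _).
- move=> l a b; have [p ->] := Spi_surj a; have [q ->] := Spi_surj b.
  by rewrite -raddfB !Scomp_pi -raddfB /= mpoly_compB.
- move=> a; have [p ->] := Spi_surj a; have [s [us pE]] := mpoly_comp_sum (Lx r) p.
  exists s; split=> //; rewrite {1}pE raddf_sum /=.
  by apply: eq_bigr => l _; rewrite Scomp_pi.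
- move=> l l' a; have [p ->] := Spi_surj a.
  by rewrite !Scomp_pi mpoly_compK; case: ifP => // _; rewrite raddf0.
- move=> l l' a b; have [p ->] := Spi_surj a; have [q ->] := Spi_surj b.
  by rewrite !Scomp_pi -rmorphM Scomp_pi mpoly_compM.
- by move=> c; rewrite [LHS]Scomp_pi mpoly_comp_scal.
Defined.

Definition weighted_stack (k : closedFieldType) (m : nat) (r : 'I_m.+3 -> nat)
  (hr : forall i, (1 < r i)%N) (lam : 'I_m.+3 -> p1pt k) : fibcat k :=
  quot_stack (Sgrading hr lam) (Sx hr lam).

(* Main.v *)
(* The algebra A of a D(L)-torsor over R is strongly graded with A_0 = R: its components
   A_l are line bundles, and A_l (x) A_m = A_(l+m). An equivariant map S -> A is then a
   system of sections x_i of M_i = A_(x_i); the r_i-th power of M_i is N = A_c, and the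
   relations of S say that x_i^(r_i) cuts out lambda_i when N carries the sections
   u = x_2^(r_2) and v = x_1^(r_1). Avoiding the origin means that u and v generate N, that
   is, (N, u, v) is a point of P^1. This is the functor to the fibre product.

   The other direction rests on the following remark: if B is an R-algebra, the
   invertible R-submodules of B form an abelian group, so that submodules I_i with
   I_i^(r_i) independent of i extend to a homomorphism l |-> I(l) on L.
   With B = A * A' and I_i the graph of a map A_(x_i) -> A'_(x_i), this extends maps of
   line bundles to graded homomorphisms, which gives fullness. For essential surjectivity,
   let B be an injective extension of R over which the M_i and N are trivial, compatibly
   with the power maps, and let I_i be the image of M_i in B; then the sum of the I(l)[l]
   in B[L] is strongly graded with degree-0 part R, hence the algebra of a torsor. *)
From HB Require Import structures.
Require Import Defs.
From mathcomp Require Import all_boot all_order all_algebra.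
From mathcomp Require Import generic_quotient ring_quotient.
From mathcomp Require Import boolp functions.
From mathcomp Require Import finmap mpoly monalg.

Set Implicit Arguments.
Unset Strict Implicit.
Unset Printing Implicit Defensive.

Import GRing.Theory.
Local Open Scope ring_scope.
Local Open Scope quotient_scope.

(** Choosing isomorphisms A_l (x) A_m = A_(l+m) along the relations of L would raise coherence
    questions. Inside a fixed commutative ring, products of submodules are associative and
    commutative on the nose, so r_i x_i = c becomes an equality of submodules and the presentation
    of L applies; hence the search for an ambient ring. Injectivity of R -> B is all that is asked
    of it, so B can be built at once from all choices of local frames, without a covering or
    descent. Roots are adjoined because the trivializations of N coming from different M_i differ by
    units. The torsor axioms must also be matched with strong gradings. Simple transitivity is
    tested on two rings made for the purpose: a subring of A[L], which puts 1 in A_l A_(-l), and a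
    ring of operators on A (x)_R A, which together with faithful flatness yields A_0 = R. In the
    other direction, the projection to degree 0 splits every base change. Throughout, finite sums
    equal to 1 replace local generators of line bundles. *)

(** * Linear maps, submodules and quotients *)

Section LinearFun.
Variables (R R' : pzRingType) (f : {rmorphism R -> R'}) (M : lmodType R) (M' : lmodType R').
Variable h : M -> M'.
Hypothesis hl : forall a x y, h (a *: x + y) = f a *: h x + h y.

Lemma twisted_linear0 : h 0 = 0.
Proof. by have := hl (-1) 0 0; rewrite scaler0 addr0 rmorphN1 scaleN1r addNr. Qed.
Lemma twisted_linearB x y : h (x - y) = h x - h y.
Proof. by have := hl (-1) y x; rewrite rmorphN1 !scaleN1r ![- _ + _]addrC. Qed.
Lemma twisted_linearD x y : h (x + y) = h x + h y.
Proof. by have := hl 1 x y; rewrite rmorph1 !scale1r. Qed.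
Lemma twisted_linearZ c x : h (c *: x) = f c *: h x.
Proof. by have := hl c x 0; rewrite twisted_linear0 !addr0. Qed.
End LinearFun.

Section LinearUnbundled.
Variables (R : pzRingType) (M M' : lmodType R) (h : M -> M') (hl : linear h).
Lemma linear_fun0 : h 0 = 0. Proof. exact: (@twisted_linear0 _ _ idfun _ _ _ hl). Qed.
Lemma linear_funB x y : h (x - y) = h x - h y.
Proof. exact: (@twisted_linearB _ _ idfun _ _ _ hl). Qed.
Lemma linear_funD x y : h (x + y) = h x + h y.
Proof. exact: (@twisted_linearD _ _ idfun _ _ _ hl). Qed.
Lemma linear_funZ c x : h (c *: x) = c *: h x.
Proof. exact: (@twisted_linearZ _ _ idfun _ _ _ hl). Qed.
Lemma linear_fun_sum (I : Type) (s : seq I) (F : I -> M) :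
  h (\sum_(i <- s) F i) = \sum_(i <- s) h (F i).
Proof. exact: (big_morph h linear_funD linear_fun0). Qed.
End LinearUnbundled.

Section Semilinear.
Variables (R R' : comPzRingType) (f : {rmorphism R -> R'}) (M : lmodType R) (M' : lmodType R').
Variables (h : M -> M') (hl : semilinear_along f h).
Lemma semilinear0 : h 0 = 0. Proof. exact: twisted_linear0 hl. Qed.
Lemma semilinearB x y : h (x - y) = h x - h y. Proof. exact: twisted_linearB hl _ _. Qed.
Lemma semilinearD x y : h (x + y) = h x + h y. Proof. exact: twisted_linearD hl _ _. Qed.
Lemma semilinearZ c x : h (c *: x) = f c *: h x. Proof. exact: twisted_linearZ hl _ _. Qed.
Lemma semilinear_sum (I : Type) (s : seq I) (F : I -> M) :
  h (\sum_(i <- s) F i) = \sum_(i <- s) h (F i).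
Proof. exact: (big_morph h semilinearD semilinear0). Qed.
End Semilinear.

(** Membership is a proposition, as the submodules below are given by existential formulas or by
    intersections; [smem] is the boolean form that the quotient and subtype constructions take. *)
Record submod (R : pzRingType) (V : lmodType R) := Submod {
  smpred :> V -> Prop;
  sm_zero : smpred 0;
  sm_lin : forall a x y, smpred x -> smpred y -> smpred (a *: x + y) }.

Definition smem (R : pzRingType) (V : lmodType R) (U : submod V) : {pred V} :=
  fun v => `[< U v >].

Lemma smem_closed (R : pzRingType) (V : lmodType R) (U : submod V) :
  submod_closed (smem U).
Proof.
split; first by apply/asboolP; exact: sm_zero.
by move=> a x y /asboolP xU /asboolP yU; apply/asboolP; exact: sm_lin.
Qed.

HB.instance Definition _ (R : pzRingType) (V : lmodType R) (U : submod V) :=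
  GRing.isSubmodClosed.Build R V (smem U) (smem_closed U).

Definition subm (R : pzRingType) (V : lmodType R) (U : submod V) :=
  {v : V | v \in smem U}.
HB.instance Definition _ (R : pzRingType) (V : lmodType R) (U : submod V) :=
  SubChoice.on (subm U).
HB.instance Definition _ (R : pzRingType) (V : lmodType R) (U : submod V) :=
  [SubChoice_isSubLmodule of subm U by <:].

Section Subm.
Variables (R : pzRingType) (V : lmodType R) (U : submod V).

Definition insm (v : V) (vU : U v) : subm U := exist _ v (asboolT vU).

Lemma submP (x : subm U) : U (val x).
Proof. by case: x => v vU; apply/asboolP. Qed.

Lemma smZ a x : U x -> U (a *: x).
Proof. by move=> xU; rewrite -[_ *: _]addr0; apply: sm_lin => //; exact: sm_zero. Qed.
Lemma subm_lin a (x y : subm U) : val (a *: x + y) = a *: val x + val y.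
Proof. by rewrite linearP. Qed.
End Subm.

Definition quotm (R : pzRingType) (V : lmodType R) (U : submod V) :=
  {ideal_quot (smem U)}.

HB.instance Definition _ (R : pzRingType) (V : lmodType R) (U : submod V) :=
  GRing.Zmodule.on (quotm U).

Section Quotm.
Variables (R : pzRingType) (V : lmodType R) (U : submod V).

Definition qpi (v : V) : quotm U := \pi_{ideal_quot (smem U)} v.

Lemma qpiB : zmod_morphism qpi.
Proof. by move=> x y; rewrite /qpi raddfB. Qed.

Lemma qpi_surj (q : quotm U) : exists v, q = qpi v.
Proof. by exists (repr (q : {ideal_quot (smem U)})); rewrite /qpi reprK. Qed.

Lemma qpi_eq x y : qpi x = qpi y <-> U (x - y).
Proof.
rewrite /qpi; split.
  by move/eqP; rewrite -Quotient.idealrBE => /asboolP.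
by move=> h; apply/eqP; rewrite -Quotient.idealrBE; apply/asboolP.
Qed.

Definition qscale (a : R) (q : quotm U) : quotm U :=
  qpi (a *: repr (q : {ideal_quot (smem U)})).

Lemma qscaleE a v : qscale a (qpi v) = qpi (a *: v).
Proof.
apply/qpi_eq; rewrite -scalerBr; apply: smZ; apply/qpi_eq.
by rewrite /qpi reprK.
Qed.

Lemma qscaleA a b q : qscale a (qscale b q) = qscale (a * b) q.
Proof. by have [v ->] := qpi_surj q; rewrite !qscaleE scalerA. Qed.
Lemma qscale1 : left_id 1 qscale.
Proof. by move=> q; have [v ->] := qpi_surj q; rewrite !qscaleE scale1r. Qed.
Lemma qpiD x y : qpi (x + y) = qpi x + qpi y.
Proof.
have q0 : qpi 0 = 0 by rewrite -(subrr 0) qpiB subrr.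
by rewrite -{1}[y]opprK qpiB -[- y]sub0r qpiB q0 sub0r opprK.
Qed.
Lemma qscaleDr : right_distributive qscale +%R.
Proof.
move=> a p q; have [v ->] := qpi_surj q; have [w ->] := qpi_surj p.
by rewrite -qpiD !qscaleE -qpiD scalerDr.
Qed.
Lemma qscaleDl q : {morph qscale^~ q : a b / a + b}.
Proof.
by move=> a b; have [v ->] := qpi_surj q; rewrite !qscaleE -qpiD scalerDl.
Qed.
End Quotm.

HB.instance Definition _ (R : pzRingType) (V : lmodType R) (U : submod V) :=
  GRing.Zmodule_isLmodule.Build R (quotm U) (@qscaleA R V U) (@qscale1 R V U)
    (@qscaleDr R V U) (@qscaleDl R V U).

Lemma qpi_lin (R : pzRingType) (V : lmodType R) (U : submod V) : linear (@qpi R V U).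
Proof. by move=> a x y; rewrite qpiD -qscaleE. Qed.

Lemma qpi_eq0 (R : pzRingType) (V : lmodType R) (U : submod V) x :
  qpi U x = 0 <-> U x.
Proof.
have <- : qpi U 0 = 0 by rewrite -(subrr 0) qpiB subrr.
by rewrite qpi_eq subr0.
Qed.

Lemma quotm_lift (R : pzRingType) (V W : lmodType R) (U : submod V) (h : V -> W) :
  linear h -> (forall x, U x -> h x = 0) ->
  exists h' : quotm U -> W, linear h' /\ forall x, h' (qpi U x) = h x.
Proof.
move=> hl hU.
pose h' (q : quotm U) := h (repr (q : {ideal_quot (smem U)})).
have hB x y : h (x - y) = h x - h y.
  by rewrite addrC -scaleN1r hl scaleN1r addrC.
have h'E x : h' (qpi U x) = h x.
  apply/eqP; rewrite -subr_eq0 -hB; apply/eqP/hU/qpi_eq.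
  by rewrite /qpi reprK.
exists h'; split=> // a p q.
have [v ->] := qpi_surj q; have [w ->] := qpi_surj p.
by rewrite -qpi_lin !h'E hl.
Qed.

(* A submodule through which the universal map factors is everything: compose the
   induced map into the submodule with the inclusion and use uniqueness. *)
Lemma tensor_ind (R : comPzRingType) (M N T : lmodType R) (b : M -> N -> T)
  (K : submod T) : is_tensor b -> (forall x y, K (b x y)) -> forall t, K t.
Proof.
move=> [[bl br] bu] Kb t.
have [] := bu (subm K) (fun x y => insm (Kb x y)).
  split=> x a y z; apply: val_inj; rewrite subm_lin /=; first exact: bl.
  exact: br.
move=> h [[hl hE] _].
have [h0 [_ h0u]] := bu T b (conj bl br).
have e1 : h0 = idfun by apply: h0u; split.
have e2 : h0 = val \o h.
  apply: h0u; split=> [a x y|x y] /=; first by rewrite hl subm_lin.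
  by rewrite hE.
by rewrite -[t]/(idfun t) -e1 e2 /=; exact: submP.
Qed.

Lemma base_change_ind (R R' : comPzRingType) (f : R -> R') (M : lmodType R)
  (M' : lmodType R') (j : M -> M') (K : submod M') :
  is_base_change f j -> (forall x, K (j x)) -> forall t, K t.
Proof.
move=> [jl ju] Kj t.
have [] := ju R' idfun (subm K) (fun x => insm (Kj x)).
  by move=> a x y; apply: val_inj; rewrite subm_lin /=; exact: jl.
move=> h [[hl hE] _].
have [h0 [_ h0u]] := ju R' idfun M' j jl.
have e1 : h0 = idfun by apply: h0u; split.
have e2 : h0 = val \o h.
  apply: h0u; split=> [a x y|x] /=; first by rewrite hl subm_lin.
  by rewrite hE.
by rewrite -[t]/(idfun t) -e1 e2 /=; exact: submP.
Qed.

Lemma tensor_power_ind (R : comPzRingType) (r : nat) (M N : lmodType R)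
  (phi : ('I_r -> M) -> N) (K : submod N) :
  is_tensor_power phi -> (forall x, K (phi x)) -> forall t, K t.
Proof.
move=> [pl pu] Kp t.
have [] := pu (subm K) (fun x => insm (Kp x)).
  by move=> x i a u v; apply: val_inj; rewrite subm_lin /=; exact: pl.
move=> h [[hl hE] _].
have [h0 [_ h0u]] := pu N phi pl.
have e1 : h0 = idfun by apply: h0u; split.
have e2 : h0 = val \o h.
  apply: h0u; split=> [a x y|x] /=; first by rewrite hl subm_lin.
  by rewrite hE.
by rewrite -[t]/(idfun t) -e1 e2 /=; exact: submP.
Qed.

(** * Invertible modules *)

(** Every term in the expansion of a high power of the sum contains a high power of one summand, so
    powers of comaximal elements are still comaximal. This replaces localization in the sequel; with
    [D] the class of 1 modulo an ideal, it shows that the ideal is the whole ring. *)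
Lemma comax_pow (R : comPzRingType) (V : lmodType R) (I : eqType) (s : seq I)
  (x : I -> R) (D : V) :
  \sum_(i <- s) x i = 1 -> (forall i, i \in s -> exists n, x i ^+ n *: D = 0) ->
  D = 0.
Proof.
move=> s1 xD; suff [N] : exists N, (\sum_(i <- s) x i) ^+ N *: D = 0.
  by rewrite s1 expr1n scale1r.
elim: s xD {s1} => [|i s IH] xD; first by exists 1; rewrite big_nil expr1 scale0r.
have [n nD] : exists n, x i ^+ n *: D = 0 by apply: xD; rewrite mem_head.
have [|N ND] := IH; first by move=> l ls; apply: xD; rewrite inE ls orbT.
exists (n + N)%N; rewrite big_cons exprDn scaler_suml big1 // => l _.
rewrite -scalerMnl; case: (leqP N l) => Nl.
  by rewrite -(subnK Nl) exprD -!scalerA ND !scaler0 mul0rn.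
have -> : (n + N - l = N - l + n)%N by rewrite -addnBA 1?addnC // ltnW.
by rewrite mulrC exprD -!scalerA nD !scaler0 mul0rn.
Qed.

(** A first-order form of the universal property of an evaluation pairing: a finite sum of values
    equal to 1, and two exchange rules which say that the modules have rank one. *)
Definition dual_pair (R : comPzRingType) (M N : lmodType R) (b : M -> N -> R^o) : Prop :=
  [/\ bilinear_map b, exists s : seq (M * N), \sum_(p <- s) b p.1 p.2 = 1,
      forall m n m', (b m n : R) *: m' = (b m' n : R) *: m &
      forall m n n', (b m n : R) *: n' = (b m n' : R) *: n].

Section Bilinear.
Variables (R : comPzRingType) (M N P : lmodType R) (b : M -> N -> P).
Hypothesis bb : bilinear_map b.
Lemma bilinZl a m n : b (a *: m) n = a *: b m n.
Proof.
exact: (linear_funZ (bb.2 n)).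
Qed.
Lemma bilinZr a m n : b m (a *: n) = a *: b m n.
Proof.
exact: (linear_funZ (bb.1 m)).
Qed.
Lemma bilinDl m m' n : b (m + m') n = b m n + b m' n.
Proof. exact: (linear_funD (bb.2 n)). Qed.
Lemma bilinDr m n n' : b m (n + n') = b m n + b m n'.
Proof. exact: (linear_funD (bb.1 m)). Qed.
End Bilinear.

Lemma is_tensorC (R : comPzRingType) (M N T : lmodType R) (b : M -> N -> T) :
  is_tensor b -> is_tensor (fun n m => b m n).
Proof.
move=> [[bl br] bu]; split=> // P c [cl cr].
have [h [[hl hE] hu]] := bu P (fun m n => c n m) (conj cr cl).
by exists h; split=> // h' [h'l h'E]; apply: hu; split.
Qed.

(** Scalars can be absorbed into the left entries, so the finite sums of values of [b] form a
    submodule and [tensor_ind] applies. *)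
Lemma tensor_sum1 (R : comPzRingType) (M N : lmodType R) (b : M -> N -> R^o) :
  is_tensor b -> exists s : seq (M * N), \sum_(p <- s) b p.1 p.2 = 1.
Proof.
move=> bT; have [bb _] := bT.
pose K (t : R^o) := exists s : seq (M * N), \sum_(p <- s) b p.1 p.2 = t.
have K0 : K 0 by exists [::]; rewrite big_nil.
have KD a x y : K x -> K y -> K (a *: x + y).
  move=> [s sx] [s' sy]; exists ([seq (a *: p.1, p.2) | p <- s] ++ s').
  rewrite big_cat big_map /= -sx -sy scaler_sumr; congr (_ + _).
  by apply: eq_bigr => p _; rewrite bilinZl.
apply: (tensor_ind (K := Submod K0 KD) bT) => x y /=.
by exists [:: (x, y)]; rewrite big_seq1.
Qed.

(* The endomorphism z of M induced by (x, m, n) |-> b x n *: m must be shown to be the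
   identity; the difference z - id is killed by every b x n with the same x, and by
   polarization by the squares of the b p.1 p.2, which generate the unit ideal. *)
Lemma tensor_rank1 (R : comPzRingType) (M N : lmodType R) (b : M -> N -> R^o) :
  is_tensor b -> forall m n m', (b m n : R) *: m' = (b m' n : R) *: m.
Proof.
move=> bT; have [bb bu] := bT; have [s s1] := tensor_sum1 bT.
pose z x := \sum_(p <- s) (b x p.2 : R) *: p.1.
have zE x m n : (b m n : R) *: z x = (b x n : R) *: m.
  have [] := bu M (fun m n => (b x n : R) *: m).
    split=> [u a v w|u a v w] /=; last by rewrite linearP.
    by rewrite (bilinDr bb) (bilinZr bb) scalerDl scalerA.
  move=> h [[hl hE] _].
  have hZ a : h a = a *: h 1 by rewrite -(linear_funZ hl) [_ *: _]mulr1.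
  suff -> : z x = h 1 by rewrite -hZ hE.
  rewrite -[h 1]scale1r -[X in X *: _]s1 scaler_suml; apply: eq_bigr => p _.
  by rewrite -hZ hE.
pose D x := z x - x.
have DD x y : D (x + y) = D x + D y.
  rewrite /D opprD addrACA -big_split /=; congr (_ + _); apply: eq_bigr => p _.
  by rewrite (bilinDl bb) scalerDl.
have bD x n : (b x n : R) *: D x = 0 by rewrite scalerBr zE subrr.
have bDD x y n : (b x n : R) *: D y = - ((b y n : R) *: D x).
  apply/eqP; rewrite -addr_eq0; apply/eqP; have := bD (x + y) n.
  by rewrite DD (bilinDl bb) scalerDr !scalerDl !bD add0r addr0 addrC.
suff D0 x : D x = 0.
  by move=> m n m'; rewrite -(zE m'); move/eqP: (D0 m'); rewrite subr_eq0 => /eqP ->.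
apply: (comax_pow s1) => p _; exists 2; rewrite expr2 -scalerA bDD.
by rewrite scalerN scalerA mulrC -scalerA bD scaler0 oppr0.
Qed.

Lemma tensor_dual_pair (R : comPzRingType) (M N : lmodType R) (b : M -> N -> R^o) :
  is_tensor b -> dual_pair b.
Proof.
move=> bT; split; [exact: bT.1|exact: tensor_sum1|exact: tensor_rank1|].
by move=> m n n'; exact: (tensor_rank1 (is_tensorC bT)).
Qed.

(** The sum equal to 1 dictates the value at 1 of the induced map, hence the map. That it extends
    [c] follows by exchanging first the left entries and then the right ones. *)
Lemma dual_pair_tensor (R : comPzRingType) (M N : lmodType R) (b : M -> N -> R^o) :
  dual_pair b -> is_tensor b.
Proof.
move=> [bb [s s1] bM bN]; split=> // P c cb.
pose h (a : R^o) : P := (a : R) *: \sum_(p <- s) c p.1 p.2.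
exists h; split; first split.
- by move=> a x y; rewrite /h scalerDl scalerA.
- move=> x y; rewrite /h scaler_sumr -[RHS]scale1r -[X in _ = X *: _]s1 scaler_suml.
  apply: eq_bigr => p _.
  by rewrite -(bilinZl cb) bM (bilinZl cb) -(bilinZr cb) bN (bilinZr cb).
- move=> h' [h'l h'E]; apply: funext => t; rewrite /h scaler_sumr.
  have -> : t = \sum_(p <- s) (t : R) *: b p.1 p.2.
    by rewrite -scaler_sumr s1 [RHS]mulr1.
  rewrite (linear_fun_sum h'l); apply: eq_bigr => p _.
  by rewrite (linear_funZ h'l) h'E -scaler_sumr s1 [X in X *: _]mulr1.
Qed.

(** * Group rings and base change *)

Section FinSupp.
Variables (K : choiceType) (G V : zmodType).

Lemma malg_ind (P : {malg G[K]} -> Prop) :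
  P 0 -> (forall x y, P x -> P y -> P (x + y)) ->
  (forall k a, P (mkmalgU k a)) -> forall g, P g.
Proof. by move=> P0 PD PU g; rewrite (monalgE g); apply: big_ind => // k _. Qed.

Variable phi : K -> G -> V.
Hypothesis phiB : forall k, {morph phi k : x y / x - y}.

(** As each [phi k] only has to be additive, the same extension serves for the product of the group
    ring and for linear maps out of free modules. *)
Definition mlift (g : {malg G[K]}) : V := \sum_(k <- msupp g) phi k (mcoeff k g).

Lemma phi0 k : phi k 0 = 0. Proof. by have := phiB k 0 0; rewrite !subrr. Qed.

Lemma mliftw (d : {fset K}) g : (msupp g `<=` d)%fset ->
  mlift g = \sum_(k <- d) phi k (mcoeff k g).
Proof.
move=> le; rewrite [LHS](big_fset_incl _ le) => //= x xd /mcoeff_outdom ->.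
exact: phi0.
Qed.

Lemma mliftU k a : mlift (mkmalgU k a) = phi k a.
Proof. by rewrite (mliftw msuppU_le) big_seq_fset1 mcoeffUU. Qed.

Lemma mliftB : {morph mlift : x y / x - y}.
Proof.
move=> g1 g2; pose d := (msupp g1 `|` msupp g2)%fset.
rewrite (@mliftw d) ?msuppB_le // (@mliftw d) ?fsubsetUl //.
rewrite (@mliftw d) ?fsubsetUr // -sumrB.
by apply: eq_bigr => k _; rewrite raddfB phiB.
Qed.

Lemma mlift0 : mlift 0 = 0. Proof. by have := mliftB 0 0; rewrite !subrr. Qed.
Lemma mliftD : {morph mlift : x y / x + y}.
Proof.
by move=> x y; apply/eqP; rewrite -subr_eq -mliftB addrK.
Qed.
End FinSupp.

Section GroupRingDef.
Variables (A : comPzRingType) (L : zmodType).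

(** A fresh name for the finitely supported functions on L, to carry the convolution product of the
    additive group L; the coefficient ring may be zero. *)
Definition gring := {malg A[L]}.
HB.instance Definition _ := GRing.Zmodule.on gring.

Definition gU (l : L) (a : A) : gring := mkmalgU l a.
Definition gco (l : L) (g : gring) : A := mcoeff l g.

Lemma gU_B l : {morph gU l : x y / x - y}.
Proof. by move=> x y; rewrite /gU raddfB. Qed.
Lemma gco_B l : {morph gco l : x y / x - y}.
Proof. by move=> x y; rewrite /gco raddfB. Qed.
Lemma gcoD l : {morph gco l : x y / x + y}.
Proof. by move=> x y; rewrite /gco raddfD. Qed.
Lemma gco0 l : gco l 0 = 0. Proof. exact: mcoeff0. Qed.
Lemma gcoU l a l' : gco l (gU l' a) = if l' == l then a else 0.
Proof. by rewrite /gco /gU mcoeffU; case: eqP. Qed.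
Lemma gco_sum l (I : Type) (s : seq I) (P : pred I) (F : I -> gring) :
  gco l (\sum_(i <- s | P i) F i) = \sum_(i <- s | P i) gco l (F i).
Proof. exact: (big_morph _ (gcoD l) (gco0 l)). Qed.
Lemma gring_ext (g h : gring) : (forall l, gco l g = gco l h) -> g = h.
Proof. by move=> e; apply/malgP. Qed.
Lemma gring_ind (P : gring -> Prop) :
  P 0 -> (forall x y, P x -> P y -> P (x + y)) -> (forall l a, P (gU l a)) ->
  forall g, P g.
Proof. exact: malg_ind. Qed.
Lemma gringE (g : gring) : exists s : seq L, uniq s /\ g = \sum_(l <- s) gU l (gco l g).
Proof. by exists (msupp g); split; [exact: fset_uniq|exact: monalgE]. Qed.

Definition gmulU (h : gring) (k : L) (a : A) : gring :=
  mlift (fun l b => gU (k + l) (a * b)) h.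
Definition gmul (g h : gring) : gring := mlift (gmulU h) g.
Definition gone : gring := gU 0 1.

Let UB a k l : {morph (fun b => gU (k + l) (a * b)) : x y / x - y}.
Proof. by move=> x y; rewrite mulrBr gU_B. Qed.

Lemma gmulU_Bl h k : {morph gmulU h k : x y / x - y}.
Proof.
move=> x y; rewrite /gmulU; elim/gring_ind: h => [|h h' IH IH'|l b].
- by rewrite !mlift0 ?subrr.
- by rewrite !mliftD // IH IH' opprD addrACA.
- by rewrite !mliftU // mulrBl gU_B.
Qed.

Lemma gmulUU k a l b : gmul (gU k a) (gU l b) = gU (k + l) (a * b).
Proof. by rewrite /gmul mliftU ?/gmulU ?mliftU //; exact: gmulU_Bl. Qed.

Lemma gmulDl : left_distributive gmul +%R.
Proof. by move=> x y z; rewrite /gmul mliftD //; exact: gmulU_Bl. Qed.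

Lemma gmulC : commutative gmul.
Proof.
have m0g g : gmul 0 g = 0 by rewrite /gmul mlift0 //; exact: gmulU_Bl.
have mg0 g : gmul g 0 = 0.
  by rewrite /gmul /mlift big1 // => k _; rewrite /gmulU mlift0.
have mDr g x y : gmul g (x + y) = gmul g x + gmul g y.
  elim/gring_ind: g => [|g g' IH IH'|k a]; first by rewrite !m0g addr0.
    by rewrite !gmulDl IH IH' addrACA.
  by rewrite /gmul !mliftU ?/gmulU ?mliftD //; exact: gmulU_Bl.
move=> x y; elim/gring_ind: x => [|g g' IH IH'|k a]; first by rewrite m0g mg0.
  by rewrite gmulDl IH IH' mDr.
elim/gring_ind: y => [|g g' IH IH'|l b]; first by rewrite m0g mg0.
  by rewrite gmulDl -IH -IH' mDr.
by rewrite !gmulUU mulrC addrC.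
Qed.

Lemma gmulA : associative gmul.
Proof.
have m0g g : gmul 0 g = 0 by rewrite /gmul mlift0 //; exact: gmulU_Bl.
have mg0 g : gmul g 0 = 0 by rewrite gmulC m0g.
have mDr g x y : gmul g (x + y) = gmul g x + gmul g y.
  by rewrite gmulC gmulDl ![gmul _ g]gmulC.
move=> x y z; elim/gring_ind: x => [|g g' IH IH'|k a]; first by rewrite !m0g.
  by rewrite !gmulDl IH IH'.
elim/gring_ind: y => [|g g' IH IH'|l b].
  by rewrite !(m0g, mg0).
  by rewrite mDr !gmulDl mDr IH IH'.
elim/gring_ind: z => [|g g' IH IH'|m c].
  by rewrite !mg0.
  by rewrite !mDr IH IH'.
by rewrite !gmulUU mulrA addrA.
Qed.

Lemma gmul1 : left_id gone gmul.
Proof.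
move=> x; elim/gring_ind: x => [|g g' IH IH'|k a].
- by rewrite gmulC /gmul mlift0 //; exact: gmulU_Bl.
- by rewrite gmulC gmulDl ![gmul _ gone]gmulC IH IH'.
- by rewrite gmulUU add0r mul1r.
Qed.

HB.instance Definition _ := GRing.Zmodule_isComPzRing.Build gring gmulA gmulC gmul1 gmulDl.
End GroupRingDef.

Section GroupRing.
Variables (A : comPzRingType) (L : zmodType).
Local Notation gring := (gring A L).

Lemma gUM k a l b : gU k a * gU l b = gU (k + l) (a * b) :> gring.
Proof. exact: gmulUU. Qed.

Lemma gco_mulU k a (g : gring) l : gco l (gU k a * g) = a * gco (l - k) g.
Proof.
elim/gring_ind: g => [|g g' IH IH'|m b]; first by rewrite mulr0 !gco0 mulr0.
  by rewrite mulrDr !gcoD IH IH' mulrDr.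
rewrite gUM !gcoU.
have -> : (m == l - k) = (k + m == l) by rewrite eq_sym subr_eq addrC eq_sym.
by case: ifP; rewrite ?mulr0.
Qed.

Definition gC : A -> gring := gU 0.
Lemma gC_B : zmod_morphism gC. Proof. exact: gU_B. Qed.
Lemma gC_M : monoid_morphism gC.
Proof. by split=> // a b; rewrite gUM addr0. Qed.
HB.instance Definition _ := GRing.isZmodMorphism.Build A gring gC gC_B.
HB.instance Definition _ := GRing.isMonoidMorphism.Build A gring gC gC_M.
End GroupRing.

(** * Free modules and the existence of base change *)

Definition fmod (A : pzRingType) (X : choiceType) := {malg A[X]}.
HB.instance Definition _ (A : pzRingType) (X : choiceType) := GRing.Zmodule.on (fmod A X).

Section FreeModule.
Variables (A : pzRingType) (X : choiceType).

Definition fscale (a : A) (g : fmod A X) : fmod A X := mlift (fun k b => mkmalgU k (a * b)) g.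

Let fB a k : {morph (fun b => mkmalgU k (a * b) : fmod A X) : x y / x - y}.
Proof. by move=> x y; rewrite mulrBr raddfB. Qed.

Lemma fscaleE a g k : mcoeff k (fscale a g) = a * mcoeff k g.
Proof.
rewrite /fscale; elim/malg_ind: g => [|g g' IH IH'|l b].
- by rewrite mlift0 ?mcoeff0 ?mulr0.
- by rewrite mliftD ?mcoeffD ?IH ?IH' ?mulrDr.
- by rewrite mliftU // !mcoeffU mulrnAr.
Qed.

Lemma fscaleA a b g : fscale a (fscale b g) = fscale (a * b) g.
Proof. by apply/malgP => k; rewrite !fscaleE mulrA. Qed.
Lemma fscale1 : left_id 1 fscale.
Proof. by move=> g; apply/malgP => k; rewrite !fscaleE mul1r. Qed.
Lemma fscaleDr : right_distributive fscale +%R.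
Proof. by move=> a g h; apply/malgP => k; rewrite mcoeffD !fscaleE mcoeffD mulrDr. Qed.
Lemma fscaleDl g : {morph fscale^~ g : a b / a + b}.
Proof. by move=> a b; apply/malgP => k; rewrite mcoeffD !fscaleE mulrDl. Qed.
End FreeModule.

HB.instance Definition _ (A : pzRingType) (X : choiceType) :=
  GRing.Zmodule_isLmodule.Build A (fmod A X) (@fscaleA A X) (@fscale1 A X)
    (@fscaleDr A X) (@fscaleDl A X).

Definition fgen (A : pzRingType) (X : choiceType) (x : X) : fmod A X := mkmalgU x 1.

Lemma fmod_lift (A : pzRingType) (X : choiceType) (N : lmodType A) (h : X -> N) :
  exists h' : fmod A X -> N, linear h' /\ forall x, h' (fgen A x) = h x.
Proof.
have phB k : {morph (fun a : A => a *: h k) : x y / x - y}.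
  by move=> x y; rewrite scalerBl.
exists (mlift (fun k a => a *: h k)); split=> [a g g'|x]; last first.
  by rewrite mliftU // scale1r.
rewrite mliftD //; congr (_ + _); elim/malg_ind: g => [|u v IH IH'|k b].
- by rewrite scaler0 mlift0 // scaler0.
- by rewrite scalerDr !mliftD // IH IH' scalerDr.
- have -> : a *: (mkmalgU k b : fmod A X) = mkmalgU k (a * b).
    by apply/malgP => l; rewrite fscaleE !mcoeffU mulrnAr.
  by rewrite !mliftU // scalerA.
Qed.

Definition restrict_scalars (R R' : pzRingType) (g : {rmorphism R -> R'})
  (N : lmodType R') : Type := N.
HB.instance Definition _ (R R' : pzRingType) (g : {rmorphism R -> R'}) (N : lmodType R') :=
  GRing.Zmodule.on (restrict_scalars g N).
Section RestrictScalars.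
Variables (R R' : pzRingType) (g : {rmorphism R -> R'}) (N : lmodType R').
Definition rsc (a : R) (x : restrict_scalars g N) : restrict_scalars g N := g a *: (x : N).
Lemma rscA a b x : rsc a (rsc b x) = rsc (a * b) x.
Proof. by rewrite /rsc scalerA rmorphM. Qed.
Lemma rsc1 : left_id 1 rsc. Proof. by move=> x; rewrite /rsc rmorph1 scale1r. Qed.
Lemma rscDr : right_distributive rsc +%R.
Proof. by move=> a x y; exact: scalerDr. Qed.
Lemma rscDl x : {morph rsc^~ x : a b / a + b}.
Proof. by move=> a b; rewrite /rsc rmorphD scalerDl. Qed.
End RestrictScalars.
HB.instance Definition _ (R R' : pzRingType) (g : {rmorphism R -> R'}) (N : lmodType R') :=
  GRing.Zmodule_isLmodule.Build R (restrict_scalars g N) (@rscA R R' g N) (@rsc1 R R' g N)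
    (@rscDr R R' g N) (@rscDl R R' g N).

Section BaseChangeExists.
Variables (R A : comPzRingType) (f : {rmorphism R -> A}) (M : lmodType R).

(** The submodule generated by the relations that make x |-> [fgen A x] semilinear, as the
    intersection of all submodules containing them. The quotient of the free module on the set M by
    it is A (x)_R M. *)
Definition bc_rel (t : fmod A M) : Prop :=
  forall Q : submod (fmod A M),
    (forall a x y, Q (fgen A (a *: x + y) - (f a *: fgen A x + fgen A y))) -> Q t.
Lemma bc_rel0 : bc_rel 0. Proof. by move=> Q _; exact: sm_zero. Qed.
Lemma bc_rel_lin a x y : bc_rel x -> bc_rel y -> bc_rel (a *: x + y).
Proof. by move=> xr yr Q QE; apply: sm_lin; [exact: xr|exact: yr]. Qed.

(** Base changes are otherwise only given by their universal property; actual ones are needed for A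
    (x)_R A and A (x)_R (A/R) when A_0 = R is proved for a torsor. *)
Lemma base_change_exists :
  exists (M' : lmodType A) (j : M -> M'), is_base_change f j.
Proof.
pose U := Submod bc_rel0 bc_rel_lin.
exists (quotm U), (fun x => qpi U (fgen A x)); split=> [a x y|R'' g N h hl].
  rewrite -qpi_lin; apply/qpi_eq => Q; exact.
have [h1 [h1l h1E]] := fmod_lift (h : M -> restrict_scalars g N).
have K0 : h1 0 = 0 by exact: linear_fun0 h1l.
have KD a x y : h1 x = 0 -> h1 y = 0 -> h1 (a *: x + y) = 0.
  by move=> x0 y0; rewrite h1l x0 y0 scaler0 addr0.
have [|h2 [h2l h2E]] := quotm_lift (U := U) h1l.
  move=> x xU; apply: (xU (Submod K0 KD)) => a y z /=.
  by rewrite (linear_funB h1l) h1l !h1E hl subrr.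
exists h2; split; first by split=> // x; rewrite h2E h1E.
move=> h' [h'l h'E]; apply: funext => q.
have [v ->] := qpi_surj q; rewrite h2E.
have h'0 : h' 0 = 0 by exact: semilinear0 h'l.
have q0 : qpi U 0 = 0 by apply/qpi_eq0; exact: bc_rel0.
elim/malg_ind: v => [|u v IH IH'|k b].
- by rewrite q0 h'0.
- have := h'l 1 (qpi U u) (qpi U v); rewrite -qpi_lin !rmorph1 !scale1r -IH -IH' => ->.
  by have := h1l 1 u v; rewrite !scale1r.
- have -> : mkmalgU k b = b *: fgen A k + 0 :> fmod A M.
    by apply/malgP => l; rewrite addr0 fscaleE !mcoeffU mulrnAr mulr1.
  rewrite qpi_lin h'l q0 h'0 h'E.
  by have := h1l b (fgen A k) 0; rewrite K0 !addr0 h1E => ->.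
Qed.
End BaseChangeExists.

(** * Torsors are strongly graded *)

(** The generated subgroup is encoded by its induction principle, so a membership hypothesis can be
    applied directly to a property closed under subtraction. *)
Definition addspan (V : zmodType) (P : V -> Prop) (x : V) : Prop :=
  forall Q : V -> Prop, Q 0 -> (forall x y, Q x -> Q y -> Q (x - y)) ->
    (forall x, P x -> Q x) -> Q x.

Section AddSpan.
Variables (V : zmodType) (P : V -> Prop).
Lemma addspan_gen x : P x -> addspan P x. Proof. by move=> Px Q _ _; apply. Qed.
Lemma addspan0 : addspan P 0. Proof. by move=> Q Q0 _ _; exact: Q0. Qed.
Lemma addspanB x y : addspan P x -> addspan P y -> addspan P (x - y).
Proof. by move=> xP yP Q Q0 QB QP; exact: QB _ _ (xP Q Q0 QB QP) (yP Q Q0 QB QP). Qed.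
Lemma addspanD x y : addspan P x -> addspan P y -> addspan P (x + y).
Proof.
move=> xP yP; rewrite -[y]opprK -[- y]sub0r; apply: (addspanB xP).
by apply: (addspanB addspan0).
Qed.
Lemma addspan_sum (I : eqType) (s : seq I) (F : I -> V) :
  (forall i, i \in s -> addspan P (F i)) -> addspan P (\sum_(i <- s) F i).
Proof.
move=> h; rewrite big_seq; apply: (big_ind (addspan P)) => [|x y|].
- exact: addspan0.
- exact: addspanD.
- exact: h.
Qed.
End AddSpan.

(** The data of a Rees ring, the sum of the K(l)[l] in A[L]. It is used for the ideals generated by
    the homogeneous components of a torsor, and for a homomorphism from L to invertible
    submodules. *)
Record mfilt (A : comPzRingType) (L : zmodType) := Mfilt {
  mfp :> L -> A -> Prop;
  mfp0 : forall l, mfp l 0;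
  mfpB : forall l x y, mfp l x -> mfp l y -> mfp l (x - y);
  mfp1 : mfp 0 1;
  mfpM : forall l m x y, mfp l x -> mfp m y -> mfp (l + m) (x * y) }.

Lemma rmorph_of (R1 R2 : pzRingType) (f : R1 -> R2) :
  {morph f : x y / x - y} -> f 1 = 1 -> {morph f : x y / x * y} ->
  exists f' : {rmorphism R1 -> R2}, f' =1 f.
Proof.
move=> fB f1 fM.
pose f' : {rmorphism R1 -> R2} := HB.pack f (GRing.isZmodMorphism.Build R1 R2 f fB)
  (GRing.isMonoidMorphism.Build R1 R2 f (conj f1 fM)).
by exists f'.
Qed.

Section Rees.
Variables (A : comPzRingType) (L : zmodType) (K : mfilt A L).

Lemma mfpD l x y : K l x -> K l y -> K l (x + y).
Proof.
move=> xP yP; rewrite -[y]opprK -[- y]sub0r.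
by apply: mfpB => //; apply: mfpB => //; exact: mfp0.
Qed.
Lemma mfp_sum l (I : eqType) (s : seq I) (F : I -> A) :
  (forall i, i \in s -> K l (F i)) -> K l (\sum_(i <- s) F i).
Proof.
move=> h; rewrite big_seq; apply: (big_ind (fun x => K l x)) => //; first exact: mfp0.
exact: mfpD.
Qed.

Definition reesp : {pred gring A L} := fun g => `[< forall l, K l (gco l g) >].
Lemma reesP g : reflect (forall l, K l (gco l g)) (g \in reesp).
Proof. exact: asboolP. Qed.

Lemma rees_closed : subring_closed reesp.
Proof.
split.
- apply/reesP => l; rewrite gcoU; case: eqP => [<-|_]; [exact: mfp1|exact: mfp0].
- move=> x y /reesP xK /reesP yK; apply/reesP => l; rewrite gco_B.
  exact: mfpB.
- move=> x y /reesP xK /reesP yK; apply/reesP => l.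
  have [s [_ ->]] := gringE x; rewrite mulr_suml gco_sum.
  apply: mfp_sum => k _; rewrite gco_mulU -{1}(subrKC k l).
  exact: mfpM.
Qed.

Definition rees := {g : gring A L | g \in reesp}.
HB.instance Definition _ := SubChoice.on rees.
HB.instance Definition _ :=
  GRing.SubChoice_isSubComPzRing.Build (gring A L) reesp rees rees_closed.

Definition inrees (g : gring A L) (gK : forall l, K l (gco l g)) : rees :=
  exist _ g (asboolT gK).
Definition rco (l : L) (x : rees) : A := gco l (val x).
Lemma rcoP l x : K l (rco l x).
Proof. by case: x => g gK; apply/reesP: l. Qed.
Lemma rees_ext x y : (forall l, rco l x = rco l y) -> x = y.
Proof. by move=> e; apply: val_inj; apply: gring_ext. Qed.

Lemma rees_lift (B : comPzRingType) (phi : {rmorphism B -> gring A L}) :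
  (forall b l, K l (gco l (phi b))) ->
  exists phi' : {rmorphism B -> rees}, forall b, val (phi' b) = phi b.
Proof.
move=> h; pose f b := inrees (h b).
have fB : {morph f : x y / x - y}.
  by move=> x y; apply: val_inj; rewrite /= rmorphB.
have f1 : f 1 = 1 by apply: val_inj; rewrite /= rmorph1.
have fM : {morph f : x y / x * y}.
  by move=> x y; apply: val_inj; rewrite /= rmorphM.
have [f' f'E] := rmorph_of fB f1 fM.
by exists f' => b; rewrite f'E.
Qed.
End Rees.

Section Grading.
Variables (L : zmodType) (R A : comPzRingType) (eta : {rmorphism R -> A}).
Variable gr : grading L eta.

Lemma grB l : {morph gr l : a b / a - b}. Proof. exact: gcompB. Qed.
Lemma gr_0 l : gr l 0 = 0. Proof. by have := grB l 0 0; rewrite !subrr. Qed.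
Lemma grD l : {morph gr l : a b / a + b}.
Proof. by move=> x y; apply/eqP; rewrite -subr_eq -grB addrK. Qed.
Lemma grN l a : gr l (- a) = - gr l a.
Proof. by rewrite -sub0r grB gr_0 sub0r. Qed.
Lemma gr_sum l (I : Type) (s : seq I) (P : pred I) (F : I -> A) :
  gr l (\sum_(i <- s | P i) F i) = \sum_(i <- s | P i) gr l (F i).
Proof. exact: (big_morph _ (grD l) (gr_0 l)). Qed.
Lemma gr_id l a : gr l (gr l a) = gr l a.
Proof. by rewrite gcompK eqxx. Qed.
Lemma gr_scal c : gr 0 (eta c) = eta c. Proof. exact: gcomp_scal. Qed.
Lemma gr_one : gr 0 1 = 1. Proof. by rewrite -(rmorph1 eta) gr_scal. Qed.

Lemma gr_ext a b : (forall l, gr l a = gr l b) -> a = b.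
Proof.
move=> e; apply/eqP; rewrite -subr_eq0; apply/eqP.
have [s [_ ->]] := gcomp_sum gr (a - b).
by rewrite big1 // => l _; rewrite grB e subrr.
Qed.

Lemma gr_mul l m a b : gr l (gr m a * b) = gr m a * gr (l - m) b.
Proof.
have [s [us bE]] := gcomp_sum gr b; rewrite [in LHS]bE [in RHS]bE.
rewrite mulr_sumr !gr_sum mulr_sumr; apply: eq_bigr => i _.
rewrite -[in LHS]gcompM [in LHS]gcompK gcompM [in RHS]gcompK subr_eq [m + i]addrC.
by case: eqP; rewrite ?mulr0.
Qed.

Lemma gr_scale l c a : gr l (eta c * a) = eta c * gr l a.
Proof. by rewrite -gr_scal gr_mul subr0. Qed.

Lemma gr_homM l m a b : gr l a = a -> gr m b = b -> gr (l + m) (a * b) = a * b.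
Proof. by move=> <- <-; rewrite gcompM. Qed.

(** The list of degrees is obtained by choice, but the coefficients do not depend on it, as
    [gco_coact] shows; multiplicativity is then checked degree by degree. *)
Definition coact (a : A) : gring A L :=
  \sum_(l <- sval (cid (gcomp_sum gr a))) gU l (gr l a).

Lemma gco_coact l a : gco l (coact a) = gr l a.
Proof.
rewrite /coact; case: (cid _) => s [us aE] /=; rewrite gco_sum.
have [ls|ls] := boolP (l \in s).
  rewrite (bigD1_seq l) //= gcoU eqxx big1 ?addr0 // => m /negbTE ml.
  by rewrite gcoU ml.
rewrite big_seq big1 => [|m ms]; last first.
  by rewrite gcoU; case: eqP => // ml; rewrite -ml ms in ls.
rewrite aE gr_sum big_seq big1 // => m ms.
by rewrite gcompK; case: eqP => // lm; rewrite lm ms in ls.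
Qed.

Lemma coact_B : zmod_morphism coact.
Proof. by move=> a b; apply: gring_ext => l; rewrite gco_B !gco_coact grB. Qed.
Lemma coact_M : monoid_morphism coact.
Proof.
split=> [|a b].
  apply: gring_ext => l; rewrite gco_coact gcoU -{1}gr_one gcompK eq_sym.
  by case: eqP => // _; exact: gr_one.
apply: gring_ext => l; rewrite gco_coact [in RHS]/coact.
case: (cid _) => s [us aE] /=; rewrite mulr_suml gco_sum {1}aE mulr_suml gr_sum.
by apply: eq_bigr => k _; rewrite gco_mulU gco_coact gr_mul.
Qed.
HB.instance Definition _ := GRing.isZmodMorphism.Build A (gring A L) coact coact_B.
HB.instance Definition _ := GRing.isMonoidMorphism.Build A (gring A L) coact coact_M.

(** The last clause amounts to A_l A_m = A_(l+m) for all l and m: multiply an element of degree l +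
    m by the expression of 1. *)
Definition strong : Prop :=
  [/\ forall c, eta c = 0 -> c = 0, forall a, gr 0 a = a -> exists c, a = eta c &
      forall l, exists s : seq (A * A), \sum_(p <- s) gr l p.1 * gr (- l) p.2 = 1].
End Grading.

Section TorsorSpan.
Variables (L : zmodType) (R : comPzRingType) (T : torsor L R).
Local Notation gr := (tgr T).

(** The ideal of T generated by the elements of degree l. These ideals are large enough for their
    Rees ring to contain both T and the image of the coaction, and small enough to carry
    information: the point is that they contain 1. *)
Definition tspan (l : L) : T -> Prop := addspan (fun z => exists a b, z = a * gr l b).

Lemma tspan1 : tspan 0 1.
Proof. by apply: addspan_gen; exists 1, 1; rewrite gr_one mulr1. Qed.

Lemma tspanM l m x y : tspan l x -> tspan m y -> tspan (l + m) (x * y).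
Proof.
move=> xl ym; apply: (xl (fun x => tspan (l + m) (x * y))).
- by rewrite mul0r; exact: addspan0.
- by move=> u v; rewrite mulrBl; exact: addspanB.
move=> _ [a [b ->]]; apply: (ym (fun y => tspan (l + m) (a * gr l b * y))).
- by rewrite mulr0; exact: addspan0.
- by move=> u v; rewrite mulrBr; exact: addspanB.
move=> _ [c [d ->]]; apply: addspan_gen; exists (a * c), (gr l b * gr m d).
by rewrite gcompM mulrACA.
Qed.

Definition tfilt : mfilt T L :=
  @Mfilt T L tspan (fun l => @addspan0 _ _) (fun l => @addspanB _ _) tspan1 tspanM.

(* The subring of A[L] generated by A and by the image of the coaction is enough to
   see that the monomials [l] are in it: the character that relates the two
   embeddings of A in this subring must be l |-> [l]. *)
Lemma torsor_sum1 l : exists s : seq (T * T), \sum_(p <- s) gr l p.1 * gr (- l) p.2 = 1.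
Proof.
have [|f fE] := @rees_lift T L tfilt T (@gC T L).
  move=> b m; rewrite gcoU; case: eqP => [<-|_]; last exact: addspan0.
  by apply: addspan_gen; exists b, 1; rewrite gr_one mulr1.
have [|g gE] := @rees_lift T L tfilt T (coact gr).
  move=> b m; rewrite gco_coact; apply: addspan_gen.
  by exists 1, b; rewrite mul1r.
have gCE c : gC L (tstr T c) = coact gr (tstr T c).
  apply: gring_ext => m; rewrite gco_coact gcoU -{2}(gr_scal gr) gcompK eq_sym.
  by case: eqP => // _; rewrite gr_scal.
have [|chi [[[chi0 chiM] chiE] _]] := @tsimple _ _ T (rees tfilt) f g.
  by move=> c; apply: val_inj; rewrite fE gE; exact: gCE.
have [|chi' [_ chi'u]] := @tsimple _ _ T (gring T L) (@gC T L) (coact gr).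
  exact: gCE.
have coactE m a : coact gr (gr m a) = gU m (gr m a).
  apply: gring_ext => n; rewrite gco_coact gcompK gcoU eq_sym.
  by case: eqP.
have e1 : chi' = val \o chi.
  apply: chi'u; split; first split=> [|m n] /=; rewrite ?chi0 ?chiM //.
  by move=> m a; rewrite /= -gE chiE -fE.
have e2 : chi' = (fun l => gU l 1).
  apply: chi'u; split; first by split=> // m n; rewrite gUM mulr1.
  by move=> m a; rewrite [LHS]coactE [RHS]gUM add0r mulr1.
(* The monomial [-l] lies in the Rees ring, so its coefficient 1 lies in the ideal generated by
   degree -l. The degree-0 part of such an expression of 1 is a sum of products of elements of
   degrees l and -l. *)
have : tspan (- l) 1.
  have := rcoP (- l) (chi (- l)); rewrite /rco.
  have -> : val (chi (- l)) = gU (- l) 1 :> gring T L by rewrite -[LHS]/((val \o chi) (- l)) -e1 e2.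
  by rewrite gcoU eqxx.
pose Q (x : T) := exists s : seq (T * T), \sum_(p <- s) gr l p.1 * gr (- l) p.2 = gr 0 x.
move=> h; have : Q 1; last by rewrite /Q gr_one.
apply: h.
- by exists [::]; rewrite big_nil gr_0.
- move=> x y [s sE] [s' s'E]; exists (s ++ [seq (- p.1, p.2) | p <- s']).
  rewrite big_cat big_map /= grB -sE -s'E; congr (_ + _).
  by rewrite -sumrN; apply: eq_bigr => p _; rewrite grN mulNr.
- move=> _ [a [b ->]]; exists [:: (a, b)].
  by rewrite big_seq1 /= mulrC [a * _]mulrC gr_mul sub0r opprK.
Qed.
End TorsorSpan.

(** The bicommutant of a commuting set of additive operators is a commutative ring containing them.
    It provides a ring of points in which the two actions of T on T (x)_R T can be compared, with no
    need for a product on the tensor product. *)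
Record comset (V : zmodType) := Comset {
  csp :> (V -> V) -> Prop;
  cs_add : forall f, csp f -> zmod_morphism f;
  cs_comm : forall f g, csp f -> csp g -> f \o g =1 g \o f }.

Section Bicommutant.
Variables (V : zmodType) (S : comset V).

Definition incomm (f : V -> V) : Prop :=
  zmod_morphism f /\ forall s, S s -> f \o s =1 s \o f.
Definition bico (f : V -> V) : Prop :=
  zmod_morphism f /\ forall g, incomm g -> f \o g =1 g \o f.

Lemma bico_gen s : S s -> bico s.
Proof.
by move=> sS; split; [exact: cs_add sS|move=> g [_ gS] x; exact: esym (gS _ sS x)].
Qed.
(** As S commutes with itself, it lies in its own commutant, so whatever commutes with the commutant
    commutes with S. This inclusion is what makes the bicommutant commutative. *)
Lemma bico_in f : bico f -> incomm f.
Proof.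
move=> [fa fc]; split=> // s sS; apply: fc; split=> [|t tS]; first exact: cs_add sS.
exact: (cs_comm sS tS).
Qed.

Definition bic := {f : V -> V | `[< bico f >]}.
HB.instance Definition _ := SubChoice.on bic.
Definition inbic f (h : bico f) : bic := exist _ f (asboolT h).
Lemma bicP (f : bic) : bico (val f). Proof. by case: f => f h; apply/asboolP. Qed.
Lemma bic_ext (f g : bic) : val f =1 val g -> f = g.
Proof. by move=> e; apply: val_inj; apply: funext. Qed.

Let ma (f : V -> V) (fa : zmod_morphism f) :
  (f 0 = 0) * ((forall x y, f (x + y) = f x + f y) * (forall x, f (- x) = - f x)).
Proof.
have f0 : f 0 = 0 by have := fa 0 0; rewrite !subrr.
have fN x : f (- x) = - f x by rewrite -sub0r fa f0 sub0r.
by split=> //; split=> // x y; rewrite -[y]opprK fa !fN opprK.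
Qed.

Lemma bico0 : bico (fun=> 0).
Proof.
by split=> [x y|g [ga _] x] /=; [rewrite subrr|rewrite (ma ga)].
Qed.
Lemma bico1 : bico id. Proof. by []. Qed.
Lemma bicoD f g : bico f -> bico g -> bico (fun x => f x + g x).
Proof.
move=> [fa fc] [ga gc]; split=> [x y|h hc x] /=; first by rewrite fa ga opprD addrACA.
by rewrite (ma hc.1); congr (_ + _); [exact: fc|exact: gc].
Qed.
Lemma bicoN f : bico f -> bico (fun x => - f x).
Proof.
move=> [fa fc]; split=> [x y|h hc x] /=; first by rewrite fa opprD.
by rewrite (ma hc.1); congr (- _); exact: fc.
Qed.
Lemma bicoM f g : bico f -> bico g -> bico (f \o g).
Proof.
move=> [fa fc] [ga gc]; split=> [x y|h hc x] /=; first by rewrite ga fa.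
by rewrite -[RHS](fc h hc (g x)) /=; congr f; exact: gc.
Qed.

Definition bic0 : bic := inbic bico0.
Definition bic1 : bic := inbic bico1.
Definition bicD (f g : bic) : bic := inbic (bicoD (bicP f) (bicP g)).
Definition bicN (f : bic) : bic := inbic (bicoN (bicP f)).
Definition bicM (f g : bic) : bic := inbic (bicoM (bicP f) (bicP g)).

Lemma bicDA : associative bicD. Proof. by move=> f g h; apply: bic_ext => x; exact: addrA. Qed.
Lemma bicDC : commutative bicD. Proof. by move=> f g; apply: bic_ext => x; exact: addrC. Qed.
Lemma bicD0 : left_id bic0 bicD. Proof. by move=> f; apply: bic_ext => x; exact: add0r. Qed.
Lemma bicDN : left_inverse bic0 bicN bicD.
Proof. by move=> f; apply: bic_ext => x; exact: addNr. Qed.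
HB.instance Definition _ := GRing.isZmodule.Build bic bicDA bicDC bicD0 bicDN.

Lemma bicMA : associative bicM. Proof. by move=> f g h; apply: bic_ext. Qed.
Lemma bicMC : commutative bicM.
Proof. by move=> f g; apply: bic_ext; exact: (bicP f).2 (bico_in (bicP g)). Qed.
Lemma bicM1 : left_id bic1 bicM. Proof. by move=> f; apply: bic_ext. Qed.
Lemma bicMDl : left_distributive bicM bicD.
Proof. by move=> f g h; apply: bic_ext. Qed.
HB.instance Definition _ := GRing.Zmodule_isComPzRing.Build bic bicMA bicMC bicM1 bicMDl.
End Bicommutant.

Lemma base_change_self (R A : comPzRingType) (f : {rmorphism R -> A}) :
  is_base_change f (f : R^o -> A^o).
Proof.
split=> [a x y|R'' g N h hl]; first by rewrite rmorphD rmorphM.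
have h0 : h 0 = 0 by exact: semilinear0 hl.
have hZ x : h x = g (f x) *: h 1.
  by have := hl x 1 0; rewrite h0 !addr0 => <-; congr h; exact/esym/mulr1.
exists (fun a : A^o => g a *: h 1); split; first split=> [a x y|x].
- by rewrite rmorphD rmorphM scalerDl scalerA.
- by rewrite -hZ.
move=> h' [h'l h'E]; apply: funext => a.
have h'0 : h' 0 = 0 by exact: semilinear0 h'l.
have := h'l a 1 0; rewrite h'0 !addr0 -[X in h' X = _ -> _]/(a * 1) mulr1 => ->.
by rewrite -h'E rmorph1.
Qed.

Lemma linear_of (R : pzRingType) (V W : lmodType R) (f : V -> W) :
  linear f -> exists f' : {linear V -> W}, f' =1 f.
Proof.
move=> fl; pose f' : {linear V -> W} := HB.pack f (GRing.isLinear.Build R V W *:%R f fl).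
by exists f'.
Qed.

(* Apply faithfulness to R --w--> W == W, which is exact in the middle iff w = 0. *)
Lemma base_change_faithful (R A : comPzRingType) (f : {rmorphism R -> A}) (W : lmodType R)
  (W' : lmodType A) (j : W -> W') w :
  faithfully_flat f -> is_base_change f j -> j w = 0 -> w = 0.
Proof.
move=> ff jb jw.
have [u uE] : exists u : {linear R^o -> W}, forall r, u r = r *: w.
  by apply: linear_of => a x y; rewrite scalerDl scalerA.
have [v vE] : exists v : {linear A^o -> W'}, forall r, v r = r *: j w.
  by apply: linear_of => a x y; rewrite scalerDl scalerA.
have [jl _] := jb.
have vu (r : R^o) : v (f r) = j (u r) by rewrite vE uE (semilinearZ jl).
have [_ e] := ff _ _ _ u idfun _ _ _ v idfun _ j j (base_change_self f) jb jb vu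
  (fun=> erefl).
suff /e /(_ w) [_ ww] : exact_at v idfun by apply: ww; exists 1; rewrite uE scale1r.
move=> x; split=> [x0|[r <-]]; first by exists 0; rewrite vE scale0r -[LHS]x0.
by rewrite /= vE jw scaler0.
Qed.

Section TorsorStrong.
Variables (L : zmodType) (R : comPzRingType) (T : torsor L R).
Local Notation gr := (tgr T).
Local Notation eta := (tstr T).

Lemma torsor_inj c : eta c = 0 -> c = 0.
Proof. by move=> c0; apply: (base_change_faithful (@tff _ _ T) (base_change_self eta)). Qed.

(* The two embeddings of T in T (x)_R T agree on degree 0, as the character relating
   them is 1 there; T (x)_R T is used through its left and right multiplications. *)
Lemma torsor_tensor : forall (M' : lmodType T) (j : restrict_scalars eta T^o -> M'),
  is_base_change eta j -> forall a, gr 0 a = a -> j a = a *: j 1.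
Proof.
move=> M' j jb; have [jl ju] := jb.
(* M' is T (x)_R T with j x = 1 (x) x: scalars act on the left factor, and the universal property
   yields multiplication by b on the right factor. *)
have Rex (b : T) : exists h : M' -> M', linear h /\ forall x : T, h (j x) = j (b * x).
  have [|h [[hl hE] _]] := ju T idfun M' (fun x : T => j (b * x)).
    move=> a x y /=; rewrite -jl; congr j.
    rewrite mulrDr; congr (_ + _).
    exact: mulrCA.
  by exists h.
pose Rm b := sval (cid (Rex b)).
have Rl b : linear (Rm b) := (svalP (cid (Rex b))).1.
have RE b x : Rm b (j x) = j (b * x) := (svalP (cid (Rex b))).2 x.
have RB b : zmod_morphism (Rm b).
  by move=> x y; exact: linear_funB (Rl b) x y.
have jB x y : j (x - y) = j x - j y by exact: semilinearB jl x y.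
have ind (h h' : M' -> M') : linear h -> linear h' -> (forall x, h (j x) = h' (j x)) ->
    h =1 h'.
  move=> hl h'l e x.
  have K0 : h 0 = h' 0 by rewrite (linear_fun0 hl) (linear_fun0 h'l).
  have KD a y z : h y = h' y -> h z = h' z -> h (a *: y + z) = h' (a *: y + z).
    by move=> ey ez; rewrite hl h'l ey ez.
  exact: (base_change_ind (K := Submod K0 KD) jb).
have RR b c : Rm b \o Rm c =1 Rm (b * c).
  apply: ind => [a x y|//|x] /=; first by rewrite !Rl.
  by rewrite !RE mulrA.
have LR a b x : a *: Rm b x = Rm b (a *: x).
  exact: esym (linear_funZ (Rl b) a x).
pose S (f : M' -> M') := (exists a : T, f = *:%R a) \/ (exists b, f = Rm b).
have Sadd f : S f -> zmod_morphism f.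
  by case=> [[a ->]|[b ->]] // x y; rewrite scalerBr.
have Scomm f g : S f -> S g -> f \o g =1 g \o f.
  move=> [[a ->]|[b ->]] [[c ->]|[d ->]] x /=.
  - by rewrite !scalerA mulrC.
  - exact: LR.
  - by rewrite LR.
  - by rewrite -[LHS]/((Rm b \o Rm d) x) -[RHS]/((Rm d \o Rm b) x) !RR mulrC.
pose CS := Comset Sadd Scomm.
have SL a : bico CS ( *:%R a) by apply: bico_gen; left; exists a.
have SR b : bico CS (Rm b) by apply: bico_gen; right; exists b.
have fB : {morph (fun a => inbic (SL a)) : x y / x - y}.
  by move=> a b; apply: bic_ext => x /=; rewrite scalerBl.
have f1 : inbic (SL 1) = 1 by apply: bic_ext => x /=; rewrite scale1r.
have fM : {morph (fun a => inbic (SL a)) : x y / x * y}.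
  by move=> a b; apply: bic_ext => x /=; rewrite scalerA.
have [f fE] := rmorph_of fB f1 fM.
have RB1 a b : Rm (a - b) =1 (fun x => Rm a x - Rm b x).
  apply: ind => // [c x y|x]; first by rewrite !Rl scalerBr opprD addrACA.
  by rewrite !RE mulrBl jB.
have R11 : Rm 1 =1 id by apply: ind => // x; rewrite RE mul1r.
have gB : {morph (fun a => inbic (SR a)) : x y / x - y}.
  by move=> a b; apply: bic_ext; exact: RB1.
have g1 : inbic (SR 1) = 1 by apply: bic_ext; exact: R11.
have gM : {morph (fun a => inbic (SR a)) : x y / x * y}.
  by move=> a b; apply: bic_ext => x /=; rewrite -RR.
have [g gE] := rmorph_of gB g1 gM.
have [|chi [[[chi0 _] chiE] _]] := @tsimple _ _ T (bic CS) f g.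
  move=> c; rewrite fE gE; apply: bic_ext => /=; apply: ind => // [a x y|x].
    by rewrite scalerDr !scalerA mulrC.
  rewrite RE; exact: esym (semilinearZ jl c x).
move=> a a0; have := chiE 0 a; rewrite a0 chi0 mulr1 fE gE => /(congr1 val) /= e.
have := congr1 (fun h : M' -> M' => h (j 1)) e; rewrite RE mulr1 => ->.
by [].
Qed.

(** If a has degree 0, then 1 (x) a = a (x) 1, so the class of a in the R-module T/R becomes zero
    after base change to T; by faithfulness it was zero. *)
Lemma torsor_deg0 a : gr 0 a = a -> exists c, a = eta c.
Proof.
move=> a0.
have [M' [j jb]] := base_change_exists eta (restrict_scalars eta T^o).
have U0 : exists c, (0 : restrict_scalars eta T^o) = eta c by exists 0; rewrite rmorph0.
have UD b (x y : restrict_scalars eta T^o) :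
    (exists c, x = eta c) -> (exists c, y = eta c) -> exists c, b *: x + y = eta c.
  move=> [c ->] [d ->]; exists (b * c + d); rewrite rmorphD rmorphM.
  by congr (_ + _).
pose U := Submod U0 UD.
have [W' [jW jWb]] := base_change_exists eta (quotm U).
suff : qpi U a = 0 by move/qpi_eq0.
apply: (base_change_faithful (@tff _ _ T) jWb).
have [jWl _] := jWb.
have [|h [[hl hE] _]] := jb.2 T idfun W' (fun x => jW (qpi U x)).
  by move=> c x y /=; rewrite -jWl -qpi_lin.
rewrite -hE (torsor_tensor jb a0).
rewrite (semilinearZ (f := idfun) hl) hE.
have -> : qpi U 1 = 0 by apply/qpi_eq0; exists 1; rewrite rmorph1.
by rewrite (semilinear0 jWl) scaler0.
Qed.

Lemma torsor_strong : strong gr.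
Proof. by split; [exact: torsor_inj|exact: torsor_deg0|exact: torsor_sum1]. Qed.
End TorsorStrong.

(** * Strongly graded algebras are torsors *)

Lemma sum_widen (I : eqType) (V : zmodType) (s t : seq I) (F : I -> V) :
  uniq s -> uniq t -> {subset s <= t} -> (forall i, i \notin s -> F i = 0) ->
  \sum_(i <- t) F i = \sum_(i <- s) F i.
Proof.
move=> us ut st F0; rewrite (bigID (mem s)) /= [X in _ + X]big1 ?addr0; last exact: F0.
rewrite -big_filter; apply: perm_big; apply: uniq_perm => //; first exact: filter_uniq.
by move=> i; rewrite mem_filter; apply/andP/idP => [[]|is'] //; split=> //; exact: st.
Qed.

(* The degree-0 projection M' -> M of a base change is not A-linear, but its adjoint
   M' -> Hom_R(A, M) is, and comes from the universal property. *)
Definition coind (A : comPzRingType) (M : zmodType) := {h : A -> M | `[< zmod_morphism h >]}.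
HB.instance Definition _ (A : comPzRingType) (M : zmodType) := SubChoice.on (coind A M).

Section Coind.
Variables (A : comPzRingType) (M : zmodType).
Definition incoind (h : A -> M) (hB : zmod_morphism h) : coind A M := exist _ h (asboolT hB).
Lemma coindP (h : coind A M) : zmod_morphism (val h).
Proof. by case: h => h hB; apply/asboolP. Qed.
Lemma coind_ext (f g : coind A M) : val f =1 val g -> f = g.
Proof. by move=> e; apply: val_inj; apply: funext. Qed.
Lemma coindD_subproof (f g : coind A M) : zmod_morphism (fun x => val f x + val g x).
Proof. by move=> x y; rewrite !coindP opprD addrACA. Qed.
Lemma coindN_subproof (f : coind A M) : zmod_morphism (fun x => - val f x).
Proof. by move=> x y; rewrite !coindP opprD. Qed.
Lemma coind0_subproof : zmod_morphism (fun _ : A => 0 : M).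
Proof. by move=> x y; rewrite subrr. Qed.
Lemma coindZ_subproof (a : A) (f : coind A M) : zmod_morphism (fun x => val f (a * x)).
Proof. by move=> x y; rewrite mulrBr coindP. Qed.
Definition coindD f g := incoind (coindD_subproof f g).
Definition coindN f := incoind (coindN_subproof f).
Definition coindZ a f := incoind (coindZ_subproof a f).
Lemma coindDA : associative coindD.
Proof. by move=> f g h; apply: coind_ext => x; exact: addrA. Qed.
Lemma coindDC : commutative coindD. Proof. by move=> f g; apply: coind_ext => x; exact: addrC. Qed.
Lemma coindD0 : left_id (incoind coind0_subproof) coindD.
Proof. by move=> f; apply: coind_ext => x; exact: add0r. Qed.
Lemma coindDN : left_inverse (incoind coind0_subproof) coindN coindD.
Proof. by move=> f; apply: coind_ext => x; exact: addNr. Qed.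
HB.instance Definition _ := GRing.isZmodule.Build (coind A M) coindDA coindDC coindD0 coindDN.
Lemma coindZA a b f : coindZ a (coindZ b f) = coindZ (a * b) f.
Proof. by apply: coind_ext => x /=; rewrite mulrCA mulrA. Qed.
Lemma coindZ1 : left_id 1 coindZ.
Proof. by move=> f; apply: coind_ext => x /=; rewrite mul1r. Qed.
Lemma coindZDr : right_distributive coindZ +%R.
Proof. by move=> a f g; apply: coind_ext. Qed.
Lemma coindZDl f : {morph coindZ^~ f : a b / a + b}.
Proof.
move=> a b; apply: coind_ext => x /=; rewrite mulrDl.
have h0 : val f 0 = 0 by have := coindP f 0 0; rewrite !subrr.
have hN y : val f (- y) = - val f y by have := coindP f 0 y; rewrite h0 !sub0r.
by rewrite -[b * x]opprK coindP !hN opprK.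
Qed.
HB.instance Definition _ := GRing.Zmodule_isLmodule.Build A (coind A M)
  coindZA coindZ1 coindZDr coindZDl.
End Coind.

Section Strong.
Variables (L : zmodType) (R A : comPzRingType) (eta : {rmorphism R -> A}).
Variables (gr : grading L eta) (st : strong gr).

Lemma eta_inj : injective eta.
Proof.
have [e0 _ _] := st.
by move=> x y e; apply/eqP; rewrite -subr_eq0; apply/eqP/e0; rewrite rmorphB e subrr.
Qed.

Lemma eps_ex a : exists c, eta c = gr 0 a.
Proof. by have [_ e0 _] := st; have [c ->] := e0 _ (gr_id gr 0 a); exists c. Qed.
Definition eps a : R := sval (cid (eps_ex a)).
Lemma epsE a : eta (eps a) = gr 0 a. Proof. exact: svalP (cid (eps_ex a)). Qed.
Lemma epsK a : gr 0 a = a -> eta (eps a) = a. Proof. by rewrite epsE. Qed.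
Lemma eps_eta c : eps (eta c) = c.
Proof. by apply: eta_inj; rewrite epsE gr_scal. Qed.
Lemma epsB : {morph eps : a b / a - b}.
Proof. by move=> a b; apply: eta_inj; rewrite rmorphB !epsE grB. Qed.
Lemma epsD : {morph eps : a b / a + b}.
Proof. by move=> a b; apply: eta_inj; rewrite rmorphD !epsE grD. Qed.
Lemma eps0 : eps 0 = 0. Proof. by rewrite -(rmorph0 eta) eps_eta. Qed.
Lemma eps1 : eps 1 = 1. Proof. by rewrite -(rmorph1 eta) eps_eta. Qed.
Lemma epsZ c a : eps (eta c * a) = c * eps a.
Proof. by apply: eta_inj; rewrite rmorphM !epsE gr_scale. Qed.
Lemma eps_sum (I : Type) (s : seq I) (F : I -> A) :
  eps (\sum_(i <- s) F i) = \sum_(i <- s) eps (F i).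
Proof. exact: (big_morph _ epsD eps0). Qed.

(** Such a list is a dual basis of A_l: an element a of degree l is the sum of the (a p.2) p.1,
    where a p.2 has degree 0 and is therefore a scalar of R. *)
Lemma res_ex l : exists s : seq (A * A),
  (forall p, p \in s -> gr l p.1 = p.1 /\ gr (- l) p.2 = p.2) /\ \sum_(p <- s) p.1 * p.2 = 1.
Proof.
have [_ _ e] := st; have [s s1] := e l.
exists [seq (gr l p.1, gr (- l) p.2) | p <- s]; split; last by rewrite big_map.
by move=> p /mapP[q _ ->] /=; rewrite !gr_id.
Qed.
Definition res l := sval (cid (res_ex l)).
Lemma res_sum l : \sum_(p <- res l) p.1 * p.2 = 1.
Proof. exact: (svalP (cid (res_ex l))).2. Qed.
Lemma res_fst l p : p \in res l -> gr l p.1 = p.1.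
Proof. by move=> h; have [] := (svalP (cid (res_ex l))).1 p h. Qed.
Lemma res_snd l p : p \in res l -> gr (- l) p.2 = p.2.
Proof. by move=> h; have [] := (svalP (cid (res_ex l))).1 p h. Qed.

Lemma eps_res l a p : gr l a = a -> p \in res l -> eta (eps (a * p.2)) = a * p.2.
Proof.
by move=> al pl; rewrite epsK // -(subrr l); apply: gr_homM => //; exact: res_snd.
Qed.

Section Flat.
Variables (M : lmodType R) (M' : lmodType A) (j : M -> M').
Hypothesis jb : is_base_change eta j.

Lemma bc_proj : exists pi : M' -> M,
  zmod_morphism pi /\ forall a x, pi (a *: j x) = eps a *: x.
Proof.
have [jl ju] := jb.
have hB (x : M) : zmod_morphism (fun b => eps b *: x) by move=> a b; rewrite epsB scalerBl.
have [|h [[hl hE] _]] := ju A idfun (coind A M) (fun x => incoind (hB x)).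
  by move=> c x y; apply: coind_ext => b /=; rewrite scalerDr epsZ !scalerA mulrC.
exists (fun y => val (h y) 1); split=> [x y|a x].
  by rewrite (semilinearB (f := idfun) hl).
by rewrite (semilinearZ (f := idfun) hl) hE /= mulr1.
Qed.

Definition bpi : M' -> M := sval (cid bc_proj).
Lemma bpiB : zmod_morphism bpi. Proof. exact: (svalP (cid bc_proj)).1. Qed.
Lemma bpiE a x : bpi (a *: j x) = eps a *: x.
Proof. exact: (svalP (cid bc_proj)).2. Qed.
Lemma bpij x : bpi (j x) = x. Proof. by rewrite -[j x]scale1r bpiE eps1 scale1r. Qed.
Lemma bpi0 : bpi 0 = 0. Proof. by have := bpiB 0 0; rewrite !subrr. Qed.

Lemma bc_span y : addspan (fun z => exists a x, z = a *: j x) y.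
Proof.
pose P := addspan (fun z => exists a x, z = a *: j x).
have P0 : P 0 by exact: addspan0.
have PZ a x y' : P x -> P y' -> P (a *: x + y').
  move=> xP yP; apply: addspanD => //; apply: (xP (fun x => P (a *: x))).
  - by rewrite scaler0.
  - by move=> u v uP vP; rewrite scalerBr; exact: addspanB.
  - by move=> _ [b [z ->]]; apply: addspan_gen; exists (a * b), z; rewrite scalerA.
apply: (base_change_ind (K := Submod P0 PZ) jb) => x /=.
by apply: addspan_gen; exists 1, x; rewrite scale1r.
Qed.

Lemma bc_ind (Q : M' -> Prop) : Q 0 -> (forall x y, Q x -> Q y -> Q (x - y)) ->
  (forall a x, Q (a *: j x)) -> forall y, Q y.
Proof. by move=> Q0 QB QE y; apply: (@bc_span y Q) => // _ [a [x ->]]. Qed.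

(** The projection of A (x)_R M onto A_l (x)_R M: elements of degree -l move degree l to degree 0,
    where [bpi] is available, and their partners of degree l move the result back. *)
Definition bpr (l : L) (y : M') : M' := \sum_(p <- res l) p.1 *: j (bpi (p.2 *: y)).

Lemma bprB l : {morph bpr l : x y / x - y}.
Proof.
move=> x y; rewrite /bpr -sumrB; apply: eq_bigr => p _.
by rewrite scalerBr bpiB (semilinearB jb.1) scalerBr.
Qed.
Lemma bprE l a x : bpr l (a *: j x) = gr l a *: j x.
Proof.
rewrite /bpr -[gr l a]mul1r -(res_sum l) mulr_suml scaler_suml.
rewrite !big_seq; apply: eq_bigr => p pl.
rewrite scalerA bpiE (semilinearZ jb.1) scalerA epsE -(res_snd pl) gr_mul sub0r opprK.
by rewrite (res_snd pl) mulrA.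
Qed.

Lemma bpr_sum y : exists s : seq L, y = \sum_(l <- s) bpr l y.
Proof.
suff [s [us [_ e]]] : exists s : seq L, uniq s /\
    (forall l, l \notin s -> bpr l y = 0) /\ y = \sum_(l <- s) bpr l y by exists s.
pose Q y := exists s : seq L, uniq s /\
    (forall l, l \notin s -> bpr l y = 0) /\ y = \sum_(l <- s) bpr l y.
apply: (@bc_ind Q).
- exists [::]; rewrite big_nil; do 2!split=> //.
  by move=> l _; have := bprB l 0 0; rewrite !subrr.
- move=> x z [s [us [s0 sE]]] [t [ut [t0 tE]]]; exists (undup (s ++ t)).
  split; first exact: undup_uniq; split.
    move=> l; rewrite mem_undup mem_cat negb_or => /andP[ls lt].
    by rewrite bprB s0 // t0 // subrr.
  under eq_bigr do rewrite bprB.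
  rewrite sumrB (sum_widen us) ?undup_uniq // -?sE; last first.
    by move=> i; rewrite mem_undup mem_cat => ->.
  rewrite (sum_widen ut) ?undup_uniq // -?tE //.
  by move=> i; rewrite mem_undup mem_cat => ->; rewrite orbT.
- move=> a x; have [s [us aE]] := gcomp_sum gr a; exists s; do 2!split=> //.
    move=> l ls; rewrite bprE aE gr_sum big_seq big1 ?scale0r // => i si.
    by rewrite gcompK; case: eqP => // e; rewrite e si in ls.
  by under eq_bigr do rewrite bprE; rewrite -scaler_suml -aE.
Qed.
End Flat.

(** The retractions [bpi] are natural in the module. Given y in the kernel of v', the element
    [bpi (q *: y)] lies in the kernel of v, hence in the image of u, for every q; the projections of
    y to all degrees are assembled from such elements, and y is their sum. For the converse, go to
    the base change by [j] and come back by [bpi]. *)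
Lemma strong_ff : faithfully_flat eta.
Proof.
move=> M1 M2 M3 u v M1' M2' M3' u' v' j1 j2 j3 b1 b2 b3 e1 e2.
have nat (X Y : lmodType R) (X' Y' : lmodType A) (i : X -> X') (i' : Y -> Y')
    (ib : is_base_change eta i) (ib' : is_base_change eta i')
    (w : {linear X -> Y}) (w' : {linear X' -> Y'}) :
    (forall x, w' (i x) = i' (w x)) -> forall y, bpi ib' (w' y) = w (bpi ib y).
  move=> e y; apply: (bc_ind ib (Q := fun y => bpi ib' (w' y) = w (bpi ib y))).
  - by rewrite bpi0 !raddf0 bpi0.
  - by move=> x z ex ez; rewrite raddfB !bpiB raddfB ex ez.
  - by move=> a x; rewrite linearZ /= e !bpiE linearZ.
have vu' : exact_at u v -> forall y, v' (u' y) = 0.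
  move=> ex y; apply: (bc_ind b1 (Q := fun y => v' (u' y) = 0)).
  - by rewrite !raddf0.
  - by move=> x z ex' ez; rewrite (linearB u') (linearB v') ex' ez subrr.
  - move=> a x; rewrite !linearZ /= e1 e2.
    by have /ex -> : exists y, u y = u x; [exists x|rewrite (semilinear0 b3.1) scaler0].
split=> ex y; split.
- move=> vy; have [s ->] := bpr_sum b2 y.
  have vp q : exists x, u x = bpi b2 (q *: y).
    apply/ex; rewrite -(nat _ _ _ _ _ _ b2 b3 v v' e2) linearZ /= vy scaler0.
    exact: bpi0.
  pose z q := sval (cid (vp q)).
  exists (\sum_(l <- s) \sum_(p <- res l) p.1 *: j1 (z p.2)).
  rewrite raddf_sum; apply: eq_bigr => l _; rewrite raddf_sum; apply: eq_bigr => p _ /=.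
  by rewrite linearZ /= e1 (svalP (cid (vp p.2))).
- by move=> [x <-]; exact: vu'.
- move=> vy; have /ex[x ux] : v' (j2 y) = 0 by rewrite e2 vy (semilinear0 b3.1).
  by exists (bpi b1 x); rewrite -(nat _ _ _ _ _ _ b1 b2 u u' e1) ux bpij.
- move=> [x <-]; rewrite -(bpij b3 (v (u x))) -e2 -e1.
  have -> : v' (u' (j1 x)) = 0 by apply/ex; exists (j1 x).
  exact: bpi0.
Qed.

Lemma strong_simple (B : comPzRingType) (f g : {rmorphism A -> B}) :
  (forall c, f (eta c) = g (eta c)) ->
  exists! chi : L -> B, is_character chi /\
      forall l a, g (gr l a) = f (gr l a) * chi l.
Proof.
move=> fg.
(* This value is forced: p.2 has degree l, so g p.2 must be f p.2 * chi l, and the f p.1 * f p.2 sum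
   to 1. *)
pose chi l := \sum_(p <- res (- l)) f p.1 * g p.2.
have uni l (x y : B) : (forall a, f (gr l a) * x = f (gr l a) * y) -> x = y.
  move=> e; rewrite -[x]mul1r -[y]mul1r -(rmorph1 f) -(res_sum l) rmorph_sum !mulr_suml.
  rewrite !big_seq; apply: eq_bigr => p pl.
  by rewrite mulrC rmorphM mulrA [x * _]mulrC -(res_fst pl) e [RHS]mulrC mulrA
    [y * _]mulrC.
have chiE l a : g (gr l a) = f (gr l a) * chi l.
  rewrite /chi mulr_sumr -[in LHS](mulr1 (gr l a)) -(res_sum (- l)) mulr_sumr rmorph_sum.
  rewrite !big_seq; apply: eq_bigr => p pl.
  have e : gr 0 (gr l a * p.1) = gr l a * p.1.
    by rewrite -(subrr l); apply: gr_homM; [exact: gr_id|exact: res_fst].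
  by rewrite mulrA rmorphM -(epsK e) -fg (epsK e) rmorphM -mulrA.
exists chi; split; first split=> //; first split.
- by apply: (uni 0) => a; rewrite -chiE mulr1 -epsE fg.
- move=> l m; apply: (uni (l + m)) => a.
  rewrite -chiE -[in LHS](mulr1 (gr _ a)) -(res_sum l) mulr_sumr rmorph_sum.
  rewrite -[in RHS](mulr1 (gr _ a)) -(res_sum l) mulr_sumr rmorph_sum mulr_suml.
  rewrite !big_seq; apply: eq_bigr => p pl.
  have e : gr m (gr (l + m) a * p.2) = gr (l + m) a * p.2.
    have {1}-> : m = l + m + (- l) by rewrite addrC addKr.
    by apply: gr_homM; [exact: gr_id|exact: res_snd].
  have e1 : g (gr (l + m) a * p.2) = f (gr (l + m) a * p.2) * chi m by rewrite -e chiE.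
  have e2 : g p.1 = f p.1 * chi l by rewrite -(res_fst pl) chiE.
  have -> : gr (l + m) a * (p.1 * p.2) = gr (l + m) a * p.2 * p.1.
    by rewrite [p.1 * _]mulrC mulrA.
  rewrite (rmorphM g) (rmorphM f) e1 e2.
  by rewrite mulrACA [chi m * _]mulrC.
- move=> chi' [_ chi'E]; apply: funext => l; apply: (uni l) => a.
  by rewrite -chiE chi'E.
Qed.

Definition strong_torsor : torsor L R := Torsor strong_ff strong_simple.
End Strong.

(** * Invertible submodules of a ring extension *)

Section LgrpUniversal.
Variables (n : nat) (r : 'I_n -> nat) (U : zmodType) (C : U) (X : 'I_n -> U).
Hypothesis XC : forall i, X i *+ r i = C.

Definition lfree_hom (z : Lfree n) : U := C *~ z.1 + \sum_i X i *~ z.2 i.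

Lemma lfree_homB : {morph lfree_hom : x y / x - y}.
Proof.
move=> x y; rewrite /lfree_hom /= mulrzBr opprD addrACA -sumrB; congr (_ + _).
by apply: eq_bigr => i _; rewrite !ffunE mulrzBr.
Qed.

Lemma lfree_hom0 : lfree_hom 0 = 0.
Proof. by have := lfree_homB 0 0; rewrite !subrr. Qed.
Lemma lfree_homD : {morph lfree_hom : x y / x + y}.
Proof. by move=> x y; apply/eqP; rewrite -subr_eq -lfree_homB addrK. Qed.
Lemma lfree_homN : {morph lfree_hom : x / - x}.
Proof. by move=> x; have := lfree_homB 0 x; rewrite lfree_hom0 !sub0r. Qed.
Lemma lfree_homMn x k : lfree_hom (x *+ k) = lfree_hom x *+ k.
Proof.
by elim: k => [|k IH]; [rewrite !mulr0n lfree_hom0|rewrite !mulrSr lfree_homD IH].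
Qed.
Lemma lfree_homMz x (k : int) : lfree_hom (x *~ k) = lfree_hom x *~ k.
Proof.
case: k => k; rewrite ?NegzE ?mulrNz ?lfree_homN -!pmulrn lfree_homMn //.
Qed.
Lemma lfree_hom_c : lfree_hom (Lfree_c n) = C.
Proof.
by rewrite /lfree_hom /= mulr1z big1 ?addr0 // => i _; rewrite ffunE mulr0z.
Qed.
Lemma lfree_hom_x i : lfree_hom (Lfree_x i) = X i.
Proof.
rewrite /lfree_hom /= mulr0z add0r (bigD1 i) //= ffunE eqxx mulr1z big1 ?addr0 //.
by move=> j /negbTE ji; rewrite ffunE ji mulr0z.
Qed.

Lemma lfree_hom_rel z : z \in Lrel r -> lfree_hom z = 0.
Proof.
move=> /asboolP[t ->]; rewrite (big_morph _ lfree_homD lfree_hom0) big1 // => i _.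
by rewrite lfree_homMz lfree_homB lfree_homMn lfree_hom_c lfree_hom_x XC subrr mul0rz.
Qed.

Definition lgrp_hom (l : Lgrp r) : U := lfree_hom (repr (l : {ideal_quot (Lrel r)})).

Lemma lgrp_hom_pi z : lgrp_hom (\pi_{ideal_quot (Lrel r)} z) = lfree_hom z.
Proof.
apply/eqP; rewrite -subr_eq0 -lfree_homB; apply/eqP/lfree_hom_rel.
by rewrite Quotient.idealrBE reprK.
Qed.

Lemma lgrp_surj (l : Lgrp r) : exists z, l = \pi_{ideal_quot (Lrel r)} z.
Proof. by exists (repr (l : {ideal_quot (Lrel r)})); rewrite reprK. Qed.

Lemma lgrp_homD : {morph lgrp_hom : x y / x + y}.
Proof.
move=> x y; have [u ->] := lgrp_surj x; have [v ->] := lgrp_surj y.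
by rewrite -raddfD !lgrp_hom_pi lfree_homD.
Qed.
Lemma lgrp_homB : {morph lgrp_hom : x y / x - y}.
Proof. by move=> x y; apply/eqP; rewrite -[_ == _]subr_eq opprK -lgrp_homD subrK. Qed.
Lemma lgrp_hom0 : lgrp_hom 0 = 0.
Proof. by have := lgrp_homB 0 0; rewrite !subrr. Qed.
Lemma lgrp_hom_x i : lgrp_hom (Lx r i) = X i.
Proof. by rewrite /Lx lgrp_hom_pi lfree_hom_x. Qed.
Lemma lgrp_hom_c : lgrp_hom (Lc r) = C.
Proof. by rewrite /Lc lgrp_hom_pi lfree_hom_c. Qed.
End LgrpUniversal.

Section InvSub.
Variables (R T : comPzRingType) (eta : {rmorphism R -> T}).

Definition is_sm (P : T -> Prop) : Prop :=
  [/\ P 0, forall x y, P x -> P y -> P (x - y) & forall c x, P x -> P (eta c * x)].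
Definition smul (P Q : T -> Prop) : T -> Prop :=
  addspan (fun z => exists x y, P x /\ Q y /\ z = x * y).
Definition sone (x : T) : Prop := exists c, x = eta c.

Lemma smul_gen (P Q : T -> Prop) x y : P x -> Q y -> smul P Q (x * y).
Proof. by move=> Px Qy; apply: addspan_gen; exists x, y. Qed.

Lemma smul_le (P Q K : T -> Prop) : K 0 -> (forall x y, K x -> K y -> K (x - y)) ->
  (forall x y, P x -> Q y -> K (x * y)) -> forall z, smul P Q z -> K z.
Proof. by move=> K0 KB KM z; apply => // _ [x [y [Px [Qy ->]]]]; exact: KM. Qed.

Lemma smul_sm P Q : is_sm P -> is_sm (smul P Q).
Proof.
move=> [P0 PB PZ]; split; first exact: addspan0.
  by move=> x y; exact: addspanB.
move=> c; apply: smul_le => [|x y|x y Px Qy].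
- by rewrite mulr0; exact: addspan0.
- by rewrite mulrBr; exact: addspanB.
- by rewrite mulrA; apply: smul_gen => //; exact: PZ.
Qed.

Lemma predeq (P Q : T -> Prop) : (forall x, P x -> Q x) -> (forall x, Q x -> P x) -> P = Q.
Proof. by move=> PQ QP; apply: funext => x; apply: propext; split; [exact: PQ|exact: QP]. Qed.

Lemma smulC P Q : smul P Q = smul Q P.
Proof.
by apply: predeq; apply: smul_le => [|x y|x y Px Qy]; [exact: addspan0|exact: addspanB|
  rewrite mulrC; exact: smul_gen|exact: addspan0|exact: addspanB|
  rewrite mulrC; exact: smul_gen].
Qed.

Lemma smulA_le P Q K z : smul (smul P Q) K z -> smul P (smul Q K) z.
Proof.
move: z; apply: smul_le => [|x y|x y]; [exact: addspan0|exact: addspanB|].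
move=> xPQ Ky; move: x xPQ; apply: smul_le => [|x z|x z Px Qz].
- by rewrite mul0r; exact: addspan0.
- by rewrite mulrBl; exact: addspanB.
- by rewrite -mulrA; apply: smul_gen => //; exact: smul_gen.
Qed.

Lemma smulA P Q K : smul P (smul Q K) = smul (smul P Q) K.
Proof.
apply: predeq => z; last exact: smulA_le.
by rewrite smulC (smulC Q) => /smulA_le; rewrite smulC [smul Q P]smulC.
Qed.

Lemma smul1 P : is_sm P -> smul sone P = P.
Proof.
move=> [P0 PB PZ]; apply: predeq.
  by apply: smul_le => // x y [c ->]; exact: PZ.
by move=> x Px; rewrite -[x]mul1r; apply: smul_gen => //; exists 1; rewrite rmorph1.
Qed.

Lemma sone_sm : is_sm sone.
Proof.
split; first by exists 0; rewrite rmorph0.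
  by move=> _ _ [c ->] [d ->]; exists (c - d); rewrite rmorphB.
by move=> c _ [d ->]; exists (c * d); rewrite rmorphM.
Qed.

(* An invertible submodule is stored together with its inverse, so that the abelian
   group of these pairs has its opposite for free. *)
Definition isp (p : (T -> Prop) * (T -> Prop)) : Prop :=
  [/\ is_sm p.1, is_sm p.2 & smul p.1 p.2 = sone].
Definition invsub := {p : (T -> Prop) * (T -> Prop) | `[< isp p >]}.
HB.instance Definition _ := SubChoice.on invsub.
Definition inis p (h : isp p) : invsub := exist _ p (asboolT h).
Lemma invsubP (p : invsub) : isp (val p). Proof. by case: p => p h; apply/asboolP. Qed.

Lemma isD_subproof (p q : invsub) : isp (smul (val p).1 (val q).1, smul (val p).2 (val q).2).
Proof.
have [p1 p2 p12] := invsubP p; have [q1 q2 q12] := invsubP q.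
split; [exact: smul_sm|exact: smul_sm|] => /=.
rewrite -smulA [smul (val q).1 _]smulA [smul (val q).1 _]smulC -smulA q12.
by rewrite [smul (val p).2 sone]smulC smul1.
Qed.
Lemma isN_subproof (p : invsub) : isp ((val p).2, (val p).1).
Proof. by have [p1 p2 p12] := invsubP p; split=> //=; rewrite smulC. Qed.
Lemma is0_subproof : isp (sone, sone).
Proof. by split; [exact: sone_sm|exact: sone_sm|exact: smul1 sone_sm]. Qed.
Definition isD p q := inis (isD_subproof p q).
Definition isN p := inis (isN_subproof p).
Definition is0 := inis is0_subproof.
Lemma isDA : associative isD.
Proof. by move=> p q s; apply: val_inj; rewrite /= !smulA. Qed.
Lemma isDC : commutative isD.
Proof. by move=> p q; apply: val_inj; rewrite /= smulC [smul (val p).2 _]smulC. Qed.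
Lemma isD0 : left_id is0 isD.
Proof.
move=> p; have [p1 p2 _] := invsubP p.
by apply: val_inj; rewrite /= !smul1 //; case: (val p).
Qed.
Lemma isDN : left_inverse is0 isN isD.
Proof.
move=> p; have [_ _ p12] := invsubP p.
by apply: val_inj; rewrite /= [smul (val p).2 _]smulC p12.
Qed.
HB.instance Definition _ := GRing.isZmodule.Build invsub isDA isDC isD0 isDN.

Definition spow (P : T -> Prop) (k : nat) : T -> Prop := iter k (smul P) sone.

Definition isI (p : invsub) : T -> Prop := (val p).1.
Lemma isI_D p q : isI (p + q) = smul (isI p) (isI q). Proof. by []. Qed.
Lemma isI_Mn (p : invsub) k : isI (p *+ k) = spow (isI p) k.
Proof. by elim: k => // k IH; rewrite mulrS isI_D IH. Qed.

Lemma spow_le (P K : T -> Prop) k : is_sm K ->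
  (forall x : 'I_k -> T, (forall i, P (x i)) -> K (\prod_i x i)) ->
  forall z, spow P k z -> K z.
Proof.
elim: k K => [|k IH] K [K0 KB KZ] KP z.
  move=> [c ->]; rewrite -[eta c]mulr1; apply: KZ.
  by have := KP (fun=> 0); rewrite big_ord0; apply; case.
apply: smul_le => // x y Px; apply: (IH (fun y => K (x * y))).
  split; first by rewrite mulr0.
    by move=> u v; rewrite mulrBr; exact: KB.
  by move=> c u; rewrite mulrCA; exact: KZ.
move=> f fP; pose g (i : 'I_k.+1) := if unlift ord0 i is Some j then f j else x.
have <- : \prod_i g i = x * \prod_i f i.
  rewrite big_ord_recl /g unlift_none; congr (_ * _).
  by apply: eq_bigr => i _; rewrite liftK.
by apply: KP => i; rewrite /g; case: (unlift ord0 i).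
Qed.

Lemma spow_gen (P : T -> Prop) k (x : 'I_k -> T) :
  (forall i, P (x i)) -> spow P k (\prod_i x i).
Proof.
elim: k x => [|k IH] x xP; first by rewrite big_ord0; exists 1; rewrite rmorph1.
by rewrite big_ord_recl; apply: smul_gen => //; exact: IH.
Qed.

Section LHom.
Variables (n : nat) (r : 'I_n -> nat) (I J : 'I_n -> T -> Prop) (N : T -> Prop) (i0 : 'I_n).
Hypothesis Ism : forall i, is_sm (I i).
Hypothesis Jsm : forall i, is_sm (J i).
Hypothesis IJ : forall i x y, I i x -> J i y -> sone (x * y).
Hypothesis IJ1 : forall i, smul (I i) (J i) 1.
Hypothesis IN : forall i, spow (I i) (r i) = N.

Lemma IJp i : isp (I i, J i).
Proof.
split=> //=; apply: predeq.
  have [s0 sB _] := sone_sm; apply: smul_le => // x y; exact: IJ.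
move=> _ [c ->]; rewrite -[eta c]mulr1; have [_ _] := smul_sm (J i) (Ism i).
exact.
Qed.

(** Inverses are unique, so two elements of [invsub] with the same first component are equal. The
    equality of the powers [spow (I i) (r i)] thus becomes the relation of L in the group [invsub],
    and the universal property of L applies; [i0] serves to exhibit N itself as an invertible
    submodule. *)
Lemma invsub_hom : exists H : Lgrp r -> T -> Prop,
  [/\ (forall l, is_sm (H l)) /\ H 0 = sone,
      forall l m x y, H l x -> H m y -> H (l + m) (x * y),
      forall l, smul (H l) (H (- l)) 1,
      forall i, H (Lx r i) = I i & H (Lc r) = N].
Proof.
pose X i := inis (IJp i).
pose C := X i0 *+ r i0.
have XC i : X i *+ r i = C.
  have e p q : isI p = isI q -> p = q :> invsub.
    rewrite /isI => pq; apply/eqP; rewrite -subr_eq0; apply/eqP; apply: val_inj.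
    have [q1 q2 qq] := invsubP q; have [p1 p2 pp] := invsubP p.
    rewrite /= pq qq; congr (_, _).
    by rewrite -pq smulC.
  apply: e; rewrite /C !isI_Mn.
  exact: etrans (IN i) (esym (IN i0)).
pose h := lgrp_hom (U := invsub) (r := r) C X.
exists (fun l => isI (h l)); split.
- split=> [l|]; first by have [] := invsubP (h l).
  by rewrite /h lgrp_hom0.
- by move=> l m x y Hx Hy; rewrite /h lgrp_homD // isI_D; exact: smul_gen.
- move=> l; rewrite -isI_D -lgrp_homD // subrr.
  by rewrite lgrp_hom0 //; exists 1; rewrite rmorph1.
- by move=> i; rewrite /h lgrp_hom_x.
- by rewrite /h (lgrp_hom_c XC); exact: etrans (isI_Mn (X i0) (r i0)) (IN i0).
Qed.
End LHom.
End InvSub.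

(** * Homogeneous components as line bundles *)

Section HPart.
Variables (L : zmodType) (R A : comPzRingType) (eta : {rmorphism R -> A}).
Variables (gr : grading L eta).

Lemma hsub0 l : gr l (0 : restrict_scalars eta A^o) = 0. Proof. exact: gr_0. Qed.
Lemma hsub_lin l a (x y : restrict_scalars eta A^o) : gr l x = x -> gr l y = y ->
  gr l (a *: x + y) = a *: x + y.
Proof. by move=> xl yl; rewrite grD yl [gr l (a *: x)]gr_scale xl. Qed.
Definition hsub l : submod (restrict_scalars eta A^o) := Submod (hsub0 l) (@hsub_lin l).

Definition hpart (l : L) : lmodType R := subm (hsub l).
Definition hval (l : L) (x : hpart l) : A := val x.
Definition hin l (a : A) (al : gr l a = a) : hpart l := insm (al : hsub l a).
Definition hproj l (a : A) : hpart l := hin (gr_id gr l a).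

Lemma hvalP l (x : hpart l) : gr l (hval x) = hval x. Proof. exact: (submP x). Qed.
Lemma hval_inj l : injective (@hval l). Proof. exact: val_inj. Qed.
Lemma hval_lin l c (x y : hpart l) : hval (c *: x + y) = eta c * hval x + hval y. Proof. by []. Qed.
Lemma hvalZ l c (x : hpart l) : hval (c *: x) = eta c * hval x. Proof. by []. Qed.
Lemma hvalD l (x y : hpart l) : hval (x + y) = hval x + hval y. Proof. by []. Qed.
Lemma hvalB l (x y : hpart l) : hval (x - y) = hval x - hval y. Proof. by []. Qed.
Lemma hval0 l : hval (0 : hpart l) = 0. Proof. by []. Qed.
Lemma hval_sum l (I : Type) (s : seq I) (F : I -> hpart l) :
  hval (\sum_(i <- s) F i) = \sum_(i <- s) hval (F i).
Proof. exact: (big_morph _ (@hvalD l) (hval0 l)). Qed.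
Lemma hval_proj l a : hval (hproj l a) = gr l a. Proof. by []. Qed.
Lemma hval_in l a (al : gr l a = a) : hval (hin al) = a. Proof. by []. Qed.

Lemma prod_hom l n (F : 'I_n -> A) : (forall i, gr l (F i) = F i) ->
  gr (l *+ n) (\prod_i F i) = \prod_i F i.
Proof.
elim: n F => [|n IH] F Fl; first by rewrite big_ord0 mulr0n gr_one.
by rewrite big_ord_recl mulrS; apply: gr_homM => //; exact: IH.
Qed.

Lemma hmul_subproof l n l' (e : l *+ n = l') (x : 'I_n -> hpart l) :
  gr l' (\prod_i hval (x i)) = \prod_i hval (x i).
Proof. by rewrite -e; apply: prod_hom => i; exact: hvalP. Qed.
Definition hmul l n l' (e : l *+ n = l') (x : 'I_n -> hpart l) : hpart l' :=
  hin (hmul_subproof e x).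
Lemma hval_mul l n l' (e : l *+ n = l') x : hval (hmul e x) = \prod_i hval (x i).
Proof. by []. Qed.

Lemma hmul_multilinear l n l' (e : l *+ n = l') : multilinear (hmul e).
Proof.
move=> x i a u v; apply: hval_inj; rewrite hval_lin !hval_mul.
have E w : \prod_j hval ([eta x with i |-> w] j) = hval w * \prod_(j | j != i) hval (x j).
  rewrite (bigD1 i) //= eqxx; congr (_ * _).
  by apply: eq_bigr => j /negbTE ->.
by rewrite !E hval_lin mulrDl mulrA.
Qed.

Section HStrong.
Variable st : strong gr.

Lemma hres l (a : A) : gr l a = a ->
  a = \sum_(p <- res st l) eta (eps st (a * p.2)) * p.1.
Proof.
move=> al; rewrite -[LHS]mulr1 -(res_sum st l) mulr_sumr !big_seq.
by apply: eq_bigr => p pl; rewrite (eps_res al pl) mulrAC mulrA.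
Qed.

Lemma hpart_res l (x : hpart l) :
  x = \sum_(p <- res st l) eps st (hval x * p.2) *: hproj l p.1.
Proof.
apply: hval_inj; rewrite hval_sum [LHS](hres (hvalP x)) !big_seq; apply: eq_bigr => p pl.
by rewrite hvalZ hval_proj (res_fst pl).
Qed.

Definition hpair l (x : hpart l) (y : hpart (- l)) : R^o := eps st (hval x * hval y).

Lemma hpairE l (x : hpart l) (y : hpart (- l)) : eta (hpair x y) = hval x * hval y.
Proof. by apply: epsK; rewrite -(subrr l); apply: gr_homM; exact: hvalP. Qed.

Lemma hpair_dual l : dual_pair (@hpair l).
Proof.
split.
- split=> x a u v; apply: (eta_inj st); rewrite rmorphD rmorphM !hpairE hval_lin.
    by rewrite mulrDr mulrCA.
  by rewrite mulrDl mulrA.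
- exists [seq (hproj l p.1, hproj (- l) p.2) | p <- res st l].
  apply: (eta_inj st); rewrite big_map rmorph_sum rmorph1 -(res_sum st l) !big_seq.
  by apply: eq_bigr => p pl; rewrite hpairE /= !hval_proj (res_fst pl) (res_snd pl).
- move=> x y z; apply: hval_inj; rewrite !hvalZ !hpairE.
  by move: (hval x) (hval y) (hval z) => a b c; rewrite -mulrA mulrC [b * c]mulrC.
- by move=> x y z; apply: hval_inj; rewrite !hvalZ !hpairE mulrAC.
Qed.

Lemma hpart_invertible l : invertible (hpart l).
Proof. by exists (hpart (- l)), (@hpair l); exact: dual_pair_tensor (hpair_dual l). Qed.
End HStrong.
End HPart.

Lemma multilinear_scale (R : comPzRingType) (r : nat) (M N : lmodType R)
  (psi : ('I_r -> M) -> N) (c : 'I_r -> R) (x : 'I_r -> M) :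
  multilinear psi -> psi (fun i => c i *: x i) = (\prod_i c i) *: psi x.
Proof.
move=> ml.
have mlZ y i a u : psi [eta y with i |-> a *: u] = a *: psi [eta y with i |-> u].
  have ml0 : psi [eta y with i |-> 0] = 0.
    by have := ml y i (-1) 0 0; rewrite scaler0 addr0 scaleN1r addNr.
  by have := ml y i a u 0; rewrite ml0 !addr0.
pose X (s : seq 'I_r) i := if i \in s then c i *: x i else x i.
have H s : uniq s -> psi (X s) = (\prod_(i <- s) c i) *: psi x.
  elim: s => [_|i s IH /= /andP[is' us]]; first by rewrite big_nil scale1r.
  have -> : X (i :: s) = [eta X s with i |-> c i *: x i].
    by apply: funext => j; rewrite /X inE /=; case: eqP => [->|].
  rewrite mlZ big_cons -scalerA -IH //; congr (_ *: psi _); apply: funext => j /=.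
  by case: eqP => // ->; rewrite /X (negbTE is').
rewrite -H ?index_enum_uniq //; congr psi; apply: funext => i; rewrite /X.
by rewrite mem_index_enum.
Qed.

Section HPower.
Variables (L : zmodType) (R A : comPzRingType) (eta : {rmorphism R -> A}).
Variables (gr : grading L eta) (st : strong gr).

(** Multiplying out n copies of the sum of the a_j b_j, which is 1, gives a dual basis of A_(l')
    whose members are products of elements of A_l; this prescribes the induced map. It extends [psi]
    because the scalars x_i b_(J i) can be moved inside by multilinearity, where x_i and a_(J i) are
    exchanged. *)
Lemma hmul_tensor_power l n l' (e : l *+ n = l') : is_tensor_power (@hmul _ _ _ _ gr l n l' e).
Proof.
split; first exact: hmul_multilinear.
move=> P psi ml.
pose s := res st l; pose K := size s.
pose a (j : 'I_K) := (tnth (in_tuple s) j).1; pose b (j : 'I_K) := (tnth (in_tuple s) j).2.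
have al j : gr l (a j) = a j by apply: (res_fst (st := st)); exact: mem_tnth.
have bl j : gr (- l) (b j) = b j by apply: (res_snd (st := st)); exact: mem_tnth.
have ab1 : \sum_j a j * b j = 1 by rewrite -(res_sum st l) [RHS]big_tnth.
pose pa (J : {ffun 'I_n -> 'I_K}) (i : 'I_n) : hpart gr l := hin (al (J i)).
pose pb (J : {ffun 'I_n -> 'I_K}) := \prod_i b (J i).
have pbl J : gr (- l') (pb J) = pb J.
  by rewrite -e -mulNrn; apply: prod_hom.
have one : \sum_(J : {ffun 'I_n -> 'I_K}) (\prod_i a (J i)) * pb J = 1.
  transitivity (\prod_(i < n) \sum_j a j * b j); last by rewrite big1.
  rewrite bigA_distr_bigA /=; apply: eq_bigr => J _.
  by rewrite big_split.
pose h (y : hpart gr l') : P := \sum_J eps st (hval y * pb J) *: psi (pa J).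
have yE (y : hpart gr l') : y = \sum_J eps st (hval y * pb J) *: hmul e (pa J).
  apply: hval_inj; rewrite hval_sum -[LHS]mulr1 -one mulr_sumr; apply: eq_bigr => J _.
  rewrite hvalZ hval_mul epsK; last by rewrite -(subrr l'); apply: gr_homM => //; exact: hvalP.
  by rewrite mulrA mulrAC.
have hl : linear h.
  move=> c x y; rewrite /h scaler_sumr -big_split /=; apply: eq_bigr => J _.
  by rewrite hval_lin mulrDl -mulrA epsD epsZ scalerDl scalerA.
exists h; split; first split=> //.
  move=> x; rewrite /h -[RHS]scale1r -(eps1 st) -one eps_sum scaler_suml.
  apply: eq_bigr => J _.
  have -> : eps st (hval (hmul e x) * pb J) = \prod_i eps st (hval (x i) * b (J i)).
    apply: (eta_inj st); rewrite rmorph_prod epsK; last first.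
      by rewrite -(subrr l'); apply: gr_homM => //; exact: hvalP.
    rewrite hval_mul -big_split; apply: eq_bigr => i _ /=.
    by rewrite epsK // -(subrr l); apply: gr_homM => //; exact: hvalP.
  have -> : eps st ((\prod_i a (J i)) * pb J) = \prod_i eps st (a (J i) * b (J i)).
    apply: (eta_inj st); rewrite rmorph_prod epsK; last first.
      rewrite -(subrr l'); apply: gr_homM => //; rewrite -e.
      by apply: prod_hom.
    rewrite -big_split; apply: eq_bigr => i _ /=.
    by rewrite epsK // -(subrr l); apply: gr_homM.
  rewrite -!multilinear_scale //; congr psi; apply: funext => i; apply: hval_inj.
  rewrite !hvalZ !epsK ?hval_in; first by rewrite mulrAC [RHS]mulrAC [a _ * _]mulrC.
    by rewrite -(subrr l); apply: gr_homM.
  by rewrite -(subrr l); apply: gr_homM => //; exact: hvalP.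
move=> h' [h'l h'E]; apply: funext => y.
rewrite [in RHS](yE y) (linear_fun_sum h'l); apply: eq_bigr => J _.
by rewrite (linear_funZ h'l) h'E.
Qed.
End HPower.

Section GradedHom.
Variables (L : zmodType) (R A R' A' : comPzRingType).
Variables (eta : {rmorphism R -> A}) (eta' : {rmorphism R' -> A'}).
Variables (gr : grading L eta) (gr' : grading L eta') (st : strong gr) (st' : strong gr').
Variables (f : {rmorphism R -> R'}) (th : {rmorphism A -> A'}).
Hypothesis the : forall c, th (eta c) = eta' (f c).
Hypothesis thg : forall l a, th (gr l a) = gr' l (th a).

Lemma hmap_subproof l (x : hpart gr l) : gr' l (th (hval x)) = th (hval x).
Proof. by rewrite -thg hvalP. Qed.
Definition hmap l (x : hpart gr l) : hpart gr' l := hin (hmap_subproof x).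
Lemma hval_map l (x : hpart gr l) : hval (hmap x) = th (hval x). Proof. by []. Qed.

Lemma th_eps a : f (eps st a) = eps st' (th a).
Proof. by apply: (eta_inj st'); rewrite -the !epsE thg. Qed.

(** A ring homomorphism preserves expressions of 1, so [th] carries the dual basis of A_l to one of
    A'_l. The coordinates in it define the induced map and show its uniqueness. *)
Lemma hmap_bc l : is_base_change f (@hmap l).
Proof.
split=> [a x y|R'' g N h hl].
  by apply: hval_inj; rewrite hval_map !hval_lin rmorphD rmorphM the.
have hZ c x : h (c *: x) = g (f c) *: h x by exact: semilinearZ hl c x.
pose h' (y : hpart gr' l) : N :=
  \sum_(p <- res st l) g (eps st' (hval y * th p.2)) *: h (hproj gr l p.1).
have yE (y : hpart gr' l) :
    y = \sum_(p <- res st l) eps st' (hval y * th p.2) *: hmap (hproj gr l p.1).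
  apply: hval_inj; rewrite hval_sum -[LHS]mulr1 -(rmorph1 th) -(res_sum st l) rmorph_sum.
  rewrite mulr_sumr !big_seq; apply: eq_bigr => p pl.
  rewrite hvalZ hval_map hval_proj (res_fst pl) rmorphM epsK ?mulrA 1?mulrAC //.
  rewrite -(subrr l); apply: gr_homM; first exact: hvalP.
  by rewrite -thg (res_snd pl).
exists h'; split; first split=> [c x y|x].
- rewrite /h' scaler_sumr -big_split /=; apply: eq_bigr => p _.
  by rewrite hval_lin mulrDl -mulrA epsD epsZ rmorphD rmorphM scalerDl scalerA.
- rewrite /h' [in RHS](hpart_res st x) (semilinear_sum hl); apply: eq_bigr => p _.
  by rewrite hZ th_eps rmorphM.
move=> h'' [h''l h''E]; apply: funext => y.
rewrite [in RHS](yE y) (semilinear_sum h''l); apply: eq_bigr => p _.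
by rewrite (semilinearZ h''l) h''E.
Qed.
End GradedHom.

(** * Graded homomorphisms *)

Lemma additive_of (U V : zmodType) (g : U -> V) : zmod_morphism g ->
  exists g' : {additive U -> V}, g' =1 g.
Proof.
by move=> gB; exists (HB.pack g (GRing.isZmodMorphism.Build U V g gB) : {additive U -> V}).
Qed.

Lemma lfreeE (n : nat) (z : Lfree n) :
  z = Lfree_c n *~ z.1 + \sum_i Lfree_x i *~ z.2 i.
Proof.
case: z => a b /=.
have E (g : Lfree n -> int) : zmod_morphism g ->
    g (Lfree_c n *~ a + \sum_i Lfree_x i *~ b i)
    = g (Lfree_c n) *~ a + \sum_i g (Lfree_x i) *~ b i.
  move=> /additive_of[h hE]; rewrite -hE raddfD raddf_sum raddfMz hE; congr (_ + _).
  by apply: eq_bigr => i _; rewrite raddfMz hE.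
have E1 := E (fun z => z.1) (fun _ _ => erefl).
set w := _ + _ in E1 *; suff [e1 e2] : w.1 = a /\ w.2 = b by case: w e1 e2 {E1} => ? ? /= -> ->.
split; first by rewrite E1 /= big1 ?addr0 ?intz // => i _; rewrite mul0rz.
apply/ffunP => j; have -> := E (fun z => z.2 j) _; last by move=> x y; rewrite !ffunE.
rewrite /= ffunE mul0rz add0r (bigD1 j) //= ffunE eqxx intz big1 ?addr0 //.
by move=> i /negbTE ij; rewrite ffunE eq_sym ij mul0rz.
Qed.

Lemma lgrp_ind (n : nat) (r : 'I_n -> nat) (P : Lgrp r -> Prop) :
  P 0 -> (forall l m, P l -> P m -> P (l - m)) -> (forall i, P (Lx r i)) -> P (Lc r) ->
  forall l, P l.
Proof.
move=> P0 PB Px Pc l.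
have PN x : P x -> P (- x) by rewrite -sub0r; exact: PB.
have PD x y : P x -> P y -> P (x + y).
  by move=> hx hy; rewrite -[y]opprK; apply: PB => //; exact: PN.
have PMn x k : P x -> P (x *+ k).
  by move=> hx; elim: k => [|k IH]; rewrite ?mulr0n ?mulrS //; exact: PD.
have PMz x (k : int) : P x -> P (x *~ k).
  move=> hx; case: k => k; first exact: PMn.
  by rewrite NegzE mulrNz; apply: PN; exact: PMn.
have [z ->] := lgrp_surj l; rewrite (lfreeE z).
have [p pE] := additive_of (fun x y => raddfB (\pi_{ideal_quot (Lrel r)}) x y).
rewrite -pE raddfD raddf_sum raddfMz pE; apply: (PD); first exact: PMz.
by apply: (big_ind P) => [||i _]; [exact: P0|exact: PD|rewrite raddfMz pE; exact: PMz (Px i)].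
Qed.

Section GHomExt.
Variables (n : nat) (r : 'I_n -> nat) (R A A' : comPzRingType).
Variables (eta : {rmorphism R -> A}) (gr : grading (Lgrp r) eta) (st : strong gr).

(** The degrees in which [th] and [th'] agree form a subgroup: if b has degree l - m, insert 1, a
    sum of products q.1 q.2 with q.1 of degree m, and evaluate first q.1 and then b q.1, which has
    degree l. *)
Lemma ghom_ext (th th' : {rmorphism A -> A'}) :
  (forall c, th (eta c) = th' (eta c)) ->
  (forall i a, gr (Lx r i) a = a -> th a = th' a) ->
  (forall a, gr (Lc r) a = a -> th a = th' a) -> th =1 th'.
Proof.
move=> e0 ex ec a.
pose P l := forall b, gr l b = b -> th b = th' b.
suff Pl l : P l.
  have [s [_ ->]] := gcomp_sum gr a; rewrite !rmorph_sum; apply: eq_bigr => l _.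
  by apply: (Pl l); exact: gr_id.
have P0 b : gr 0 b = b -> th b = th' b by move=> b0; rewrite -(epsK st b0).
apply: (lgrp_ind (P := P)) => {l} [//|l m Pl Pm b bl|i b|b]; last 2 first.
- exact: ex.
- exact: ec.
rewrite -[LHS]mulr1 -(rmorph1 th') -(res_sum st m) rmorph_sum mulr_sumr.
rewrite -[b in RHS]mulr1 -(res_sum st m) mulr_sumr rmorph_sum !big_seq.
apply: eq_bigr => q qm; have [q1 q2] := (res_fst qm, res_snd qm).
have bq : gr l (b * q.1) = b * q.1 by rewrite -(subrK m l); exact: gr_homM.
rewrite (rmorphM th' q.1) -(Pm _ q1) mulrA -(rmorphM th) (Pl _ bq) -(rmorphM th').
by rewrite mulrA.
Qed.
End GHomExt.

Lemma pairM (A A' : comPzRingType) (a c : A) (b d : A') :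
  (a, b) * (c, d) = (a * c, b * d) :> A * A'.
Proof. by []. Qed.
Lemma pairD (A A' : comPzRingType) (a c : A) (b d : A') :
  (a, b) + (c, d) = (a + c, b + d) :> A * A'.
Proof. by []. Qed.
Lemma pairB (A A' : comPzRingType) (a c : A) (b d : A') :
  (a, b) - (c, d) = (a - c, b - d) :> A * A'.
Proof. by []. Qed.

Section GHomFull.
Variables (n : nat) (r : 'I_n -> nat) (i0 : 'I_n) (R A R' A' : comPzRingType).
Variables (eta : {rmorphism R -> A}) (eta' : {rmorphism R' -> A'}).
Variables (gr : grading (Lgrp r) eta) (gr' : grading (Lgrp r) eta').
Variables (st : strong gr) (st' : strong gr').
Variable f : {rmorphism R -> R'}.
Variables (t : forall i, hpart gr (Lx r i) -> hpart gr' (Lx r i)).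
Variables (tc : hpart gr (Lc r) -> hpart gr' (Lc r)).
Hypothesis tb : forall i, is_base_change f (@t i).
Hypothesis tcl : semilinear_along f tc.
Hypothesis tcm : forall i x, tc (hmul (LxE r i) x) = hmul (LxE r i) (@t i \o x).

Definition eta2 (c : R) : A * A' := (eta c, eta' (f c)).
Lemma eta2_B : zmod_morphism eta2.
Proof. by move=> x y; rewrite /eta2 !rmorphB. Qed.
Lemma eta2_M : monoid_morphism eta2.
Proof. by split=> [|x y]; rewrite /eta2 ?rmorph1 // !rmorphM. Qed.
HB.instance Definition _ := GRing.isZmodMorphism.Build R (A * A')%type eta2 eta2_B.
HB.instance Definition _ := GRing.isMonoidMorphism.Build R (A * A')%type eta2 eta2_M.

(* Pairs (I, J) of inverse submodules of A * A': I is the graph of t. *)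
Definition gI i (z : A * A') : Prop := exists x, z = (hval x, hval (@t i x)).
Definition gJ i (z : A * A') : Prop := gr (- Lx r i) z.1 = z.1 /\
  forall x : hpart gr (Lx r i), hval (t x) * z.2 = eta' (f (eps st (hval x * z.1))).
Definition gN (z : A * A') : Prop := exists x, z = (hval x, hval (tc x)).

Lemma graph_sm l (h : hpart gr l -> hpart gr' l) : semilinear_along f h ->
  is_sm eta2 (fun z => exists x, z = (hval x, hval (h x))).
Proof.
move=> hl; split.
- by exists 0; rewrite (semilinear0 hl) !hval0.
- by move=> _ _ [x ->] [y ->]; exists (x - y); rewrite (semilinearB hl) !hvalB pairB.
- by move=> c _ [x ->]; exists (c *: x); rewrite (semilinearZ hl) !hvalZ pairM.
Qed.

Lemma gI_sm i : is_sm eta2 (gI i).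
Proof. by apply: graph_sm; have [] := tb i. Qed.
Lemma gN_sm : is_sm eta2 gN. Proof. exact: graph_sm tcl. Qed.
Lemma gJ_sm i : is_sm eta2 (gJ i).
Proof.
split.
- by split=> [|x]; rewrite /= ?gr_0 // !mulr0 eps0 !rmorph0.
- move=> x y [x1 x2] [y1 y2]; split=> [|z] /=; first by rewrite grB x1 y1.
  by rewrite !mulrBr x2 y2 epsB !rmorphB.
- move=> c x [x1 x2]; split=> [|z] /=; first by rewrite gr_scale x1.
  by rewrite mulrCA x2 mulrCA epsZ !rmorphM.
Qed.

Lemma gIJ i x y : gI i x -> gJ i y -> sone eta2 (x * y).
Proof.
case: y => y y' [a ->] [/= y1 y2]; exists (eps st (hval a * y)).
have e : eta (eps st (hval a * y)) = hval a * y.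
  by apply: epsK; rewrite -(subrr (Lx r i)); apply: gr_homM => //; exact: hvalP.
by rewrite pairM y2 /eta2; congr (_, _); rewrite e.
Qed.

(* The second component is determined by duality, as t exhibits a base change. *)
Lemma gJ_ex i b : gr (- Lx r i) b = b -> exists b', gJ i (b, b').
Proof.
move=> bi; have [_ tu] := tb i.
have [|h [[hl hE] _]] := tu R' idfun R'^o (fun x : hpart gr (Lx r i) => f (eps st (hval x * b))).
  by move=> c x y /=; rewrite hval_lin mulrDl -mulrA epsD epsZ rmorphD rmorphM.
exists (\sum_(q <- res st' (Lx r i)) eta' (h (hproj gr' (Lx r i) q.1)) * q.2).
split=> // x; rewrite /= -hE [in RHS](hpart_res st' (t x)).
rewrite (semilinear_sum (f := idfun) hl) rmorph_sum.
rewrite mulr_sumr !big_seq; apply: eq_bigr => q qi.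
rewrite (semilinearZ (f := idfun) hl) [X in _ = eta' X]/(_ * _) rmorphM mulrCA.
by rewrite (eps_res (hvalP _) qi) mulrC.
Qed.

Lemma gIJ1 i : smul (gI i) (gJ i) 1.
Proof.
pose s := res st (Lx r i).
have bex p : exists b', p \in s -> gJ i (p.2, b').
  have [ps|ps] := boolP (p \in s); last by exists 0.
  by have [b' h] := gJ_ex (res_snd ps); exists b'.
have e1 : \sum_(p <- s) hval (hproj gr (Lx r i) p.1) * p.2 = 1.
  rewrite -(res_sum st (Lx r i)) !big_seq; apply: eq_bigr => p ps.
  by rewrite hval_proj (res_fst ps).
pose b p := sval (cid (bex p)).
have e2 : \sum_(p <- s) hval (t (hproj gr (Lx r i) p.1)) * b p = 1.
  rewrite -(rmorph1 eta') -(rmorph1 f) -(eps1 st) -e1 eps_sum !rmorph_sum.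
  rewrite !big_seq; apply: eq_bigr => p ps.
  by have [_ ->] := svalP (cid (bex p)) ps.
have -> : 1 = \sum_(p <- s) (hval (hproj gr (Lx r i) p.1), hval (t (hproj gr (Lx r i) p.1)))
    * (p.2, b p) :> A * A'.
  rewrite [RHS]surjective_pairing (raddf_sum fst) (raddf_sum snd) /=.
  by rewrite e1 e2.
apply: addspan_sum => p ps; apply: smul_gen; first by exists (hproj gr (Lx r i) p.1).
exact: svalP (cid (bex p)) ps.
Qed.

(** Compatibility of [t i] and [tc] with powers gives one inclusion; the other one holds because A_c
    is generated by products of r_i elements of degree x_i. *)
Lemma gIN i : spow eta2 (gI i) (r i) = gN.
Proof.
apply: predeq; first apply: spow_le; first exact: gN_sm.
  move=> x xI; pose y j := sval (cid (xI j)).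
  have yE j : x j = (hval (y j), hval (t (y j))) := svalP (cid (xI j)).
  exists (hmul (LxE r i) y); rewrite tcm !hval_mul [LHS]surjective_pairing.
  by rewrite (rmorph_prod fst) (rmorph_prod snd); congr (_, _);
    apply: eq_bigr => j _; rewrite yE.
move=> _ [x ->].
pose K x := spow eta2 (gI i) (r i) (hval x, hval (tc x)).
have spsm k : is_sm eta2 (spow eta2 (gI i) k).
  by case: k => [|k]; [exact: sone_sm|apply: smul_sm; exact: gI_sm].
have [s0 sB sZ] := spsm (r i).
have sD u v : spow eta2 (gI i) (r i) u -> spow eta2 (gI i) (r i) v ->
    spow eta2 (gI i) (r i) (u + v).
  by move=> hu hv'; rewrite -[v]opprK -[- v]sub0r; apply: (sB) => //; exact: sB.
have K0 : K 0 by rewrite /K (semilinear0 tcl).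
have KD a u v : K u -> K v -> K (a *: u + v).
  rewrite /K tcl !hval_lin => Ku Kv.
  have := sD _ _ (sZ a _ Ku) Kv; rewrite /eta2 pairM pairD.
  exact.
apply: (tensor_power_ind (K := Submod K0 KD) (hmul_tensor_power st (LxE r i))) => y /=.
rewrite /K tcm !hval_mul.
have -> : (\prod_i1 hval (y i1), \prod_i1 hval ((t (i:=i) \o y) i1))
    = \prod_j (hval (y j), hval (t (y j))) :> A * A'.
  by rewrite [RHS]surjective_pairing (rmorph_prod fst) (rmorph_prod snd).
by apply: spow_gen => j; exists (y j).
Qed.

(** The submodules H(l) of A * A' generated from the graphs have to be graphs themselves: H(l)
    consists of pairs of elements of degree l, is single-valued, and is defined on all of A_l. The
    homomorphism sends each component of an element to its partner, and H(l) H(m) inside H(l+m)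
    makes it multiplicative. *)
Lemma ghom_full : exists th : {rmorphism A -> A'},
  [/\ forall c, th (eta c) = eta' (f c), forall l a, th (gr l a) = gr' l (th a),
      forall i x, th (hval x) = hval (@t i x) & forall x, th (hval x) = hval (tc x)].
Proof.
have [H [[Hsm H0] HM H1 Hx Hc]] := invsub_hom i0 gI_sm gJ_sm gIJ gIJ1 gIN.
have HB l u v : H l u -> H l v -> H l (u - v) by have [_ + _] := Hsm l; exact.
have Hz l : H l 0 by have [] := Hsm l.
have HZ l c u : H l u -> H l (eta2 c * u) by have [_ _] := Hsm l; exact.
have HD l u v : H l u -> H l v -> H l (u + v).
  by move=> hu hw; rewrite -[v]opprK -[- v]sub0r; apply: (HB) => //; exact: HB.
have Hsum l (I : eqType) (s : seq I) (F : I -> A * A') :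
    (forall i, H l (F i)) -> H l (\sum_(i <- s) F i).
  by move=> h; apply: (big_ind (H l)) => //; exact: HD.
pose G l (z : A * A') := gr l z.1 = z.1 /\ gr' l z.2 = z.2.
have GB l x y : G l x -> G l y -> G l (x - y).
  by move=> [x1 x2] [y1 y2]; split; rewrite /= ?grB ?x1 ?y1 ?x2 ?y2.
have GM l m x y : G l x -> G m y -> G (l + m) (x * y).
  by move=> [x1 x2] [y1 y2]; split; apply: gr_homM.
have Gz l : G l 0 by split; exact: gr_0.
have G0 z : sone eta2 z -> G 0 z by move=> [c ->]; split; exact: gr_scal.
have HG : forall l z, H l z -> G l z.
  pose P l := forall z, H l z -> G l z.
  apply: (lgrp_ind (P := P)) => [z|l m Pl Pm z zH|i z|z]; first by rewrite H0; exact: G0.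
  (* An inverse of a homogeneous submodule is homogeneous: if u has degree m and u y has degree 0,
     then u kills the components of y of degree other than -m, and 1 is a combination of such u. *)
  - have PN y : H (- m) y -> G (- m) y.
      move=> yH.
      have gk k : k != - m -> gr k y.1 = 0 /\ gr' k y.2 = 0.
        move=> km; pose Q (w : A * A') := gr k y.1 * w.1 = 0 /\ gr' k y.2 * w.2 = 0.
        suff [] : Q 1 by rewrite !mulr1.
        apply: (smul_le _ _ _ (H1 m)) => [|u v [u1 u2] [v1 v2]|u v uH vH].
        - by rewrite /Q /= !mulr0.
        - by rewrite /Q /= !mulrBr u1 u2 v1 v2 !subrr.
        - have [u1 u2] := Pm _ uH.
          have [/= w1 w2] : G 0 (u * y) by apply: G0; rewrite -H0 -(subrr m); exact: HM.
          have km' : (k + m == 0) = false by rewrite addr_eq0; exact: negbTE.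
          split; rewrite /= mulrA.
            suff e : u.1 * gr k y.1 = 0 by rewrite [_ * u.1]mulrC e mul0r.
            by rewrite -u1 -(addrK m k) -gr_mul u1 -w1 gcompK km'.
          suff e : u.2 * gr' k y.2 = 0 by rewrite [_ * u.2]mulrC e mul0r.
          by rewrite -u2 -(addrK m k) -gr_mul u2 -w2 gcompK km'.
      split.
        apply: (gr_ext (gr := gr)) => k; rewrite gcompK; case: eqP => [->//|/eqP km].
        by have [-> _] := gk _ km.
      apply: (gr_ext (gr := gr')) => k; rewrite gcompK; case: eqP => [->//|/eqP km].
      by have [_ ->] := gk _ km.
    pose Q w := G (l - m) (z * w); suff : Q 1 by rewrite /Q mulr1.
    apply: (smul_le _ _ _ (H1 m)) => [|u v uG vG|u v uH vH]; rewrite /Q.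
    - by rewrite mulr0.
    - by rewrite mulrBr; exact: GB.
    - rewrite mulrA; apply: GM; last exact: PN.
      by apply: Pl; rewrite -(subrK m l); exact: HM.
  - by rewrite Hx => -[x ->]; split; exact: hvalP.
  - by rewrite Hc => -[x ->]; split; exact: hvalP.
(* For v in H(-l) the product (0, a') v lies in H(0), so it comes from a scalar c with eta c = 0,
   that is c = 0. Multiplying a' by a sum of products u v equal to 1 then gives 0. *)
have uniq0 l a' : H l (0, a') -> a' = 0.
  move=> h; pose Q (w : A * A') := a' * w.2 = 0.
  suff : Q 1 by rewrite /Q mulr1.
  apply: (smul_le _ _ _ (H1 l)) => [|u v u1 v1|u v uH vH]; rewrite /Q /=.
  - by rewrite mulr0.
  - by rewrite mulrBr u1 v1 subrr.
  - have : H 0 ((0, a') * v) by rewrite -(subrr l); exact: HM.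
    rewrite H0; case: v {vH} => v v' /= [c]; rewrite pairM mul0r => -[c0 ce].
    rewrite mulrCA ce -(_ : 0 = c) ?rmorph0 ?mulr0 //.
    by apply: (eta_inj st); rewrite rmorph0.
have uniq l a a1 a2 : H l (a, a1) -> H l (a, a2) -> a1 = a2.
  move=> h1 h2; apply/eqP; rewrite -subr_eq0; apply/eqP; apply: (uniq0 l).
  by have := HB _ _ _ h1 h2; rewrite pairB subrr.
(* In the product of [gr l a] with a sum of u v equal to 1, each [gr l a * v.1] has degree 0 and is
   a scalar c of R; then c u lies in H(l), which supplies the second component. *)
have ex l a : exists a', H l (gr l a, a').
  pose Q (w : A * A') := exists a', H l (gr l a * w.1, a').
  suff : Q 1 by rewrite /Q mulr1.
  apply: (smul_le _ _ _ (H1 l)) => [|u v [u1 hu] [v1 hw]|u v uH vH]; rewrite /Q /=.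
  - by exists 0; rewrite mulr0.
  - by exists (u1 - v1); rewrite mulrBr -pairB; exact: HB.
  - have [v1 _] := HG _ _ vH.
    have e : eta (eps st (gr l a * v.1)) = gr l a * v.1.
      by rewrite epsK // -(subrr l); apply: gr_homM => //; exact: gr_id.
    have := HZ _ (eps st (gr l a * v.1)) _ uH; case: u {uH} => u u'.
    rewrite /eta2 pairM e /= => h; exists (eta' (f (eps st (gr l a * v.1))) * u').
    by rewrite [u * _]mulrC mulrA.
pose th l a := sval (cid (ex l a)).
have thH l a : H l (gr l a, th l a) := svalP (cid (ex l a)).
have thl l a : gr' l (th l a) = th l a by have [] := HG _ _ (thH l a).
have th0 l a : gr l a = 0 -> th l a = 0.
  by move=> a0; apply: (uniq0 l); rewrite -a0; exact: thH.
(* The partners [th l a] vanish outside the finitely many degrees of a, so they are the components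
   of a single element of A'. *)
have tex a : exists a', forall l, gr' l a' = th l a.
  have [s [us aE]] := gcomp_sum gr a; exists (\sum_(l <- s) th l a) => l.
  rewrite gr_sum.
  under eq_bigr do rewrite -thl gcompK thl.
  have [ls|ls] := boolP (l \in s).
    by rewrite (bigD1_seq l) //= eqxx big1 ?addr0 // => k; rewrite eq_sym => /negbTE ->.
  rewrite big_seq big1 => [|k ks]; last by case: eqP => // e; rewrite e ks in ls.
  rewrite th0 // aE gr_sum big_seq big1 // => k ks.
  by rewrite gcompK; case: eqP => // e; rewrite e ks in ls.
pose T a := sval (cid (tex a)).
have TE l a : gr' l (T a) = th l a := svalP (cid (tex a)) l.
have Thom l a a' : gr l a = a -> H l (a, a') -> T a = a'.
  move=> al aH; have [_ /= a'l] := HG _ _ aH.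
  apply: (gr_ext (gr := gr')) => k; rewrite TE -a'l gcompK; case: eqP => [->|/eqP kl].
    by rewrite a'l; apply: (uniq l) aH; rewrite -{1}al; exact: thH.
  by apply: th0; rewrite -al gcompK (negbTE kl).
have TB : {morph T : x y / x - y}.
  move=> x y; apply: (gr_ext (gr := gr')) => l; rewrite grB !TE.
  apply: (uniq l (gr l (x - y))); first exact: thH.
  by rewrite grB -pairB; exact: HB.
have Teta c : T (eta c) = eta' (f c).
  by apply: (Thom 0); [exact: gr_scal|rewrite H0; exists c].
have T1 : T 1 = 1 by rewrite -(rmorph1 eta) Teta !rmorph1.
have TM : {morph T : x y / x * y}.
  move=> x y; apply: (gr_ext (gr := gr')) => l; rewrite TE.
  have [s [us xE]] := gcomp_sum gr x.
  have TxE : T x = \sum_(k <- s) th k x.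
    apply: (gr_ext (gr := gr')) => k; rewrite TE gr_sum.
    under eq_bigr do rewrite -thl gcompK thl.
    have [ks|ks] := boolP (k \in s).
      by rewrite (bigD1_seq k) //= eqxx big1 ?addr0 // => i; rewrite eq_sym => /negbTE ->.
    rewrite big_seq big1 => [|i si]; last by case: eqP => // e; rewrite e si in ks.
    rewrite th0 // xE gr_sum big_seq big1 // => i si.
    by rewrite gcompK; case: eqP => // e; rewrite e si in ks.
  rewrite TxE mulr_suml gr_sum; apply: (uniq l (gr l (x * y))); first exact: thH.
  rewrite {1}xE mulr_suml gr_sum.
  have -> : (\sum_(k <- s) gr l (gr k x * y), \sum_(k <- s) gr' l (th k x * T y))
      = \sum_(k <- s) (gr k x, th k x) * (gr (l - k) y, th (l - k) y).
    rewrite [RHS]surjective_pairing (raddf_sum fst) (raddf_sum snd) /=.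
    by congr (_, _); apply: eq_bigr => k _; rewrite -1?[th k x]thl gr_mul ?TE.
  by apply: Hsum => k; rewrite -{1}(subrKC k l); apply: HM.
have [T' T'E] := rmorph_of TB T1 TM; exists T'; split=> [c|l a|i x|x]; rewrite !T'E.
- exact: Teta.
- apply: (gr_ext (gr := gr')) => k; rewrite gcompK !TE.
  case: eqP => [->|/eqP kl]; last by rewrite th0 // gcompK (negbTE kl).
  by apply: (uniq l (gr l a)) (thH l a); have := thH l (gr l a); rewrite gr_id.
- by apply: (Thom (Lx r i)); [exact: hvalP|rewrite Hx; exists x].
- by apply: (Thom (Lc r)); [exact: hvalP|rewrite Hc; exists x].
Qed.
End GHomFull.

(** * From torsors to roots of line bundles *)

Section SRing.
Variables (k : closedFieldType) (m : nat) (r : 'I_m.+3 -> nat).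
Variables (hr : forall i, (1 < r i)%N) (lam : 'I_m.+3 -> p1pt k).
Local Notation S := (Salg hr lam).

Lemma Srel0 (i : 'I_m.+3) : (1 < i)%N -> Spi hr lam (Srel r lam i) = 0.
Proof.
move=> i1; rewrite -(rmorph0 (Spi hr lam)); apply/eqP.
rewrite -Quotient.idealrBE subr0; apply/asboolP.
exists (fun j => (j == i)%:R); rewrite (bigD1 i) //= eqxx mul1r big1 ?addr0 //.
by move=> j /andP[_ /negbTE ->]; rewrite mul0r.
Qed.

Lemma Sx_rel (i : 'I_m.+3) : (1 < i)%N ->
  (Sx hr lam i : S) ^+ r i = Sx hr lam (ord2nd m) ^+ r (ord2nd m)
    - kstr S (p1coord (lam i)) * Sx hr lam (ord1st m) ^+ r (ord1st m).
Proof.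
move=> /Srel0; rewrite /Srel -mpoly.mul_mpolyC rmorphD rmorphB rmorphM !rmorphXn.
by move=> /eqP; rewrite -addrA addr_eq0 opprD opprK addrC => /eqP.
Qed.

Lemma Sx_deg i : Sgrading hr lam (Lx r i) (Sx hr lam i) = Sx hr lam i.
Proof.
rewrite [LHS]Scomp_pi; congr (Spi hr lam _).
have {1}-> : Lx r i = Defs.mweight (Lx r) (mpoly.mnm1 i).
  rewrite /Defs.mweight (bigD1 i) //= mpoly.mnm1E eqxx mulr1n big1 ?addr0 // => j.
  by rewrite mpoly.mnm1E eq_sym => /negbTE ->.
exact: mpoly_compX.
Qed.

Lemma Smor_ext (B : comPzRingType) (f g : {rmorphism S -> B}) :
  (forall c, f (kstr S c) = g (kstr S c)) ->
  (forall i, f (Sx hr lam i) = g (Sx hr lam i)) -> f =1 g.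
Proof.
move=> ec ex a; have [p ->] := Spi_surj a.
rewrite [p]mpoly.mpolyE !rmorph_sum; apply: eq_bigr => e _.
rewrite -mpoly.mul_mpolyC !rmorphM; congr (_ * _); first exact: ec.
rewrite mpoly.mpolyXE_id !rmorph_prod; apply: eq_bigr => i _.
by rewrite !rmorphXn; congr (_ ^+ _); exact: ex.
Qed.
End SRing.
Section ToRoots.
Variables (k : closedFieldType) (m : nat) (r : 'I_m.+3 -> nat).
Variables (hr : forall i, (1 < r i)%N) (lam : 'I_m.+3 -> p1pt k).
Hypothesis lam_1 : lam (ord1st m) = pinf.
Hypothesis lam_2 : lam (ord2nd m) = pfin 0.
Hypothesis lam_i : forall i : 'I_m.+3, (1 < i)%N -> lam i = pfin (p1coord (lam i)).
Local Notation S := (Salg hr lam).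
Local Notation i1 := (ord1st m).
Local Notation i2 := (ord2nd m).
Local Notation X := (weighted_stack hr lam).
Local Notation Y := (fibprod (fun i : 'I_m.+3 => root_to_P1 (r i) (lam i))).

Section OnObjects.
Variables (R : kalg k) (x : quot_ob (Sgrading hr lam) (Sx hr lam) R).
Local Notation T := (qt_tor x).
Local Notation st := (torsor_strong T).

Definition qs (i : 'I_m.+3) : T := qt_map x (Sx hr lam i).
Lemma qs_deg i : tgr T (Lx r i) (qs i) = qs i.
Proof. by rewrite -qt_equiv Sx_deg. Qed.
Definition qsec i : hpart (tgr T) (Lx r i) := hin (qs_deg i).
Definition qpow i := hmul (gr := tgr T) (LxE r i).
Definition qu : hpart (tgr T) (Lc r) := qpow (fun=> qsec i2).
Definition qv : hpart (tgr T) (Lc r) := qpow (fun=> qsec i1).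

Lemma hval_qpow i : hval (qpow (fun=> qsec i)) = qs i ^+ r i.
Proof. by rewrite hval_mul prodr_const card_ord hval_in. Qed.

Lemma qs_rel (i : 'I_m.+3) : (1 < i)%N ->
  qs i ^+ r i = hval qu - tstr T (kstr R (p1coord (lam i))) * hval qv.
Proof.
move=> h; rewrite !hval_qpow /qs -rmorphXn (Sx_rel hr lam h).
by rewrite rmorphB rmorphM !rmorphXn qt_k.
Qed.

(** The powers x_i^(r_i) all lie in the ideal (u, v): two of them are v and u, and the relations of
    S express the others. Since the x_i generate the unit ideal, [comax_pow] applied to the class of
    1 modulo (u, v) concludes. *)
Lemma quv_unit : exists a b : T, a * hval qu + b * hval qv = 1.
Proof.
have I0 : exists a b : T, (0 : T^o) = a * hval qu + b * hval qv.
  by exists 0, 0; rewrite !mul0r addr0.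
have ID c (y z : T^o) : (exists a b : T, y = a * hval qu + b * hval qv) ->
    (exists a b : T, z = a * hval qu + b * hval qv) ->
    exists a b : T, c *: y + z = a * hval qu + b * hval qv.
  move=> [a [b ->]] [a' [b' ->]]; exists (c * a + a'), (c * b + b').
  by rewrite [c *: _]mulrDr !mulrA addrACA -!mulrDl.
pose U := Submod I0 ID.
suff : qpi U 1 = 0 by move/qpi_eq0 => [a [b ->]]; exists a, b.
have [c c1] := qt_avoid x.
have qZ a v : a *: qpi U v = qpi U (a *: v) by exact: qscaleE.
have in1 (i : 'I_m.+3) : exists a b : T, qs i ^+ r i = a * hval qu + b * hval qv.
  have [h|h] := ltnP 1 i.
    exists 1, (- tstr T (kstr R (p1coord (lam i)))).
    by rewrite qs_rel // mul1r mulNr.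
  have [i0|i0] := posnP i.
    have -> : i = i1 by exact: val_inj.
    by exists 0, 1; rewrite mul0r mul1r add0r hval_qpow.
  have -> : i = i2 by apply: val_inj; apply/eqP; rewrite /= eqn_leq h i0.
  by exists 1, 0; rewrite mul0r mul1r addr0 hval_qpow.
apply: (comax_pow c1) => i _; exists (r i); rewrite qZ; apply/qpi_eq0.
have [a [b ab]] := in1 i; exists (c i ^+ r i * a), (c i ^+ r i * b).
by rewrite [_ *: _]mulr1 exprMn ab mulrDr !mulrA.
Qed.

(** Multiply y by a u + b v = 1 and keep the component of degree c: this replaces the coefficients y
    a and y b by their degree-0 parts, which are scalars of R. *)
Lemma quv_gen (y : hpart (tgr T) (Lc r)) : exists a b : R, y = a *: qu + b *: qv.
Proof.
have [a [b e]] := quv_unit.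
exists (eps st (hval y * a)), (eps st (hval y * b)).
apply: hval_inj; rewrite hvalD !hvalZ !epsE -{1}(hvalP y) -[X in tgr _ _ X]mulr1 -e mulrDr grD.
have E (w z : T) : tgr T (Lc r) w = w -> tgr T (Lc r) (z * w) = tgr T 0 z * w.
  by move=> wc; rewrite -{1}wc mulrC gr_mul subrr wc mulrC.
by rewrite !mulrA !E //; exact: hvalP.
Qed.

Definition qp1 : p1ob R := P1ob (hpart_invertible (gr := tgr T) st (Lc r)) quv_gen.

Lemma hval_form_fin a :
  hval (p1form (pfin a) qp1 : hpart (tgr T) (Lc r)) = hval qu - tstr T (kstr R a) * hval qv.
Proof. by rewrite -hvalZ -hvalB. Qed.

Lemma qpow_sec i : qpow (fun=> qsec i) = p1form (lam i) qp1 :> hpart (tgr T) (Lc r).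
Proof.
apply: hval_inj; rewrite hval_qpow.
have [h|h] := ltnP 1 i; first by rewrite (qs_rel h) -hval_form_fin -lam_i.
have [i0|i0] := posnP i.
  have -> : i = i1 by exact: val_inj.
  by rewrite lam_1 -hval_qpow.
have -> : i = i2 by apply: val_inj; apply/eqP; rewrite /= eqn_leq h i0.
by rewrite lam_2 hval_form_fin !rmorph0 mul0r subr0 hval_qpow.
Qed.

Definition qroot (i : 'I_m.+3) : root_ob (r i) (lam i) R :=
  @RootOb k (r i) (lam i) R qp1 (hpart (tgr T) (Lx r i))
    (hpart_invertible (gr := tgr T) st (Lx r i)) (qsec i) (qpow (i := i))
    (hmul_tensor_power st (LxE r i)) (qpow_sec i).

Definition id_iso (Z : fibcat k) (z : Z R) : fiso z z :=
  Fiso (fover_id z) (fover_id z) (fcomp1l (fid z)) (fcomp1l (fid z)).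

Definition torsor_roots_ob : Y R :=
  @FprodOb k (P1 k) 'I_m.+3 (fun i => root_stack (r i) (lam i))
    (fun i : 'I_m.+3 => root_to_P1 (r i) (lam i)) R qp1 qroot
    (fun i => id_iso (Z := P1 k) qp1).
End OnObjects.

Section OnHoms.
Variables (R R' : kalg k).
Variables (x : quot_ob (Sgrading hr lam) (Sx hr lam) R).
Variables (y : quot_ob (Sgrading hr lam) (Sx hr lam) R').
Variable g : quot_hom x y.
Local Notation hm := (hmap (qth_equiv g)).

Lemma hm_sec i : hm (qsec x i) = qsec y i.
Proof. by apply: hval_inj; rewrite hval_map !hval_in /qs qth_map. Qed.
Lemma hm_pow i w : hm (qpow (x := x) (i := i) w) = qpow (x := y) (hm (l := Lx r i) \o w).
Proof. by apply: hval_inj; rewrite hval_map !hval_mul rmorph_prod. Qed.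
Lemma hm_bc l : is_base_change (qth_over g) (@hmap _ _ _ _ _ _ _ _ _ _ (qth_equiv g) l).
Proof.
exact: (hmap_bc (torsor_strong (qt_tor x)) (torsor_strong (qt_tor y)) (qth_str g)).
Qed.
Lemma hm_u : hm (qu x) = qu y.
Proof. by rewrite hm_pow; congr qpow; apply: funext => i /=; exact: hm_sec. Qed.
Lemma hm_v : hm (qv x) = qv y.
Proof. by rewrite hm_pow; congr qpow; apply: funext => i /=; exact: hm_sec. Qed.

Definition qp1_hom : p1hom (qp1 x) (qp1 y) :=
  @P1hom k R R' (qp1 x) (qp1 y) (qth_over g) (hm (l := Lc r)) (hm_bc (Lc r)) hm_u hm_v.

Definition qroot_hom (i : 'I_m.+3) : root_hom (qroot x i) (qroot y i) :=
  @RootHom k (r i) (lam i) R R' (qroot x i) (qroot y i) qp1_hom (hm (l := Lx r i))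
    (hm_bc (Lx r i)) (hm_sec i) (@hm_pow i).

Definition torsor_roots_hom : fhom (torsor_roots_ob x) (torsor_roots_ob y).
Proof.
refine (@FprodHom k (P1 k) 'I_m.+3 (fun i => root_stack (r i) (lam i))
    (fun i : 'I_m.+3 => root_to_P1 (r i) (lam i)) R R'
    (torsor_roots_ob x) (torsor_roots_ob y) qp1_hom qroot_hom
    (fun _ => erefl) _) => i.
exact: etrans (@fcomp1r k (P1 k) _ _ _ _ _) (esym (@fcomp1l k (P1 k) _ _ _ _ _)).
Defined.
End OnHoms.

Definition torsor_roots : ffunctor X Y.
Proof.
refine (@Ffunctor k X Y torsor_roots_ob torsor_roots_hom (fun _ _ _ _ _ => erefl) _ _).
- move=> R x; apply: fibprod_hom_eq => [|i].
    by apply: p1hom_eq => // w; apply: hval_inj.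
  apply: root_hom_eq => [|w]; last exact: hval_inj.
  by apply: p1hom_eq => // w; apply: hval_inj.
- move=> R R' R'' x y z f g; apply: fibprod_hom_eq => [|i].
    by apply: p1hom_eq => // w; apply: hval_inj.
  apply: root_hom_eq => [|w]; last exact: hval_inj.
  by apply: p1hom_eq => // w; apply: hval_inj.
Defined.

Lemma torsor_roots_faithful (R R' : kalg k) (x : X R) (y : X R') (g g' : fhom x y) :
  fnhom torsor_roots g = fnhom torsor_roots g' -> g = g'.
Proof.
move=> e; have eb : qp1_hom g = qp1_hom g' := congr1 (fun h => fph_base h) e.
have eo : qth_over g = qth_over g' := congr1 (fun h => p1h_over h) eb.
apply: quot_hom_eq => //; apply: (ghom_ext (torsor_strong (qt_tor x))).
- by move=> c; rewrite !qth_str eo.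
- move=> i a al.
  have ei : qroot_hom g i = qroot_hom g' i := congr1 (fun h => fph_comp h i) e.
  exact: (congr1 (fun h : root_hom (qroot x i) (qroot y i) =>
    hval (rth_fun h (hin al) : hpart (tgr (qt_tor y)) (Lx r i))) ei).
- move=> a al.
  exact: (congr1 (fun h : p1hom (qp1 x) (qp1 y) =>
    hval (p1h_fun h (hin al) : hpart (tgr (qt_tor y)) (Lc r))) eb).
Qed.

Lemma torsor_roots_full (R R' : kalg k) (x : X R) (y : X R')
  (h : fhom (torsor_roots R x) (torsor_roots R' y)) :
  exists g, fnhom torsor_roots g = h.
Proof.
pose b : p1hom (qp1 x) (qp1 y) := fph_base h.
pose c i : root_hom (qroot x i) (qroot y i) := fph_comp h i.
(* On objects in the image of the functor, the isomorphisms with the base point are identities, so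
   the compatibility squares say that all the roots lie over one and the same arrow of P^1. *)
have e i : b = rth_p1 (c i).
  have h1 := fph_iso h i.
  have h2 := @fcomp1r k (P1 k) _ _ _ _ b.
  have h3 := @fcomp1l k (P1 k) _ _ _ _ (rth_p1 (c i)).
  exact: etrans (esym h2) (etrans h1 h3).
pose f := p1h_over b.
pose t i : hpart (tgr (qt_tor x)) (Lx r i) -> hpart (tgr (qt_tor y)) (Lx r i) := rth_fun (c i).
pose tc : hpart (tgr (qt_tor x)) (Lc r) -> hpart (tgr (qt_tor y)) (Lc r) := p1h_fun b.
have tb i : is_base_change f (@t i) by rewrite /f (e i); exact: rth_bc (c i).
have tcl : semilinear_along f tc := (p1h_bc b).1.
have tcm i w : tc (hmul (LxE r i) w) = hmul (LxE r i) (@t i \o w).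
  by rewrite /tc (e i); exact: rth_pow (c i) w.
have [th [th1 th2 th3 th4]] := ghom_full i1 (torsor_strong (qt_tor x))
  (torsor_strong (qt_tor y)) tb tcl tcm.
have th5 a : th (qt_map x a) = qt_map y a.
  rewrite -[LHS]/((th \o qt_map x) a); apply: Smor_ext => [d|i] /=.
    by rewrite qt_k th1 kfunE -qt_k.
  rewrite -[qt_map x _]/(hval (qsec x i)) th3.
  have -> : t i (qsec x i) = qsec y i by exact: rth_sec (c i).
  by [].
pose g : quot_hom x y := QuotHom th1 th2 th5.
exists g; apply: fibprod_hom_eq => [|i].
  by apply: p1hom_eq => // w; apply: hval_inj; exact: th4.
apply: root_hom_eq => [|w]; last by apply: hval_inj; exact: th3.
rewrite -[rth_p1 (fph_comp h i)]/(rth_p1 (c i)) -e.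
by apply: p1hom_eq => // w; apply: hval_inj; exact: th4.
Qed.
End ToRoots.

(** * Trivialization of line bundles *)

(** This computes the kernel of Q -> Q[X]/(fX - 1) = Q[1/f]. Comparing coefficients, q_(i+1) = f q_i
    and c = - q_0, so the coefficients of -q are the f^i c and must vanish from some point on. *)
Lemma invert_poly_ker (Q : comNzRingType) (f c : Q) (q : {poly Q}) :
  c%:P = q * (f%:P * 'X - 1) -> exists n, f ^+ n * c = 0.
Proof.
move=> e.
have e0 : c = - q`_0.
  by have := congr1 (fun p : {poly Q} => p`_0) e;
    rewrite /= coefC /= mulrBr mulr1 mulrA coefB coefMX /= sub0r.
have eS i : q`_i.+1 = f * q`_i.
  have := congr1 (fun p : {poly Q} => p`_i.+1) e.
  rewrite /= coefC /= mulrBr mulr1 mulrA coefB coefMX coefMC /= => /eqP.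
  by rewrite eq_sym subr_eq0 mulrC => /eqP.
have qE i : q`_i = f ^+ i * q`_0.
  by elim: i => [|i IH]; rewrite ?expr0 ?mul1r // eS IH exprS mulrA.
by exists (size q); rewrite e0 mulrN -qE nth_default ?oppr0.
Qed.

Lemma localization_nz (Q : comNzRingType) (f : Q) : (forall n, f ^+ n <> 0) ->
  exists (Q' : comPzRingType) (i : {rmorphism Q -> Q'}) (g : Q'),
    i f * g = 1 /\ forall a, i a = 0 -> exists n, f ^+ n * a = 0.
Proof.
move=> fn.
pose I : {pred {poly Q}} := fun p => `[< exists q, p = q * (f%:P * 'X - 1) >].
have Ic : idealr_closed I.
  split.
  - by apply/asboolP; exists 0; rewrite mul0r.
  - apply/asboolP => -[q /invert_poly_ker[n]]; rewrite mulr1; exact: fn.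
  - move=> a u v /asboolP[p ->] /asboolP[q ->]; apply/asboolP.
    by exists (a * p + q); rewrite mulrDl mulrA.
pose Ii : idealr {poly Q} := HB.pack I (isIdealr.Build {poly Q} I Ic).
pose pi : {rmorphism {poly Q} -> {ideal_quot Ii}} := \pi_{ideal_quot Ii}.
have pi0 p : pi p = 0 <-> exists q, p = q * (f%:P * 'X - 1).
  rewrite -(rmorph0 pi); split.
    by move/eqP; rewrite -Quotient.idealrBE subr0 => /asboolP.
  by move=> h; apply/eqP; rewrite -Quotient.idealrBE subr0; apply/asboolP.
exists {ideal_quot Ii}, (pi \o polyC : {rmorphism Q -> _}), (pi 'X); split.
  rewrite /= -rmorphM; apply/eqP; rewrite -subr_eq0 -(rmorph1 pi) -rmorphB.
  by apply/eqP/pi0; exists 1; rewrite mul1r.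
by move=> a /= /pi0[q /invert_poly_ker].
Qed.

Lemma localization (Q : comPzRingType) (f : Q) : (forall n, f ^+ n <> 0) ->
  exists (Q' : comPzRingType) (i : {rmorphism Q -> Q'}) (g : Q'),
    i f * g = 1 /\ forall a, i a = 0 -> exists n, f ^+ n * a = 0.
Proof.
move=> fn; have nz : (1 : Q) != 0 by apply/eqP; rewrite -(expr0 f); exact: fn.
pose Qn : comNzRingType :=
  HB.pack (GRing.ComPzRing.sort Q) (GRing.PzSemiRing_isNonZero.Build Q nz).
exact: (@localization_nz Qn f fn).
Qed.

Lemma adjoin_root_nz (Q : comNzRingType) (w : Q) (n : nat) : (0 < n)%N ->
  exists (Q' : comPzRingType) (i : {rmorphism Q -> Q'}) (t : Q'),
    (forall a, i a = 0 -> a = 0) /\ t ^+ n = i w.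
Proof.
move=> n0; pose h : {poly Q} := 'X^n - w%:P.
have hm : h \is monic by exact: monicXnsubC.
have sh : size h = n.+1 by exact: size_XnsubC.
(* The quotient [{poly %/ h}] is taken modulo [mk_monic h], which agrees with h because h is monic
   of positive degree. *)
have hE : mk_monic h = h by rewrite /mk_monic sh hm ltnS n0.
have sC a : in_qpoly h a%:P = a%:P :> {poly Q}.
  by rewrite in_qpoly_small // hE sh size_polyC ltnS; case: eqP.
pose i (a : Q) := in_qpoly h a%:P.
have iB : {morph i : x y / x - y} by move=> x y; rewrite /i rmorphB /= raddfB.
have i1 : i 1 = 1 by rewrite /i in_qpoly1.
have iM : {morph i : x y / x * y} by move=> x y; rewrite /i rmorphM /= in_qpolyM.
have [j jE] := rmorph_of iB i1 iM.
exists {poly %/ h}, j, (in_qpoly h 'X); split=> [a|].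
  by rewrite jE => /(congr1 (fun p : {poly %/ h} => (p : {poly Q}))); rewrite sC => /eqP;
    rewrite polyC_eq0 => /eqP.
have pX k : in_qpoly h 'X ^+ k = in_qpoly h 'X^k.
  by elim: k => [|k IH]; rewrite ?expr0 ?in_qpoly1 // !exprS IH in_qpolyM.
rewrite jE /i pX -[X in in_qpoly h X](subrK w%:P) -/h in_qpolyD.
suff -> : in_qpoly h h = 0 by rewrite add0r.
by apply: val_inj; rewrite /= hE Pdiv.RingMonic.rmodpp.
Qed.

Lemma adjoin_root (Q : comPzRingType) (w : Q) (n : nat) : (0 < n)%N ->
  exists (Q' : comPzRingType) (i : {rmorphism Q -> Q'}) (t : Q'),
    (forall a, i a = 0 -> a = 0) /\ t ^+ n = i w.
Proof.
move=> n0; have [Q0|nz] := eqVneq (1 : Q) 0.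
  exists Q, idfun, 0; split=> //.
  by rewrite -[LHS]mulr1 -[RHS]mulr1 Q0 !mulr0.
pose Qn : comNzRingType :=
  HB.pack (GRing.ComPzRing.sort Q) (GRing.PzSemiRing_isNonZero.Build Q nz).
exact: (@adjoin_root_nz Qn w n n0).
Qed.

Lemma adjoin_roots (Q : comPzRingType) (s : seq (Q * nat)) :
  (forall p, p \in s -> (0 < p.2)%N) ->
  exists (Q' : comPzRingType) (i : {rmorphism Q -> Q'}),
    (forall a, i a = 0 -> a = 0) /\ forall p, p \in s -> exists t, t ^+ p.2 = i p.1.
Proof.
elim: s => [|p s IH] ps; first by exists Q, idfun.
have [|Q1 [i [i0 iE]]] := IH; first by move=> q qs; apply: ps; rewrite inE qs orbT.
have [|Q2 [j [t [j0 jE]]]] := @adjoin_root Q1 (i p.1) p.2; first by apply: ps; rewrite mem_head.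
exists Q2, (j \o i : {rmorphism Q -> Q2}); split=> [a /= /j0/i0 //|q].
rewrite inE => /orP[/eqP->|/iE[u uE]]; first by exists t.
by exists (j u); rewrite -rmorphXn uE.
Qed.

(** On a line bundle the product of two linear forms is symmetric. After inserting a sum of values
    of [b] equal to 1, the elements y, z and p.1 are permuted by the exchange rule, which each form
    respects. *)
Lemma rank1_forms (R R' : comPzRingType) (eta : {rmorphism R -> R'}) (N D : lmodType R)
  (b : N -> D -> R^o) (h h' : N -> R'^o) : is_tensor b ->
  semilinear_along eta h -> semilinear_along eta h' ->
  forall y z, (h y : R') * h' z = h z * h' y.
Proof.
move=> bT hl h'l y z; have [bb [s s1] b1 _] := tensor_dual_pair bT.
have hZ' c x : h (c *: x) = eta c * h x by exact: semilinearZ hl c x.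
have h'Z' c x : h' (c *: x) = eta c * h' x by exact: semilinearZ h'l c x.
rewrite -[LHS]mul1r -[RHS]mul1r -(rmorph1 eta) -s1 rmorph_sum !mulr_suml.
apply: eq_bigr => p _.
have e1 : eta (b p.1 p.2) * h y = eta (b y p.2) * h p.1 by rewrite -[LHS]hZ' b1 hZ'.
have e2 : eta (b y p.2) * h' z = eta (b z p.2) * h' y by rewrite -[LHS]h'Z' b1 h'Z'.
have e3 : eta (b z p.2) * h p.1 = eta (b p.1 p.2) * h z by rewrite -[LHS]hZ' b1 hZ'.
by rewrite mulrA e1 mulrAC e2 mulrAC e3 mulrA.
Qed.

Section LocalTrivialization.
Variables (R : comPzRingType) (n : nat) (M D : 'I_n -> lmodType R).
Variables (b : forall i, M i -> D i -> R^o).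
Hypothesis bT : forall i, is_tensor (@b i).

Definition frames := forall i : 'I_n, (M i * D i)%type.
Definition fval (j : frames) (i : 'I_n) : R := b (j i).1 (j i).2.

(** For each index the values of [b] generate the unit ideal, and so do their e-th powers. Varying
    the frame at one index only, with the others fixed, removes the factor of this index from the
    hypothesis. *)
Lemma fval_kill (e : nat) (u : seq 'I_n) (a : R) : uniq u ->
  (forall j : frames, (\prod_(i <- u) fval j i) ^+ e * a = 0) -> a = 0.
Proof.
elim: u a => [|i u IH] a /=; first by move=> _ /(_ (fun i => (0, 0))); rewrite big_nil expr1n mul1r.
move=> /andP[iu uu] h; apply: IH => // j.
have [s s1] := tensor_sum1 (bT i).
apply: (comax_pow (V := R^o) s1) => p _; exists e.
have := h (dfwith j p); rewrite big_cons {1}/fval dfwith_in exprMn -mulrA => E.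
rewrite -[RHS]E; congr (_ * (_ ^+ _ * _)); rewrite !big_seq; apply: eq_bigr => l lu.
by rewrite /fval dfwith_out //; apply: contraNneq iu => ->.
Qed.

(* The functions on all frames j = (m_i, d_i), localized at j |-> \prod_i b_i m_i d_i:
   there M_i has the linear form m |-> b_i m d_i, which is a trivialization. *)
Lemma trivialize_local : (1 : R) != 0 ->
  exists (R1 : comPzRingType) (eta : {rmorphism R -> R1})
    (t : forall i, M i -> R1^o) (s : forall i, D i -> R1^o),
  [/\ forall c, eta c = 0 -> c = 0, forall i, semilinear_along eta (@t i),
      forall i, semilinear_along eta (@s i) &
      forall i x y, (t i x : R1) * s i y = eta (b x y)].
Proof.
move=> nz.
pose Q : comPzRingType := (frames -> R).
pose f : Q := fun j => \prod_i fval j i.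
have fE e (a : Q) j : (f ^+ e * a) j = f j ^+ e * a j.
  by elim: e => [|e IH]; rewrite ?expr0 ?mul1r // !exprS -!mulrA -IH.
have fn e : f ^+ e <> 0.
  move=> fe; move/eqP: nz; apply; apply: (@fval_kill e (index_enum _)).
    exact: index_enum_uniq.
  move=> j; rewrite -[LHS]/(f j ^+ e * (1 : Q) j) -fE fe mul0r //.
have [R1 [io [g [g1 ker]]]] := localization fn.
have [co coE] := rmorph_of (R1 := R) (R2 := Q) (f := fun c _ => c)
  (fun _ _ => erefl) erefl (fun _ _ => erefl).
(* The dual form at i is y |-> b m_i y divided by [fval j i]; the division is written as
   multiplication by the other factors of f and by the inverse g of f. *)
exists R1, (io \o co : {rmorphism R -> R1}),
  (fun i x => io (fun j => b x (j i).2)),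
  (fun i y => io (fun j => b (j i).1 y * \prod_(l | l != i) fval j l) * g).
split=> [c|i a x y|i a x y|i x y] /=.
- move=> /ker[e]; rewrite coE => ec.
  apply: (@fval_kill e (index_enum _)) (index_enum_uniq _) _ => j.
  by have := congr1 (fun h : Q => h j) ec; rewrite /= fE.
- rewrite -[RHS]/(io (co a) * io (fun j => b x (j i).2) + io (fun j => b y (j i).2)).
  rewrite -rmorphM -rmorphD coE; congr (io _).
  apply: funext => j; rewrite -[RHS]/(a * b x (j i).2 + b y (j i).2).
  by have [_ br] := (bT i).1; rewrite br.
- pose F w : Q := fun j => b (j i).1 w * \prod_(l | l != i) fval j l.
  rewrite -[RHS]/(io (co a) * (io (F x) * g) + io (F y) * g).
  rewrite mulrA -rmorphM -mulrDl -rmorphD coE.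
  congr (io _ * _); apply: funext => j.
  rewrite -[RHS]/(a * (b (j i).1 x * \prod_(l | l != i) fval j l)
    + b (j i).1 y * \prod_(l | l != i) fval j l).
  by have [bl _] := (bT i).1; rewrite bl mulrDl mulrA.
- pose F : Q := fun j => b (j i).1 y * \prod_(l | l != i) fval j l.
  pose G : Q := fun j => b x (j i).2.
  rewrite -[LHS]/(io G * (io F * g)) -[RHS]/(io (co (b x y))) mulrA -rmorphM.
  rewrite -[RHS]mulr1 -g1 mulrA -rmorphM coE; congr (io _ * _).
  apply: funext => j.
  rewrite -[LHS]/((b x (j i).2 : R) * ((b (j i).1 y : R) * \prod_(l | l != i) fval j l)).
  rewrite -[RHS]/((b x y : R) * \prod_l fval j l) [X in _ = _ * X](bigD1 i) //=.
  rewrite !mulrA; congr (_ * _).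
  have [bb _ b1 _] := tensor_dual_pair (bT i).
  have := b1 x (j i).2 (j i).1 => /(congr1 (fun w => b w y)).
  by rewrite !(bilinZl bb) => E; rewrite [RHS]mulrC; exact: E.
Qed.
End LocalTrivialization.

Lemma prod_multilinear (R R' : comPzRingType) (eta : {rmorphism R -> R'}) (M : lmodType R)
  (t : M -> R'^o) n : semilinear_along eta t ->
  multilinear (fun x : 'I_n -> M => (\prod_j (t (x j) : R') : restrict_scalars eta R'^o)).
Proof.
move=> tl x i a u v.
have E w : \prod_j (t ([eta x with i |-> w] j) : R')
    = (t w : R') * \prod_(j | j != i) (t (x j) : R').
  rewrite (bigD1 i) //= eqxx; congr (_ * _); apply: eq_bigr => j /negbTE -> //.
rewrite !E tl -[RHS]/(eta a * _ + _) mulrA -mulrDl //.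
Qed.

Section Trivialization.
Variables (R : comPzRingType) (n : nat) (i0 : 'I_n) (r : 'I_n -> nat).
Variables (M D : 'I_n -> lmodType R) (b : forall i, M i -> D i -> R^o).
Variables (N Nd : lmodType R) (bN : N -> Nd -> R^o) (phi : forall i, ('I_(r i) -> M i) -> N).
Hypothesis r_gt0 : forall i, (0 < r i)%N.
Hypothesis bT : forall i, is_tensor (@b i).
Hypothesis bNT : is_tensor bN.
Hypothesis phiT : forall i, is_tensor_power (@phi i).

(* Two of the forms N -> R1 induced by the power maps differ by a unit v i i0; rescaling
   t0 i by an r i-th root of this unit makes the power maps compatible. *)
Lemma trivialize : exists (R' : comPzRingType) (eta : {rmorphism R -> R'})
    (t : forall i, M i -> R'^o) (s : forall i, D i -> R'^o) (tN : N -> R'^o),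
  [/\ forall c, eta c = 0 -> c = 0,
      (forall i, semilinear_along eta (@t i)) /\ (forall i, semilinear_along eta (@s i)),
      semilinear_along eta tN,
      forall i x y, (t i x : R') * s i y = eta (b x y) &
      forall i x, tN (@phi i x) = \prod_j (t i (x j) : R')].
Proof.
have [R0|nz] := eqVneq (1 : R) 0.
  have z (x y : R) : x = y by rewrite -[x]mulr1 -[y]mulr1 R0 !mulr0.
  exists R, idfun, (fun _ _ => 0), (fun _ _ => 0), (fun _ => 0).
  by split=> [c _||a x y|i x y|i x]; [exact: z|split=> i a x y; exact: z|exact: z..].
have [R1 [eta [t0 [s0 [eta0 t0l s0l ts]]]]] := trivialize_local bT nz.
have hex i : exists h : N -> restrict_scalars eta R1^o, linear h /\
    forall x, h (@phi i x) = \prod_j (t0 i (x j) : R1).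
  have [h [[hl hE] _]] := (phiT i).2 (restrict_scalars eta R1^o) _
    (prod_multilinear (n := r i) (t0l i)).
  by exists h.
pose h i : N -> R1^o := sval (cid (hex i)).
have hl i : semilinear_along eta (h i) := (svalP (cid (hex i))).1.
have hE i x : h i (@phi i x) = \prod_j (t0 i (x j) : R1) := (svalP (cid (hex i))).2 x.
(* The values of [h i] generate the unit ideal: those of [t0 i] do, and the power t0 i m ^+ r i is
   the value of [h i] at the power of m in N. *)
have h1 i : exists q : seq (N * R1), \sum_(p <- q) (h i p.1 : R1) * p.2 = 1.
  have I0 : exists q : seq (N * R1), \sum_(p <- q) (h i p.1 : R1) * p.2 = (0 : R1^o).
    by exists [::]; rewrite big_nil.
  have ID c (y z : R1^o) : (exists q : seq (N * R1), \sum_(p <- q) (h i p.1 : R1) * p.2 = y) ->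
      (exists q : seq (N * R1), \sum_(p <- q) (h i p.1 : R1) * p.2 = z) ->
      exists q : seq (N * R1), \sum_(p <- q) (h i p.1 : R1) * p.2 = c *: y + z.
    move=> [q <-] [q' <-]; exists ([seq (p.1, c * p.2) | p <- q] ++ q').
    rewrite big_cat big_map /= -[RHS]/(c * _ + _) mulr_sumr; congr (_ + _).
    by apply: eq_bigr => p _; rewrite mulrCA.
  pose U := Submod I0 ID.
  suff : qpi U 1 = 0 by move/qpi_eq0.
  have [q q1] := tensor_sum1 (bT i).
  have E : \sum_(p <- q) (t0 i p.1 : R1) * s0 i p.2 = 1.
    by rewrite -(rmorph1 eta) -q1 rmorph_sum; apply: eq_bigr => p _; exact: ts.
  apply: (comax_pow E) => p _; exists (r i).
  rewrite -[LHS]/(qscale _ _) qscaleE; apply/qpi_eq0.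
  exists [:: (@phi i (fun=> p.1), (s0 i p.2 : R1) ^+ r i)].
  by rewrite big_seq1 hE prodr_const card_ord -exprMn [RHS]mulr1.
pose q i := sval (cid (h1 i)).
have qE i : \sum_(p <- q i) (h i p.1 : R1) * p.2 = 1 := svalP (cid (h1 i)).
(* The ratio of [h j] to [h i], read off on elements where a combination of the values of [h i] is
   1; it is well defined by [rank1_forms], and [v j i] is its inverse. *)
pose v i j := \sum_(p <- q i) (h j p.1 : R1) * p.2.
have vE i j y : v i j * h i y = h j y.
  rewrite /v mulr_suml -[RHS]mulr1 -(qE i) mulr_sumr; apply: eq_bigr => p _.
  by rewrite mulrAC (rank1_forms bNT (hl j) (hl i)) mulrA.
have vv i j : v i j * v j i = 1.
  rewrite {2}/v mulr_sumr -(qE j); apply: eq_bigr => p _.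
  by rewrite mulrA vE.
have [|R2 [io [io0 ioE]]] := @adjoin_roots R1 [seq (v i i0, r i) | i <- enum 'I_n].
  by move=> p /mapP[i _ ->] /=.
have tex i : exists tau, tau ^+ r i = io (v i i0).
  by have := ioE (v i i0, r i); apply; apply: map_f; rewrite mem_enum.
pose tau i := sval (cid (tex i)).
have tauE i : tau i ^+ r i = io (v i i0) := svalP (cid (tex i)).
pose tai i := tau i ^+ (r i).-1 * io (v i0 i).
have tai1 i : tau i * tai i = 1.
  by rewrite /tai mulrA -exprS prednK // tauE -rmorphM vv rmorph1.
exists R2, (io \o eta : {rmorphism R -> R2}), (fun i x => tau i * io (t0 i x)),
  (fun i y => tai i * io (s0 i y)), (fun y => io (h i0 y)).
split=> [c /io0/eta0 //||a x y|i x y|i x] /=.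
- split=> i a x y.
    have -> : t0 i (a *: x + y) = eta a * t0 i x + t0 i y :> R1 by exact: t0l.
    by rewrite rmorphD rmorphM mulrDr mulrCA.
  have -> : s0 i (a *: x + y) = eta a * s0 i x + s0 i y :> R1 by exact: s0l.
  by rewrite rmorphD rmorphM mulrDr mulrCA.
- have -> : h i0 (a *: x + y) = eta a * h i0 x + h i0 y :> R1 by exact: hl.
  by rewrite rmorphD rmorphM.
- by rewrite mulrACA tai1 mul1r -rmorphM ts.
- by rewrite big_split /= prodr_const card_ord tauE -rmorph_prod -hE -rmorphM vE.
Qed.
End Trivialization.

(** * From roots of line bundles to torsors *)

(* The target is multiplied by k in order to evaluate polynomials in a nonzero ring. *)
Lemma mpoly_eval (k : closedFieldType) (n : nat) (B : comPzRingType) (h : {rmorphism k -> B})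
  (x : 'I_n -> B) :
  exists f : {rmorphism mpoly.mpoly n k -> B},
    (forall c, f (mpoly.mpolyC n c) = h c) /\ forall i, f (mpoly.mpolyX k (mpoly.mnm1 i)) = x i.
Proof.
have nz : (1 : (B * k)%type) != 0 by apply/eqP => -[_ /eqP]; rewrite oner_eq0.
pose C : comNzRingType := HB.pack (B * k)%type (GRing.PzSemiRing_isNonZero.Build (B * k)%type nz).
pose h' (c : k) : C := (h c, c).
have hB : {morph h' : x y / x - y}.
  by move=> a b; rewrite /h' rmorphB.
have h1 : h' 1 = 1 by rewrite /h' rmorph1.
have hM : {morph h' : x y / x * y} by move=> a b; rewrite /h' rmorphM.
have [g gE] := rmorph_of hB h1 hM.
pose x' i : C := (x i, 0).
pose p : {rmorphism C -> B} := fst : {rmorphism (B * k)%type -> B}.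
exists (p \o mpoly.mmap g x' : {rmorphism _ -> _}); split=> [c|i] /=.
  by rewrite mpoly.mmapC; exact: (congr1 (fun z : C => p z) (gE c)).
by rewrite mpoly.mmapX mpoly.mmap1U.
Qed.

Section FromSRing.
Variables (k : closedFieldType) (m : nat) (r : 'I_m.+3 -> nat).
Variables (hr : forall i, (1 < r i)%N) (lam : 'I_m.+3 -> p1pt k).
Local Notation S := (Salg hr lam).
Variables (B : comPzRingType) (h : {rmorphism k -> B}) (x : 'I_m.+3 -> B).
Hypothesis x_rel : forall i : 'I_m.+3, (1 < i)%N ->
  x i ^+ r i = x (ord2nd m) ^+ r (ord2nd m) - h (p1coord (lam i)) * x (ord1st m) ^+ r (ord1st m).

Lemma Smor_exists : exists f : {rmorphism S -> B},
  (forall c, f (kstr S c) = h c) /\ forall i, f (Sx hr lam i) = x i.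
Proof.
have [f [fC fX]] := mpoly_eval h x.
have f0 p : p \in Sideal hr lam -> f p = 0.
  move=> /asboolP[q ->]; rewrite rmorph_sum big1 // => i i1.
  rewrite rmorphM /Srel -mpoly.mul_mpolyC rmorphD rmorphB rmorphM !rmorphXn !fX fC.
  by rewrite (x_rel i1) [X in X + _]addrAC subrr add0r addNr mulr0.
pose g (a : S) : B := f (repr (a : Sring hr lam)).
have gE p : g (Spi hr lam p) = f p.
  apply/eqP; rewrite -subr_eq0 -rmorphB; apply/eqP/f0.
  by rewrite Quotient.idealrBE reprK.
have gB : {morph g : x y / x - y}.
  move=> a b; have [p ->] := Spi_surj a; have [q ->] := Spi_surj b.
  by rewrite -rmorphB !gE rmorphB.
have g1 : g 1 = 1 by rewrite -(rmorph1 (Spi hr lam)) gE rmorph1.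
have gM : {morph g : x y / x * y}.
  move=> a b; have [p ->] := Spi_surj a; have [q ->] := Spi_surj b.
  by rewrite -rmorphM !gE rmorphM.
have [g' g'E] := rmorph_of gB g1 gM.
by exists g'; split=> [c|i]; rewrite g'E; [exact: etrans (gE _) (fC c)|
  exact: etrans (gE _) (fX i)].
Qed.

Lemma Smor_graded (R : comPzRingType) (eta : {rmorphism R -> B}) (gr : grading (Lgrp r) eta)
  (f : {rmorphism S -> B}) :
  (forall c, gr 0 (f (kstr S c)) = f (kstr S c)) ->
  (forall i, gr (Lx r i) (f (Sx hr lam i)) = f (Sx hr lam i)) ->
  forall l a, f (Sgrading hr lam l a) = gr l (f a).
Proof.
move=> fc fx l a; have [p ->] := Spi_surj a.
have E (e : mpoly.multinom m.+3) (c : k) :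
    gr (Defs.mweight (Lx r) e) (f (Spi hr lam (c *: mpoly.mpolyX k e)))
    = f (Spi hr lam (c *: mpoly.mpolyX k e)).
  rewrite -mpoly.mul_mpolyC !rmorphM -[Defs.mweight _ _]add0r.
  apply: gr_homM; first exact: fc.
  rewrite mpoly.mpolyXE_id !rmorph_prod /Defs.mweight.
  elim/big_rec2: _ => [|i u v _ IH]; first exact: gr_one.
  apply: gr_homM => //; rewrite !rmorphXn.
  elim: (e i) => [|d IHd]; first by rewrite mulr0n expr0 gr_one.
  by rewrite mulrS exprS; apply: gr_homM => //; exact: fx.
rewrite -[LHS]/(f (Scomp l (Spi hr lam p))) Scomp_pi /mpoly_comp.
rewrite [in RHS](mpoly.mpolyE p) !rmorph_sum gr_sum big_mkcond /=.
apply: eq_bigr => e _; rewrite -[in RHS]E gcompK eq_sym.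
by case: eqP => // ->; rewrite E.
Qed.
End FromSRing.

(** * Rees algebras of invertible submodules as torsors *)

Section ReesTorsor.
Variables (L : zmodType) (R B : comPzRingType) (eta : {rmorphism R -> B}).
Variable K : mfilt B L.
Hypothesis eta0 : forall c, eta c = 0 -> c = 0.
Hypothesis K0 : K 0 = sone eta.
Hypothesis K1 : forall l, smul (K l) (K (- l)) 1.

Lemma rees_U_subproof l a : K l a -> forall m, K m (gco m (gU l a)).
Proof. by move=> h m; rewrite gcoU; case: eqP => [<-//|_]; exact: mfp0. Qed.
Definition rU l a (h : K l a) : rees K := inrees (rees_U_subproof h).
Lemma rco_U l a (h : K l a) m : rco m (rU h) = if l == m then a else 0.
Proof. exact: gcoU. Qed.
Lemma rcoB l : {morph @rco B L K l : x y / x - y}.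
Proof. by move=> x y; rewrite /rco raddfB gco_B. Qed.
Lemma rco0 l : rco l (0 : rees K) = 0.
Proof. by have := rcoB l 0 0; rewrite !subrr. Qed.
Lemma rcoD l : {morph @rco B L K l : x y / x + y}.
Proof. by move=> x y; apply/eqP; rewrite -subr_eq -rcoB addrK. Qed.
Lemma rco_sum l (I : Type) (s : seq I) (F : I -> rees K) :
  rco l (\sum_(i <- s) F i) = \sum_(i <- s) rco l (F i).
Proof. exact: (big_morph _ (rcoD l) (rco0 l)). Qed.
Lemma rU_M l a (h : K l a) m b (h' : K m b) : rU h * rU h' = rU (mfpM h h').
Proof. by apply: val_inj; exact: gUM. Qed.
Lemma rU_eq l a (h : K l a) m b (h' : K m b) : l = m -> a = b -> rU h = rU h'.
Proof. by move=> lm ab; apply: val_inj; rewrite /= lm ab. Qed.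

Lemma K_eta c : K 0 (eta c). Proof. by rewrite K0; exists c. Qed.
Definition reta (c : R) : rees K := rU (K_eta c).
Lemma reta_B : zmod_morphism reta.
Proof. by move=> x y; apply: val_inj; rewrite /= rmorphB gU_B. Qed.
Lemma reta_M : monoid_morphism reta.
Proof.
split=> [|x y]; first by apply: val_inj; rewrite /= rmorph1.
by rewrite /reta rU_M; apply: rU_eq; rewrite ?addr0 ?rmorphM.
Qed.
HB.instance Definition _ := GRing.isZmodMorphism.Build R (rees K) reta reta_B.
HB.instance Definition _ := GRing.isMonoidMorphism.Build R (rees K) reta reta_M.

Definition rgr (l : L) (x : rees K) : rees K := rU (rcoP l x).
Lemma rco_gr m l x : rco m (rgr l x) = if l == m then rco m x else 0.
Proof. by rewrite rco_U; case: eqP => [->|]. Qed.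

Definition rees_grading : grading L reta.
Proof.
refine (@Grading L R (rees K) reta rgr _ _ _ _ _).
- move=> l x y; apply: rees_ext => m; rewrite rcoB !rco_gr rcoB.
  by case: eqP => // _; rewrite subr0.
- move=> x; have [s [us xE]] := gringE (val x); exists s; split=> //.
  apply: rees_ext => m; rewrite rco_sum.
  under eq_bigr do rewrite rco_gr.
  rewrite {1}/rco xE gco_sum; apply: eq_bigr => l _; rewrite gcoU.
  by case: eqP => [->|].
- move=> l m x; apply: rees_ext => e; rewrite rco_gr.
  case: (eqVneq l m) => [->|lm]; first by rewrite rco_gr; case: eqP.
  by rewrite rco_gr rco0; case: eqP => // <-; rewrite eq_sym (negbTE lm).
- move=> l m x y; rewrite /rgr; apply: rees_ext => e; rewrite rU_M !rco_U.
  by rewrite eqxx.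
- move=> c; apply: rees_ext => m; rewrite rco_gr; case: eqP => // /eqP m0.
  by rewrite rco_U (negbTE m0).
Defined.

Lemma rees_strong : strong rees_grading.
Proof.
split.
- move=> c /(congr1 (rco 0)); rewrite rco_U eqxx rco0; exact: eta0.
- move=> a a0; have : K 0 (rco 0 a) by exact: rcoP.
  rewrite K0 => -[c ac]; exists c; apply: rees_ext => m.
  by rewrite -a0 rco_gr rco_U; case: eqP => // <-.
- move=> l; pose Q (z : B) := exists s : seq (rees K * rees K),
    \sum_(p <- s) rco l p.1 * rco (- l) p.2 = z.
  have [s sE] : Q 1.
    apply: (smul_le (K := Q) _ _ _ (@K1 l)) => [|x y [s sE] [s' s'E]|x y xK yK].
    - by exists [::]; rewrite big_nil.
    - exists (s ++ [seq (- p.1, p.2) | p <- s']); rewrite big_cat big_map /= sE -s'E.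
      rewrite -sumrN; congr (_ + _); apply: eq_bigr => p _.
      by have := rcoB l 0 p.1; rewrite !sub0r rco0 sub0r => ->; rewrite mulNr.
    - by exists [:: (rU xK, rU yK)]; rewrite big_seq1 /= !rco_U !eqxx.
  exists s; apply: rees_ext => m; rewrite rco_sum.
  have e1 : 1 = reta 1 by rewrite rmorph1.
  rewrite e1 rco_U rmorph1 -sE.
  transitivity (\sum_(p <- s) if 0 == m then rco l p.1 * rco (- l) p.2 else 0).
    by apply: eq_bigr => p _; rewrite rU_M rco_U subrr.
  by case: eqP => // _; rewrite big1.
Qed.

(** The Rees algebra is hidden behind the maps [co l], which identify T_l with the submodule K(l) of
    B; essential surjectivity works with these properties only. *)
Lemma rees_torsor : exists (T : torsor L R) (co : L -> T -> B),
  [/\ forall l x y, co l (x - y) = co l x - co l y,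
      forall l m x y, tgr T l x = x -> tgr T m y = y -> co (l + m) (x * y) = co l x * co m y,
      forall c, co 0 (tstr T c) = eta c,
      forall l x, tgr T l x = x -> co l x = 0 -> x = 0 &
      (forall l x, K l (co l x)) /\
      forall l a, K l a -> exists x, tgr T l x = x /\ co l x = a].
Proof.
exists (strong_torsor rees_strong), (fun l x => rco l x); split.
- by move=> l; exact: rcoB.
- move=> l m x y <- <-; rewrite rU_M !rco_U !eqxx //.
- by move=> c; rewrite rco_U eqxx.
- move=> l x xl x0; apply: rees_ext => m; rewrite -xl rco_gr rco0.
  by case: eqP => // <-.
- split=> [l x|l a h]; first exact: rcoP.
  exists (rU h); split; last by rewrite rco_U eqxx.
  apply: rees_ext => m; rewrite rco_gr rco_U; by case: eqP.
Qed.
End ReesTorsor.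

(** * Equivalences of fibred categories *)

Section EquivalenceCriterion.
Variables (k : closedFieldType) (X Y : fibcat k) (F : ffunctor X Y).
Hypothesis F_inj : forall (R R' : kalg k) (x : X R) (y : X R') (g g' : fhom x y),
  fnhom F g = fnhom F g' -> g = g'.
Hypothesis F_full : forall (R R' : kalg k) (x : X R) (y : X R')
  (h : fhom (F R x) (F R' y)), exists g, fnhom F g = h.
Hypothesis F_esurj : forall (R : kalg k) (y : Y R), exists x : X R, inhabited (fiso (F R x) y).

(** Object and isomorphism are packed in one type, so that a single application of choice yields
    both of them coherently. *)
Lemma F_esurj_sig R (y : Y R) : exists p : {x : X R & fiso (F R x) y}, True.
Proof. by have [x [i]] := F_esurj y; exists (existT _ x i). Qed.

Definition esurj_ob R (y : Y R) : X R := projT1 (sval (cid (F_esurj_sig y))).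
Definition esurj_iso R (y : Y R) : fiso (F R (esurj_ob y)) y := projT2 (sval (cid (F_esurj_sig y))).
Definition full_lift (R R' : kalg k) (x : X R) (y : X R') (h : fhom (F R x) (F R' y)) : fhom x y :=
  sval (cid (F_full h)).
Lemma full_liftE (R R' : kalg k) (x : X R) (y : X R') (h : fhom (F R x) (F R' y)) :
  fnhom F (full_lift h) = h.
Proof. exact: svalP (cid (F_full h)). Qed.

Definition quasi_inv_hom (R R' : kalg k) (x : Y R) (y : Y R') (f : fhom x y) :
  fhom (esurj_ob x) (esurj_ob y) :=
  full_lift (fcomp (esurj_iso x) (fcomp f (iso_inv (esurj_iso y)))).

Lemma kcomp1 (R R' : kalg k) (f : kmor R R') : kcomp (kid R) f = f.
Proof. exact: kmor_eq. Qed.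
Lemma kcomp1r (R R' : kalg k) (f : kmor R R') : kcomp f (kid R') = f.
Proof. exact: kmor_eq. Qed.

Definition quasi_inv : ffunctor Y X.
Proof.
refine (@Ffunctor k Y X esurj_ob quasi_inv_hom _ _ _).
- move=> R R' x y f; rewrite -(fn_over F) full_liftE !fover_comp iso_fun_over iso_inv_over.
  by rewrite kcomp1 kcomp1r.
- move=> R x; apply: F_inj; rewrite full_liftE fcomp1l fn_id; exact: iso_funK.
- move=> R R' R'' x y z f g; apply: F_inj; rewrite fn_comp !full_liftE.
  rewrite -!fcompA; congr (fcomp _ (fcomp _ _)).
  by rewrite (fcompA _ (esurj_iso y)) iso_invK fcomp1l.
Defined.

Definition quasi_inv_unit R (x : X R) : fiso (esurj_ob (F R x)) x.
Proof.
exists (full_lift (esurj_iso (F R x) : fhom (F R (esurj_ob (F R x))) (F R x)))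
  (full_lift (iso_inv (esurj_iso (F R x)))).
- by rewrite -(fn_over F) full_liftE iso_fun_over.
- by rewrite -(fn_over F) full_liftE iso_inv_over.
- by apply: F_inj; rewrite fn_comp !full_liftE fn_id iso_funK.
- by apply: F_inj; rewrite fn_comp !full_liftE fn_id iso_invK.
Defined.

Lemma equivalent_of_ff_esurj : equivalent X Y.
Proof.
exists F, quasi_inv; split; constructor.
  exists quasi_inv_unit => R R' x y f; apply: F_inj.
  rewrite !fn_comp /= !full_liftE -!fcompA; congr fcomp.
  by rewrite iso_invK fcomp1r.
exists esurj_iso => R R' x y f /=.
by rewrite full_liftE -!fcompA iso_invK fcomp1r.
Qed.
End EquivalenceCriterion.

Lemma linear_inv (R : comPzRingType) (M M' : lmodType R) (u : M -> M') (v : M' -> M) :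
  linear u -> cancel u v -> cancel v u -> linear v.
Proof. by move=> ul uv vu a x y; rewrite -[RHS]uv ul !vu. Qed.

(** The ring map is assumed to be the identity only pointwise, since the ring maps under arrows of
    the fibre product are identities by a propositional equality. *)
Lemma linear_iso_bc (R : comPzRingType) (f : R -> R) (M M' : lmodType R) (u : M -> M')
  (v : M' -> M) :
  f =1 id -> linear u -> cancel u v -> cancel v u -> is_base_change f u.
Proof.
move=> fid ul uv vu; split=> [a x y|R'' g N h hl]; first by rewrite fid ul.
exists (h \o v); split; first split=> [a x y|x] /=.
- by rewrite (linear_inv ul uv vu) hl /= fid.
- by rewrite uv.
- by move=> h' [_ h'E]; apply: funext => x /=; rewrite -h'E vu.
Qed.

Lemma base_change_id_inv (R : comPzRingType) (M M' : lmodType R) (u : M -> M') :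
  is_base_change idfun u -> exists v, cancel u v /\ cancel v u.
Proof.
move=> ub; have [ul uu] := ub.
have [|v [[vl vE] _]] := uu R idfun M id; first by [].
exists v; split=> // x.
have K0 : u (v 0) = 0.
  by rewrite (semilinear0 (f := idfun) vl) (semilinear0 (f := idfun) ul).
have KD a y z : u (v y) = y -> u (v z) = z -> u (v (a *: y + z)) = a *: y + z.
  by move=> ey ez; rewrite vl ul ey ez.
by apply: (base_change_ind (K := Submod K0 KD) ub) => y /=; rewrite vE.
Qed.

Lemma tensor_power_iso (R : comPzRingType) (n : nat) (M N N' : lmodType R)
  (phi : ('I_n -> M) -> N) (u : N -> N') (v : N' -> N) :
  linear u -> cancel u v -> cancel v u -> is_tensor_power phi ->
  is_tensor_power (u \o phi).
Proof.
move=> ul uv vu [pl pu]; split=> [x i a y z|P psi psil] /=; first by rewrite pl ul.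
have [h [[hl hE] hu]] := pu P psi psil.
exists (h \o v); split; first split=> [a x y|x] /=.
- by rewrite (linear_inv ul uv vu) hl.
- by rewrite uv hE.
- move=> h' [h'l h'E]; apply: funext => x /=.
  have -> : h = h' \o u by apply: hu; split=> [a y z|y] /=; rewrite ?ul ?h'l ?h'E.
  by rewrite /= vu.
Qed.

Lemma square_inv (k : closedFieldType) (Z : fibcat k) (R : kalg k) (a b a' b' : Z R)
  (f : fhom a b) (f' : fhom a' b') (i : fhom a a') (j : fhom b b')
  (g : fhom b a) (g' : fhom b' a') :
  fcomp f j = fcomp i f' -> fcomp g f = fid b -> fcomp f' g' = fid a' ->
  fcomp g i = fcomp j g'.
Proof.
move=> sq gf fg; rewrite -[LHS]fcomp1r -fg -fcompA [fcomp i _]fcompA -sq.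
by rewrite -fcompA fcompA gf fcomp1l.
Qed.

Section Groupoid.
Variables (k : closedFieldType) (R : kalg k).

Lemma p1_inv (x y : p1ob R) (f : p1hom x y) : p1h_over f = kid R ->
  exists g : p1hom y x, [/\ p1h_over g = kid R, p1_comp f g = p1_id x & p1_comp g f = p1_id y].
Proof.
move=> fo; have fb : is_base_change idfun (p1h_fun f).
  by have := p1h_bc f; rewrite fo.
have [v [uv vu]] := base_change_id_inv fb.
have ul : linear (p1h_fun f) by have [] := fb.
have vb : is_base_change (kid R) v.
  by apply: (linear_iso_bc (v := p1h_fun f)) => //; exact: linear_inv ul uv vu.
have vU : v (p1u y) = p1u x by rewrite -(p1h_u f) uv.
have vV : v (p1v y) = p1v x by rewrite -(p1h_v f) uv.
exists (P1hom vb vU vV); split=> //; apply: p1hom_eq; rewrite /= ?fo ?kcomp1 //.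
Qed.

Lemma p1_fun_inv (x y : p1ob R) (f : p1hom x y) (g : p1hom y x) :
  p1_comp f g = p1_id x -> cancel (p1h_fun f) (p1h_fun g).
Proof. by move=> e z; exact: (congr1 (fun h : p1hom x x => p1h_fun h z) e). Qed.

Lemma root_inv (r : nat) (pt : p1pt k) (x y : root_ob r pt R) (f : root_hom x y)
  (g : p1hom (rt_p1 y) (rt_p1 x)) :
  p1h_over (rth_p1 f) = kid R -> p1h_over g = kid R -> p1_comp (rth_p1 f) g = p1_id (rt_p1 x) ->
  p1_comp g (rth_p1 f) = p1_id (rt_p1 y) ->
  exists h : root_hom y x, [/\ rth_p1 h = g, Defs.root_comp f h = root_id x &
    Defs.root_comp h f = root_id y].
Proof.
move=> fo go fg gf; have fb : is_base_change idfun (rth_fun f).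
  by have := rth_bc f; rewrite fo.
have [v [uv vu]] := base_change_id_inv fb.
have ul : linear (rth_fun f) by have [] := fb.
have vb : is_base_change (p1h_over g) v.
  rewrite go; apply: (linear_iso_bc (v := rth_fun f)) => //; exact: linear_inv ul uv vu.
have vS : v (rt_sec y) = rt_sec x by rewrite -(rth_sec f) uv.
have vP m : p1h_fun g (rt_pow m) = rt_pow (v \o m).
  rewrite -[RHS](p1_fun_inv fg) rth_pow; congr (p1h_fun g (rt_pow _)).
  by apply: funext => i /=; rewrite vu.
exists (RootHom vb vS vP); split=> //; apply: root_hom_eq; rewrite //= ?fg ?gf //.
Qed.

(** A base change along the identity is bijective, so every arrow over the identity is invertible.
    Essential surjectivity is thereby reduced to the construction of an arrow in one direction. *)
Lemma fibprod_root_iso (n : nat) (r : 'I_n -> nat) (lam : 'I_n -> p1pt k)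
  (x y : fibprod (fun i => root_to_P1 (r i) (lam i)) R)
  (h : fhom x y) : fover h = kid R -> inhabited (fiso x y).
Proof.
move=> ho.
have [g0 [g0o hg gh]] := p1_inv (f := fph_base h) ho.
have co i : p1h_over (rth_p1 (fph_comp h i)) = kid R by rewrite -ho; exact: fph_over h i.
have gex i := p1_inv (co i).
pose g i := sval (cid (gex i)).
have [gP] : inhabited (forall i, [/\ p1h_over (g i) = kid R,
    p1_comp (rth_p1 (fph_comp h i)) (g i) = p1_id _ &
    p1_comp (g i) (rth_p1 (fph_comp h i)) = p1_id _]).
  by constructor => i; exact: svalP (cid (gex i)).
have cex i : exists c : root_hom (fp_comp y i) (fp_comp x i), [/\ rth_p1 c = g i,
    Defs.root_comp (fph_comp h i) c = root_id _ & Defs.root_comp c (fph_comp h i) = root_id _].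
  by have [go fg gf] := gP i; exact: root_inv.
pose c i := sval (cid (cex i)).
have cP i : [/\ rth_p1 (c i) = g i,
    Defs.root_comp (fph_comp h i) (c i) = root_id _ &
    Defs.root_comp (c i) (fph_comp h i) = root_id _].
  exact: svalP (cid (cex i)).
have cover i : p1h_over (rth_p1 (c i)) = p1h_over g0.
  by have [-> _ _] := cP i; have [-> _ _] := gP i.
have ciso i : @fcomp k (P1 k) _ _ _ _ _ _ g0 (fp_iso x i)
    = @fcomp k (P1 k) _ _ _ _ _ _ (fp_iso y i) (rth_p1 (c i)).
  have [-> _ _] := cP i; have [_ fg gf] := gP i.
  exact: (square_inv (Z := P1 k) (fph_iso h i) gh fg).
pose h' : fhom y x := @FprodHom k (P1 k) 'I_n (fun i => root_stack (r i) (lam i))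
    (fun i => root_to_P1 (r i) (lam i)) R R y x g0 c cover ciso.
constructor; exists h h'; rewrite //=.
- by apply: fibprod_hom_eq => //= i; have [_ + _] := cP i.
- by apply: fibprod_hom_eq => //= i; have [_ _ +] := cP i.
Qed.
End Groupoid.

(** * Essential surjectivity *)

(** Both A_l and M embed in B, by [co] and [t], with the same image; the isomorphism between them
    and its linearity are read off in B. *)
Lemma hpart_model (R : comPzRingType) (L : zmodType) (B A : comPzRingType)
  (eta : {rmorphism R -> B}) (etaA : {rmorphism R -> A}) (gr : grading L etaA) (l : L)
  (co : A -> B) (M : lmodType R) (t : M -> B^o) :
  (forall c, eta c = 0 -> c = 0) -> semilinear_along eta t -> (forall x, t x = 0 -> x = 0) ->
  (forall x y, co (x - y) = co x - co y) ->
  (forall c x, gr l x = x -> co (etaA c * x) = eta c * co x) ->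
  (forall x, gr l x = x -> co x = 0 -> x = 0) ->
  (forall x, gr l x = x -> exists y, co x = t y) ->
  (forall y, exists x, gr l x = x /\ co x = t y) ->
  exists u : hpart gr l -> M, [/\ forall w, t (u w) = co (hval w), linear u &
    exists v, cancel u v /\ cancel v u].
Proof.
move=> eta0 tl t0 coB coZ co0 cot tco.
have tinj x y : t x = t y -> x = y.
  by move=> e; apply/eqP; rewrite -subr_eq0; apply/eqP/t0; rewrite (semilinearB tl) e subrr.
have coinj (x y : hpart gr l) : co (hval x) = co (hval y) -> x = y.
  move=> e; apply: hval_inj; apply/eqP; rewrite -subr_eq0; apply/eqP/co0.
    by rewrite grB !hvalP.
  by rewrite coB e subrr.
have coD x y : co (x + y) = co x + co y.
  apply/eqP; rewrite -subr_eq -coB addrK //.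
have uex (w : hpart gr l) : exists y, co (hval w) = t y by apply: cot; exact: hvalP.
pose u w := sval (cid (uex w)).
have uE w : t (u w) = co (hval w) := esym (svalP (cid (uex w))).
have vex y : exists w : hpart gr l, co (hval w) = t y.
  by have [x [xl xy]] := tco y; exists (hin xl).
pose v y := sval (cid (vex y)).
have vE y : co (hval (v y)) = t y := svalP (cid (vex y)).
exists u; split=> // [a x y|].
  apply: tinj; rewrite tl !uE hval_lin coD coZ //; exact: hvalP.
exists v; split=> [w|y]; first by apply: coinj; rewrite vE uE.
by apply: tinj; rewrite uE vE.
Qed.

Lemma p1form_hom (k : closedFieldType) (R : kalg k) (pt : p1pt k) (x x' : p1ob R)
  (f : p1hom x x') : linear (p1h_fun f) -> p1h_fun f (p1form pt x) = p1form pt x'.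
Proof.
move=> fl; case: pt => [a|] /=; last exact: p1h_v.
have := fl (- kstr R a) (p1v x) (p1u x); rewrite p1h_u p1h_v !scaleNr.
by rewrite [- _ + p1u x]addrC [- _ + p1u x']addrC.
Qed.

Section EssSurj.
Variables (k : closedFieldType) (m : nat) (r : 'I_m.+3 -> nat).
Variables (hr : forall i, (1 < r i)%N) (lam : 'I_m.+3 -> p1pt k).
Hypothesis lam_1 : lam (ord1st m) = pinf.
Hypothesis lam_2 : lam (ord2nd m) = pfin 0.
Hypothesis lam_i : forall i : 'I_m.+3, (1 < i)%N -> lam i = pfin (p1coord (lam i)).
Local Notation S := (Salg hr lam).
Local Notation i1 := (ord1st m).
Local Notation i2 := (ord2nd m).
Local Notation X := (weighted_stack hr lam).
Local Notation Y := (fibprod (fun i : 'I_m.+3 => root_to_P1 (r i) (lam i))).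
Local Notation F := (torsor_roots hr lam_1 lam_2 lam_i).
Variables (R : kalg k) (y : Y R).

Let y0 : p1ob R := fp_base y.
Let ro i : root_ob (r i) (lam i) R := fp_comp y i.
Let al i : p1hom y0 (rt_p1 (ro i)) := iso_fun (fp_iso y i).
Let be i : p1hom (rt_p1 (ro i)) y0 := iso_inv (fp_iso y i).

Lemma al_over i : p1h_over (al i) = kid R. Proof. exact: iso_fun_over (fp_iso y i). Qed.
Lemma be_over i : p1h_over (be i) = kid R. Proof. exact: iso_inv_over (fp_iso y i). Qed.
Lemma albe i : cancel (p1h_fun (al i)) (p1h_fun (be i)).
Proof. apply: p1_fun_inv; exact: iso_funK (fp_iso y i). Qed.
Lemma beal i : cancel (p1h_fun (be i)) (p1h_fun (al i)).
Proof. apply: p1_fun_inv; exact: iso_invK (fp_iso y i). Qed.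
Lemma be_lin i : linear (p1h_fun (be i)).
Proof. by have [] := p1h_bc (be i); rewrite be_over. Qed.

Let phi i : ('I_(r i) -> rt_mod (ro i)) -> y0 := p1h_fun (be i) \o @rt_pow _ _ _ _ (ro i).

Lemma phiT i : is_tensor_power (@phi i).
Proof. exact: tensor_power_iso (@be_lin i) (@beal i) (@albe i) (rt_powP (ro i)). Qed.

Lemma phi_sec i : @phi i (fun=> rt_sec (ro i)) = p1form (lam i) y0.
Proof. by rewrite /phi /= rt_pow_sec; apply: p1form_hom; exact: be_lin. Qed.

Lemma esurj_hom : exists (x : X R) (h : fhom (F R x) y), fover h = kid R.
Proof.
have r0 i : (0 < r i)%N := ltnW (hr i).
have Dex i : exists q : {D : lmodType R & {b : rt_mod (ro i) -> D -> R^o | is_tensor b}}, True.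
  by have [D [b bT]] := rt_inv (ro i); exists (existT _ D (exist _ b bT)).
pose D i := projT1 (sval (cid (Dex i))).
pose b i : rt_mod (ro i) -> D i -> R^o := sval (projT2 (sval (cid (Dex i)))).
have bT i : is_tensor (@b i) := svalP (projT2 (sval (cid (Dex i)))).
have [Nd [bN bNT]] := p1inv y0.
have [B [eta [t [s [tN [eta0 [tl sl] tNl ts tNphi]]]]]] := trivialize i1 r0 bT bNT phiT.
pose I i (a : B) : Prop := exists x, a = t i x.
pose J i (a : B) : Prop := exists z, a = s i z.
pose N (a : B) : Prop := exists z, a = tN z.
have im_sm (V : lmodType R) (f : V -> B^o) : semilinear_along eta f ->
    is_sm eta (fun a : B => exists x, a = f x).
  move=> fl; split; first by exists 0; rewrite (semilinear0 fl).
    by move=> _ _ [x ->] [z ->]; exists (x - z); rewrite (semilinearB fl).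
  by move=> c _ [x ->]; exists (c *: x); rewrite (semilinearZ fl).
have Ism i : is_sm eta (I i) by exact: im_sm.
have Jsm i : is_sm eta (J i) by exact: im_sm.
have IJ i x z : I i x -> J i z -> sone eta (x * z).
  by move=> [a ->] [c ->]; exists (b i a c); rewrite -ts.
have IJ1 i : smul (I i) (J i) 1.
  have [q q1] := tensor_sum1 (bT i); rewrite -(rmorph1 eta) -q1 rmorph_sum.
  apply: addspan_sum => p _; rewrite -[eta _]ts; apply: smul_gen; first by exists p.1.
  by exists p.2.
have IN i : spow eta (I i) (r i) = N.
  apply: predeq.
    apply: spow_le; first exact: im_sm.
    move=> x xI; pose z j := sval (cid (xI j)).
    have zE j : x j = t i (z j) := svalP (cid (xI j)).
    by exists (@phi i z); rewrite tNphi; apply: eq_bigr => j _.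
  move=> _ [z ->].
  have [s0 sB sZ] : is_sm eta (spow eta (I i) (r i)).
    by case: (r i) => [|e]; [exact: sone_sm|apply: smul_sm; exact: Ism].
  have sD u v : spow eta (I i) (r i) u -> spow eta (I i) (r i) v ->
      spow eta (I i) (r i) (u + v).
    by move=> hu hv'; rewrite -[v]opprK -[- v]sub0r; apply: (sB) => //; exact: sB.
  have K0 : spow eta (I i) (r i) (tN 0) by rewrite (semilinear0 tNl).
  have KD a u v : spow eta (I i) (r i) (tN u) -> spow eta (I i) (r i) (tN v) ->
      spow eta (I i) (r i) (tN (a *: u + v)).
    by move=> Ku Kv; rewrite tNl; apply: (sD) => //; exact: (sZ a _ Ku).
  apply: (tensor_power_ind (K := Submod K0 KD) (@phiT i)) => w /=.
  by rewrite (tNphi i w); apply: spow_gen => j; exists (w j).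
have [H [[Hsm H0] HM H1 Hx Hc]] := invsub_hom i1 Ism Jsm IJ IJ1 IN.
have H01 : H 0 1 by rewrite H0; exists 1; rewrite rmorph1.
have Hz l : H l 0 by have [] := Hsm l.
have HB l u v : H l u -> H l v -> H l (u - v) by have [_ + _] := Hsm l; exact.
pose K := @Mfilt B (Lgrp r) H Hz HB H01 HM.
have [T [co [coB coM co_eta co0 [coK Kco]]]] :=
  @rees_torsor (Lgrp r) R B eta K eta0 H0 H1.
have coZ l c x : tgr T l x = x -> co l (tstr T c * x) = eta c * co l x.
  move=> xl; rewrite -co_eta -coM ?add0r //; exact: gr_scal.
have coX l x e : tgr T l x = x ->
    tgr T (l *+ e) (x ^+ e) = x ^+ e /\ co (l *+ e) (x ^+ e) = co l x ^+ e.
  move=> xl; elim: e => [|e [IH1 IH2]].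
    rewrite mulr0n !expr0 gr_one; split=> //.
    by rewrite -(rmorph1 (tstr T)) co_eta rmorph1.
  rewrite mulrS !exprS; split; first exact: gr_homM.
  by rewrite coM // IH2.
have coP l n (z : 'I_n -> T) : (forall j, tgr T l (z j) = z j) ->
    tgr T (l *+ n) (\prod_j z j) = \prod_j z j /\
    co (l *+ n) (\prod_j z j) = \prod_j co l (z j).
  elim: n z => [|n IH] z zl.
    rewrite mulr0n !big_ord0 gr_one; split=> //.
    by rewrite -(rmorph1 (tstr T)) co_eta rmorph1.
  have [h1 h2] := IH (fun j => z (lift ord0 j)) (fun j => zl _).
  rewrite mulrS !big_ord_recl; split; first exact: gr_homM.
  by rewrite coM // h2.
have sex i : exists a, tgr T (Lx r i) a = a /\ co (Lx r i) a = t i (rt_sec (ro i)).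
  by apply: Kco; rewrite /= Hx; exists (rt_sec (ro i)).
pose sg i := sval (cid (sex i)).
have sgl i : tgr T (Lx r i) (sg i) = sg i := (svalP (cid (sex i))).1.
have sgc i : co (Lx r i) (sg i) = t i (rt_sec (ro i)) := (svalP (cid (sex i))).2.
have sgr i : tgr T (Lc r) (sg i ^+ r i) = sg i ^+ r i /\
    co (Lc r) (sg i ^+ r i) = tN (p1form (lam i) y0).
  rewrite -(LxE r i); have [h1 h2] := coX _ _ (r i) (sgl i); split=> //.
  by rewrite h2 sgc -phi_sec tNphi prodr_const card_ord.
have tNfin a : tN (p1form (pfin a) y0) = tN (p1u y0) - eta (kstr R a) * tN (p1v y0).
  by have := tNl (- kstr R a) (p1v y0) (p1u y0); rewrite scaleNr addrC rmorphN scaleNr => ->;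
    rewrite addrC.
have coinj l x z : tgr T l x = x -> tgr T l z = z -> co l x = co l z -> x = z.
  move=> xl zl e; apply/eqP; rewrite -subr_eq0; apply/eqP/(co0 l).
    by rewrite grB xl zl.
  by rewrite coB e subrr.
have coD l u v : co l (u + v) = co l u + co l v.
  by apply/eqP; rewrite -subr_eq -coB addrK.
(* As lambda_1 is infinity and lambda_2 is 0, the forms cutting out these points are v and u - 0 v,
   so the corresponding powers of [sg i1] and [sg i2] represent v and u. *)
have [vl vc] := sgr i1; have [ul uc] := sgr i2.
rewrite lam_1 /= in vc; rewrite lam_2 tNfin !rmorph0 mul0r subr0 in uc.
pose hk : {rmorphism k -> T} := tstr T \o kstr R.
have sg_rel (i : 'I_m.+3) : (1 < i)%N ->
    sg i ^+ r i = sg i2 ^+ r i2 - hk (p1coord (lam i)) * sg i1 ^+ r i1.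
  move=> hi; have [wl wc] := sgr i; apply: (coinj (Lc r)) => //.
    by rewrite grB ul gr_scale vl.
  by rewrite wc (lam_i hi) tNfin coB uc coZ // vc -(lam_i hi).
have [psi [psi_k psi_x]] := Smor_exists hr sg_rel.
have psi_eq l a : psi (Sgrading hr lam l a) = tgr T l (psi a).
  apply: Smor_graded => [c|i]; first by rewrite psi_k; exact: gr_scal.
  by rewrite psi_x sgl.
(* The image of N in B has the inverse H(-c), and u and v generate N; hence 1 is a combination of u
   and v with coefficients in H(-c), which are lifted to degree -c of T. *)
have [z [z' [zl z'l zz]]] : exists z z' : T, [/\ tgr T (- Lc r) z = z, tgr T (- Lc r) z' = z' &
    z * sg i2 ^+ r i2 + z' * sg i1 ^+ r i1 = 1].
  pose Q (w : B) := exists z z' : T, [/\ tgr T (- Lc r) z = z, tgr T (- Lc r) z' = z' &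
    co 0 (z * sg i2 ^+ r i2 + z' * sg i1 ^+ r i1) = w].
  have coQ (a c : T) : tgr T (- Lc r) a = a -> tgr T (- Lc r) c = c ->
      co 0 (a * sg i2 ^+ r i2 + c * sg i1 ^+ r i1)
      = co (- Lc r) a * tN (p1u y0) + co (- Lc r) c * tN (p1v y0).
    move=> a1 c1; rewrite coD -(addNr (Lc r)) !coM // uc vc //.
  suff [z [z' [zl z'l e]]] : Q 1.
    exists z, z'; split=> //; apply: (coinj 0).
    - by rewrite grD -(addNr (Lc r)) !gr_homM.
    - exact: gr_one.
    - by rewrite e -(rmorph1 (tstr T)) co_eta rmorph1.
  apply: (smul_le (K := Q) _ _ _ (H1 (Lc r))).
  - by exists 0, 0; rewrite !gr_0 !mul0r addr0; split=> //; have := coB 0 0 0; rewrite !subrr.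
  - move=> _ _ [a [a' [al' a'l <-]]] [c [c' [cl c'l <-]]]; exists (a - c), (a' - c').
    rewrite !grB al' a'l cl c'l; split=> //; rewrite -coB; congr (co 0 _).
    by rewrite !mulrBl opprD addrACA.
  - rewrite Hc => _ w [n ->] wH.
    have [z [zl zw]] : exists z, tgr T (- Lc r) z = z /\ co (- Lc r) z = w by exact: Kco.
    have [a [c nE]] := p1gen n.
    exists (tstr T a * z), (tstr T c * z); rewrite !gr_scale zl; split=> //.
    rewrite coQ ?gr_scale ?zl // !coZ // zw nE.
    rewrite (semilinearD tNl) !(semilinearZ tNl).
    by rewrite -[_ *: tN _]/(_ * _) mulrDl; congr (_ + _); rewrite mulrAC.
have avoid : exists c : 'I_m.+3 -> T, \sum_i c i * psi (Sx hr lam i) = 1.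
  (* The first two generators are already comaximal: u and v are positive powers of x_2 and x_1, and
     all but one factor goes into the coefficient. *)
  exists (fun i => if i == i1 then z' * sg i1 ^+ (r i1).-1
                   else if i == i2 then z * sg i2 ^+ (r i2).-1 else 0).
  rewrite (bigD1 i1) // (bigD1 i2) //= big1 ?addr0 => [|i /andP[/negbTE-> /negbTE->]]; last first.
    by rewrite mul0r.
  by rewrite !psi_x -!mulrA -!exprSr !prednK ?r0 // addrC.
pose x : quot_ob (Sgrading hr lam) (Sx hr lam) R := QuotOb psi_k psi_eq avoid.
exists x.
have ti0 i w : t i w = 0 -> w = 0.
  move=> w0; have [bb [q q1] b1 _] := tensor_dual_pair (bT i).
  rewrite -[w]scale1r -[X in X *: _]q1 scaler_suml big1 // => p _.
  rewrite b1; suff -> : b i w p.2 = 0 by rewrite scale0r.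
  by apply: eta0; rewrite -ts w0 mul0r.
(* In place of a dual form as for the M_i, the inverse H(-c) is used: the values of [tN] generate
   the unit ideal of B, and by the exchange rule [bN w n] times such a value is a multiple of
   [tN w]. *)
have tN0 w : tN w = 0 -> w = 0.
  move=> w0; have [bb [q q1] b1 _] := tensor_dual_pair bNT.
  have tNZ := semilinearZ tNl.
  have kill n : bN w n = 0.
    apply: eta0; pose Q (v : B) := eta (bN w n) * v = 0.
    suff : Q 1 by rewrite /Q mulr1.
    apply: (smul_le (K := Q) _ _ _ (H1 (Lc r))); rewrite /Q.
    - by rewrite mulr0.
    - by move=> u v u0 v0; rewrite mulrBr u0 v0 subrr.
    - rewrite Hc => _ v [p ->] _; rewrite mulrA.
      have -> : eta (bN w n) * tN p = 0; last by rewrite mul0r.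
      by rewrite -[LHS](tNZ (bN w n) p) b1 tNZ w0; exact: mulr0.
  rewrite -[w]scale1r -[X in X *: _]q1 scaler_suml big1 // => p _.
  by rewrite b1 kill scale0r.
have tNinj v w : tN v = tN w -> v = w.
  move=> e; apply/eqP; rewrite -subr_eq0; apply/eqP/tN0.
  by rewrite (semilinearB tNl) e subrr.
have tiinj i v w : t i v = t i w -> v = w.
  move=> e; apply/eqP; rewrite -subr_eq0; apply/eqP/(ti0 i).
  by rewrite (semilinearB (tl i)) e subrr.
have [uN [uNE uNl [vN [uvN vuN]]]] : exists u : hpart (tgr T) (Lc r) -> y0,
    [/\ forall w, tN (u w) = co (Lc r) (hval w), linear u & exists v, cancel u v /\ cancel v u].
  apply: (hpart_model eta0 tNl tN0 (coB _)) => [c w|w|w wl|w]; [exact: coZ|exact: co0| |].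
  - by have := coK (Lc r) w; rewrite /= Hc.
  - by apply: Kco; rewrite /= Hc; exists w.
have uex i : exists u : hpart (tgr T) (Lx r i) -> rt_mod (ro i),
    [/\ forall w, t i (u w) = co (Lx r i) (hval w), linear u & exists v, cancel u v /\ cancel v u].
  apply: (hpart_model eta0 (tl i) (ti0 i) (coB _)) => [c w|w|w wl|w]; [exact: coZ|exact: co0| |].
  - by have := coK (Lx r i) w; rewrite /= Hx.
  - by apply: Kco; rewrite /= Hx; exists w.
pose u i := sval (cid (uex i)).
have uP i : [/\ forall w, t i (u i w) = co (Lx r i) (hval w), linear (u i) &
    exists v, cancel (u i) v /\ cancel v (u i)] := svalP (cid (uex i)).
have uE i w : t i (u i w) = co (Lx r i) (hval w) by have [+ _ _] := uP i; exact.
have qsE i : qs x i = sg i by exact: psi_x.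
have uU : uN (qu x) = p1u y0 by apply: tNinj; rewrite uNE [hval _](hval_qpow x i2) qsE.
have uV : uN (qv x) = p1v y0 by apply: tNinj; rewrite uNE [hval _](hval_qpow x i1) qsE.
pose q0 : p1ob R := fp_base (F R x).
have uNb : is_base_change (kid R) uN by exact: (linear_iso_bc (v := vN)).
pose h0 : p1hom q0 y0 := @P1hom k R R q0 y0 (kid R) uN uNb uU uV.
pose qi i : root_ob (r i) (lam i) R := fp_comp (F R x) i.
have ub i : is_base_change (kcomp (kid R) (p1h_over (al i))) (u i).
  have [_ uil [v [uv vu]]] := uP i; apply: (linear_iso_bc (v := v)) => // c /=.
  by rewrite al_over.
have us i : u i (qsec x i) = rt_sec (ro i).
  by apply: (tiinj i); rewrite uE hval_in qsE.
have up i w : p1h_fun (al i) (uN (qpow (x := x) (i := i) w)) = rt_pow (u i \o w).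
  rewrite -[RHS](@beal i); congr (p1h_fun (al i) _); apply: tNinj.
  rewrite uNE hval_mul -[p1h_fun _ _]/(@phi i (u i \o w)) tNphi -{1}(LxE r i).
  have [_ ->] := coP (Lx r i) (r i) (fun j => hval (w j)) (fun j => hvalP (w j)).
  by apply: eq_bigr => j _; rewrite uE.
pose hi i : root_hom (qi i) (ro i) :=
  @RootHom k (r i) (lam i) R R (qi i) (ro i) (p1_comp h0 (al i)) (u i) (ub i) (us i) (@up i).
have ho i : fover (hi i : @fhom k (root_stack (r i) (lam i)) _ _ _ _) = kid R.
  by apply: kmor_eq => c /=; rewrite al_over.
have hiso i : @fcomp k (P1 k) _ _ _ _ _ _ h0 (fp_iso y i)
    = @fcomp k (P1 k) _ _ _ _ _ _ (fp_iso (F R x) i) (rth_p1 (hi i)).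
  exact: esym (@fcomp1l k (P1 k) _ _ _ _ _).
by exists (@FprodHom k (P1 k) 'I_m.+3 (fun i => root_stack (r i) (lam i))
  (fun i => root_to_P1 (r i) (lam i)) R R (F R x) y h0 hi ho hiso).
Qed.
End EssSurj.

Lemma lamseq_1 (k : closedFieldType) (m : nat) (lam : 'I_m -> k) :
  lamseq lam (ord1st m) = pinf.
Proof.
rewrite /lamseq; case: splitP => j e //=.
by have <- : ord0 = j by exact: val_inj.
Qed.

Lemma lamseq_2 (k : closedFieldType) (m : nat) (lam : 'I_m -> k) :
  lamseq lam (ord2nd m) = pfin 0.
Proof.
rewrite /lamseq; case: splitP => j e //=.
by rewrite -e.
Qed.

Lemma lamseq_i (k : closedFieldType) (m : nat) (lam : 'I_m -> k) (i : 'I_m.+3) :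
  (1 < i)%N -> lamseq lam i = pfin (p1coord (lamseq lam i)).
Proof.
rewrite /lamseq; case: splitP => j //= ->.
by case: j => [[|[|[|j]]] lj].
Qed.

Theorem theorem1p2 (k : closedFieldType) (char0 : [pchar k]%R =i pred0)
  (m : nat) (r : 'I_m.+3 -> nat) (hr : forall i, (1 < r i)%N) (lam : 'I_m -> k) :
  equivalent
    (weighted_stack hr (lamseq lam))
    (fibprod (fun i : 'I_m.+3 => root_to_P1 (r i) (lamseq lam i))).
Proof.
have l1 := lamseq_1 lam; have l2 := lamseq_2 lam; have li := @lamseq_i _ _ lam.
apply: (@equivalent_of_ff_esurj _ _ _ (torsor_roots hr l1 l2 li)) => [R R' x y g g'|R R' x y h|R y].
- exact: torsor_roots_faithful.
- exact: torsor_roots_full.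
- have [x [h ho]] := esurj_hom hr l1 l2 li y.
  by exists x; exact: (fibprod_root_iso ho).
Qed.
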